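(* Let $a$ be a symmetric, sub-gaussian random variable with $\mathbb{E}a^2=1$ and sub-gaussian norm $\kappa$. Let $\mathbf{a}_1,\dots,\mathbf{a}_m$ be independent random vectors in $\mathbb{R}^n$ whose coordinates are i.i.d. copies of $a$. Let $K\subseteq B_2^n$ and fix $\mathbf{x}\in K$ with $\|\mathbf{x}\|_2=1$. Let $\theta:\mathbb{R}\to[-1,1]$ be a $C^3$ function with $\|\theta'\|_\infty\le\tau_1$, $\|\theta''\|_\infty\le\tau_2$, $\|\theta'''\|_\infty\le\tau_3$, and with $\lambda:=\mathbb{E}\,\theta(g)g>0$ where $g\sim N(0,1)$. Let $y_1,\dots,y_m$ be $\{-1,1\}$-valued random variables which, conditionally on $\{\mathbf{a}_i\}$, are independent and satisfy $\mathbb{E}(y_i\mid\mathbf{a}_i)=\theta(\langle\mathbf{a}_i,\mathbf{x}\rangle)$. Then for each $\beta>0$, with probability at least $1-4e^{-\beta^2}$, the solution $\widehat{\mathbf{x}}$ of $$\max \sum_{i=1}^m y_i\langle \mathbf{a}_i,\mathbf{x}'\rangle\quad\text{subject to}\quad \mathbf{x}'\in K$$ satisfies $$\|\mathbf{x}-\widehat{\mathbf{x}}\|_2^2\le C\Big(\frac{\kappa^4}{\lambda}(\tau_2+\tau_3)\|\mathbf{x}\|_\infty+\frac{\kappa}{\lambda\sqrt{m}}\big(w(K)+\beta\big)\Big),$$ where $C>0$ is an absolute constant.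
   Context: $B_2^n$ is the closed Euclidean unit ball of $\mathbb{R}^n$. The sub-gaussian norm is $\kappa=\sup_{q\ge1}q^{-1/2}(\mathbb{E}|a|^q)^{1/q}<\infty$. The Gaussian mean width is $w(K)=\mathbb{E}\sup_{\mathbf{u}\in K-K}\langle\mathbf{g},\mathbf{u}\rangle$ with $\mathbf{g}$ a standard Gaussian vector in $\mathbb{R}^n$. *)

(* Defs.v *)
From HB Require Import structures.
From mathcomp Require Import all_boot all_order all_algebra.
From mathcomp Require Import all_classical all_reals all_analysis.

Set Implicit Arguments.
Unset Strict Implicit.
Unset Printing Implicit Defensive.

Import Order.TTheory GRing.Theory Num.Theory.
Import numFieldNormedType.Exports.

Local Open Scope classical_set_scope.
Local Open Scope ring_scope.

Section Defs.
Context {R : realType}.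

Definition dotv n (u v : 'rV[R]_n) : R := \sum_(j < n) u 0 j * v 0 j.
Definition norm2 n (u : 'rV[R]_n) : R := Num.sqrt (dotv u u).
Definition norminf n (u : 'rV[R]_n) : R := \big[Num.max/0]_(j < n) `|u 0 j|.
Definition unit_ball n : set 'rV[R]_n := [set u | norm2 u <= 1].
Definition minkowski_diff n (K : set 'rV[R]_n) : set 'rV[R]_n :=
  [set z | exists u v, K u /\ K v /\ z = u - v].

Definition same_law d (T : measurableType d) (P : probability T R)
  (X : T -> R) (mu : set R -> \bar R) : Prop :=
  forall B : set R, measurable B -> P (X @^-1` B) = mu B.

Definition symmetric_law (mu : probability R R) : Prop :=
  forall B : set R, measurable B -> mu [set - t | t in B] = mu B.

(** Sub-gaussian norm  sup_{q >= 1} q^{-1/2} (E|a|^q)^{1/q}  of a law mu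
    (as an extended real; a is sub-gaussian iff this is finite). *)
Definition subgaussian_norm (mu : probability R R) : \bar R :=
  ereal_sup [set ((q `^ (- 2^-1))%:E *
                  ((\int[mu]_t (`|t| `^ q)%:E) `^ q^-1)%E)%E
            | q in [set q : R | 1 <= q]].

Definition mutually_independent d (T : measurableType d) (P : probability T R)
  (I : finType) (X : I -> T -> R) : Prop :=
  forall B : I -> set R, (forall i, measurable (B i)) ->
    P (\bigcap_(i in [set: I]) (X i @^-1` B i)) =
    (\prod_(i : I) fine (P (X i @^-1` B i)))%:E.

Definition gen_sigma d (T : measurableType d) (I : Type) (X : I -> T -> R)
  : set (set T) :=
  <<s setT, \bigcup_(i in [set: I]) preimage_set_system setT (X i) measurable >>.

(** Conditional model for {-1,1}-valued responses: conditionally on the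
    sigma-algebra F, the Y_i are independent and E(Y_i | F) = p_i, i.e.
    P(Y_i = s_i for all i | F) = prod_i (1 + s_i p_i)/2.  Written without
    conditional expectation (absent from the library) via its defining
    property: for every G in F,
    P(G /\ {Y = s}) = int_G prod_i (1 + s_i p_i)/2 dP. *)
Definition cond_pm1_model d (T : measurableType d) (P : probability T R)
  (F : set (set T)) (m : nat) (Y : 'I_m -> T -> R) (p : 'I_m -> T -> R)
  : Prop :=
  forall (s : 'I_m -> bool) (G : set T), F G ->
    P (G `&` [set w | forall i, Y i w = (if s i then 1 else -1)]) =
    (\int[P]_(w in G)
        (\prod_(i < m) ((1 + (if s i then 1 else -1) * p i w) / 2))%:E)%E.

Definition C3 (f : R -> R) : Prop :=
  (forall t, derivable f t 1) /\
  (forall t, derivable (derive1n 1 f) t 1) /\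
  (forall t, derivable (derive1n 2 f) t 1) /\
  continuous (derive1n 3 f).

(** Gaussian mean width  w(K) = E sup_{u in K-K} <g,u>, computed on a
    probability space PQ carrying a standard Gaussian vector g = (G_j)_j. *)
Definition mean_width dQ (Q : measurableType dQ) (PQ : probability Q R)
  n (G : 'I_n -> Q -> R) (K : set 'rV[R]_n) : \bar R :=
  (\int[PQ]_w ereal_sup [set (dotv (\row_j G j w) u)%:E
                        | u in minkowski_diff K])%E.

Definition objective m n (A : 'I_m -> 'I_n -> R) (y : 'I_m -> R)
  (x' : 'rV[R]_n) : R :=
  \sum_(i < m) y i * dotv (\row_j A i j) x'.

End Defs.

(* Main.v *)
(** Let [u_i = y_i a_i], whose mean is [v] with [v_j = E theta(<a,x>) a_j], and
[z = x - xh]. Optimality of [xh] reads [<sum_i u_i, z> <= 0], hence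
[m <v,z> <= sup_(u in K) <sum_i (u_i - v), u - x>], while
[|z|^2 <= 2 <x,z>] because [|xh| <= 1 = |x|].

Bias: [<v,z>] is close to [lambda <x,z>]. A third-order Taylor expansion in the
coordinate [a_j] gives [v_j = x_j E theta'(<a,x>) + O(|x_j|^3)], and replacing the
coordinates of [a] one by one by Gaussians (Lindeberg) gives
[E theta(<a,x>) <a,x> = lambda + O(sum_j |x_j|^3)], where
[sum_j |x_j|^3 <= norminf x].

Deviation: for convex test functions a symmetric sub-gaussian law with unit
variance is dominated by a Gaussian of standard deviation [128 kappa]. After
symmetrization the exponential moments of the supremum over a finite set are
therefore bounded by those of a supremum of a Gaussian process, for which the
rotation invariance of the Gaussian law yields a concentration inequality.
Chernoff's bound and a countable dense subset of [K] finish the proof. *)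

Require Import Defs.
From HB Require Import structures.
From mathcomp Require Import all_boot all_order all_algebra.
From mathcomp Require Import all_classical all_reals all_analysis.
From mathcomp Require Import measurable_realfun ring lra.

Import Order.TTheory GRing.Theory Num.Theory.
Import numFieldNormedType.Exports.

Local Open Scope classical_set_scope.
Local Open Scope ring_scope.

(** * Product spaces and iterated integrals *)

(** Expectations are mostly integrals of nonnegative functions, taken one coordinate at a time by
    Tonelli. A signed quantity such as theta(<a,x>) a_j first receives a summand like 1 + a_j^2,
    which makes it nonnegative and has a known mean.

    The label y_i depends on the row a_i, so the coordinates of u_i are in general neither
    independent nor symmetric, and the Gaussian comparison does not apply to u_i itself. Jensen's
    inequality on the mean, then averaging over both signs, lead back to the bare row a_i.

    Concentration uses no differential inequality. For independent copies X and Y, convexity bounds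
    the exponential moment of the step from X to (X + Y) / sqrt 2 by a moment at a smaller
    parameter, and rotation invariance treats the step from there to Y alike. The result is a
    self-bounding inequality for the logarithm of the moment.

    The slope E theta'(<a,x>) is never compared with its Gaussian analogue: the expansion of v
    tested on x, and the replacement of a by a Gaussian, both evaluate <v,x>, and this ties the
    slope to lambda. *)

(* An alias of [I -> E] that carries the product sigma-algebra. *)
Definition env (I : Type) (E : Type) := I -> E.

(** Ended by [Qed]: the display stays opaque, so that the structure on [env I E] is never confused
    with one carrying the display [d]. *)
Definition env_display : measure_display -> measure_display.
Proof. exact. Qed.

Section EnvMeasurable.
Context {d : measure_display} {E : measurableType d} {I : Type}.

Let cyl : set (set (env I E)) :=
  <<s \bigcup_(i in [set: I])
       preimage_set_system setT (fun c : env I E => c i) measurable >>.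

Let cyl0 : cyl set0. Proof. exact: sigma_algebra0. Qed.

Let cylC A : cyl A -> cyl (~` A). Proof. exact: sigma_algebraC. Qed.

Let cyl_bigcup (F : (set (env I E))^nat) :
  (forall i, cyl (F i)) -> cyl (\bigcup_i F i).
Proof. exact: sigma_algebra_bigcup. Qed.

HB.instance Definition _ := Pointed.copy (env I E) (I -> E).
HB.instance Definition _ := @isMeasurable.Build (env_display d) (env I E)
  cyl cyl0 cylC cyl_bigcup.

Lemma measurable_coord (i : I) : measurable_fun setT (fun c : env I E => c i).
Proof.
move=> _ Y mY; rewrite setTI; apply: sub_sigma_algebra.
by exists i => //; exists Y => //; rewrite setTI.
Qed.

Lemma measurable_env d' (S : measurableType d') (f : S -> env I E) :
  (forall i, measurable_fun setT (fun s => f s i)) -> measurable_fun setT f.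
Proof.
move=> mf.
pose C := \bigcup_(i in [set: I])
  preimage_set_system setT (fun c : env I E => c i) measurable.
apply: (measurability C) => //.
move=> _ [_ [i _ [B mB <-]] <-]; rewrite setTI.
rewrite setTI; have := mf i measurableT _ mB; rewrite setTI; exact.
Qed.

End EnvMeasurable.

Section Update.
Context {d : measure_display} {E : measurableType d} {I : eqType}.

Definition update (c : env I E) (i : I) (t : E) : env I E :=
  fun j => if j == i then t else c j.

Lemma measurable_update (i : I) :
  measurable_fun setT (fun p : env I E * E => update p.1 i p.2).
Proof.
apply: measurable_env => j; rewrite /update; case: (j == i).
  exact: measurable_snd.
exact: (measurableT_comp (measurable_coord j) measurable_fst).
Qed.

Lemma measurable_updater (i : I) (c : env I E) :
  measurable_fun setT (fun t : E => update c i t).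
Proof. by apply: measurable_env => j; rewrite /update; case: (j == i). Qed.

Lemma updateC (c : env I E) i j s t : i != j ->
  update (update c i s) j t = update (update c j t) i s.
Proof.
move=> ij; apply/funext => k; rewrite /update.
by case: eqP => // ->; case: eqP => // ji; rewrite ji eqxx in ij.
Qed.

End Update.

Section IteratedIntegral.
Context {R : realType} {d : measure_display} {E : measurableType d} {I : eqType}.
Local Open Scope ereal_scope.

(** The head of [l] is the outermost variable, and indices outside [l] keep their value in [c].
    Integrating along a list instead of against a product measure lets the replacement arguments be
    inductions that touch one coordinate. *)
Fixpoint itint (nu : I -> probability E R) (l : seq I)
    (f : env I E -> \bar R) (c : env I E) : \bar R :=
  if l is i :: l' then \int[nu i]_t itint nu l' f (update c i t) else f c.

Lemma integral_update_ge0 (nu : probability E R) i (f : env I E -> \bar R) c :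
  (forall c, 0 <= f c) -> 0 <= \int[nu]_t f (update c i t).
Proof. by move=> f0; apply: integral_ge0 => t _; exact: f0. Qed.

Lemma measurable_integral_update (nu : probability E R) i
    (f : env I E -> \bar R) :
  measurable_fun setT f -> (forall c, 0 <= f c) ->
  measurable_fun setT (fun c => \int[nu]_t f (update c i t)).
Proof.
move=> mf f0.
apply: (@measurable_fun_fubini_tonelli_F _ _ (env I E) E R nu
  (fun p => f (update p.1 i p.2))) => //.
exact: measurableT_comp mf (measurable_update i).
Qed.

Lemma itint_ge0 nu l f c : (forall c, 0 <= f c) -> 0 <= itint nu l f c.
Proof.
by elim: l c => [|i l IH] c f0 //=; apply: integral_ge0 => t _; exact: IH.
Qed.

Lemma measurable_itint nu l f : measurable_fun setT f -> (forall c, 0 <= f c) ->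
  measurable_fun setT (itint nu l f).
Proof.
move=> mf f0; elim: l => [|i l IH] //=.
by apply: measurable_integral_update => // c; exact: itint_ge0.
Qed.

Lemma measurable_comp_update i (f : env I E -> \bar R) c :
  measurable_fun setT f -> measurable_fun setT (fun t => f (update c i t)).
Proof. by move=> mf; exact: measurableT_comp mf (measurable_updater i c). Qed.

Lemma le_itint nu l f g c :
  measurable_fun setT f -> (forall c, 0 <= f c) ->
  measurable_fun setT g -> (forall c, f c <= g c) ->
  itint nu l f c <= itint nu l g c.
Proof.
move=> mf f0 mg fg.
have g0 c' : 0 <= g c' by exact: le_trans (f0 c') (fg c').
elim: l c => [|i l IH] c //=; apply: ge0_le_integral => //.
- by move=> t _; exact: itint_ge0.
- by apply: measurable_comp_update; exact: measurable_itint.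
- by apply: measurable_comp_update; exact: measurable_itint.
Qed.

Lemma eq_itint nu l f g c : f =1 g -> itint nu l f c = itint nu l g c.
Proof. by move=> fg; congr itint; apply/funext. Qed.

Lemma itint_cat nu l1 l2 f c :
  itint nu (l1 ++ l2) f c = itint nu l1 (itint nu l2 f) c.
Proof.
by elim: l1 c => [|i l1 IH] c //=; apply: eq_integral => t _; rewrite IH.
Qed.

Lemma measurable_itint_param d' (S : measurableType d') nu l
  (f : S -> env I E -> \bar R) :
measurable_fun setT (fun p : S * env I E => f p.1 p.2) ->
(forall s c, 0 <= f s c) ->
measurable_fun setT (fun p : S * env I E => itint nu l (f p.1) p.2).
Proof.
move=> mf f0.
elim: l => [|i l IH] //=.
apply: (@measurable_fun_fubini_tonelli_F _ _ (S * env I E)%type E R (nu i)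
  (fun q => itint nu l (f q.1.1) (update q.1.2 i q.2))) => //; last first.
  by move=> q; exact: itint_ge0.
apply: (@measurableT_comp _ _ _ _ _ _
  (fun p : S * env I E => itint nu l (f p.1) p.2) _
  (fun q : (S * env I E) * E => (q.1.1, update q.1.2 i q.2))) => //.
apply: measurable_fun_pair; first exact: measurableT_comp.
apply: (@measurableT_comp _ _ _ _ _ _ (fun p : env I E * E => update p.1 i p.2)
  _ (fun q : (S * env I E) * E => (q.1.2, q.2))); first exact: measurable_update.
by apply: measurable_fun_pair => //; exact: measurableT_comp.
Qed.

Lemma integral_itint d' (S : measurableType d') (mu : probability S R) nu l
    (f : S -> env I E -> \bar R) c :
  measurable_fun setT (fun p : S * env I E => f p.1 p.2) ->
  (forall s c, 0 <= f s c) ->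
  \int[mu]_s itint nu l (f s) c = itint nu l (fun c' => \int[mu]_s f s c') c.
Proof.
move=> mf f0.
have mi l' := measurable_itint_param _ _ nu l' f mf f0.
elim: l c => [|i l IH] c //=.
rewrite (@fubini_tonelli _ _ S E R mu (nu i)
  (fun q => itint nu l (f q.1) (update c i q.2))) /=.
- by apply: eq_integral => t _; rewrite IH.
- apply: (@measurableT_comp _ _ _ _ _ _
    (fun p : S * env I E => itint nu l (f p.1) p.2) _
    (fun q : S * E => (q.1, update c i q.2))) => //.
  apply: measurable_fun_pair => //.
  by apply: measurableT_comp => //; exact: measurable_updater.
- by move=> q; exact: itint_ge0.
Qed.

(** Tonelli, together with the commutation of updates at distinct indices, carries the variable [j]
    from the outermost to the innermost position; [j \notin l] keeps it from being overwritten. *)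
Lemma itint_integral_updateC nu l (mu : probability E R) j f c :
  j \notin l -> measurable_fun setT f -> (forall c, 0 <= f c) ->
  \int[mu]_t itint nu l f (update c j t) =
  itint nu l (fun c' => \int[mu]_t f (update c' j t)) c.
Proof.
move=> + mf f0; elim: l c => [|i l IH] c //=.
rewrite inE negb_or => /andP[ji jl].
rewrite (@fubini_tonelli _ _ E E R mu (nu i)
  (fun q => itint nu l f (update (update c j q.1) i q.2))) /=.
- apply: eq_integral => s _.
  under eq_integral do rewrite updateC//.
  exact: IH.
- apply: (@measurableT_comp _ _ _ _ _ _ (itint nu l f) _
    (fun q : E * E => update (update c j q.1) i q.2)).
    exact: measurable_itint.
  apply: measurable_env => k; rewrite /update; case: (k == i).
    exact: measurable_snd.
  by case: (k == j); [exact: measurable_fst|exact: measurable_cst].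
- by move=> q; exact: itint_ge0.
Qed.

End IteratedIntegral.

Lemma integral_probability_cst {R : realType} {d} {T : measurableType d}
  (P : probability T R) (r : \bar R) : (\int[P]_x r = r)%E.
Proof.
have PT : P setT = 1%E := probability_setT P.
exact: etrans (integral_cst P measurableT r) (etrans (congr1 (mule r) PT) (mule1 r)).
Qed.

Section IndependentLaws.
Context {R : realType} {d : measure_display} {E : measurableType d} {I : finType}.
Local Open Scope ereal_scope.

Definition rect (B : I -> set E) : set (env I E) := [set c | forall i, B i (c i)].

Definition rects : set (set (env I E)) :=
  [set A | exists2 B : I -> set E, (forall i, measurable (B i)) & A = rect B].

Lemma measurable_rect B : (forall i, measurable (B i)) -> measurable (rect B).
Proof.
move=> mB; have -> : rect B = \bigcap_(i in [set: I]) ((fun c : env I E => c i) @^-1` B i).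
  by apply/seteqP; split => [c Bc i _|c Bc i]; exact: Bc.
apply: fin_bigcap_measurable; first exact: finite_finset.
move=> i _; rewrite -[X in measurable X]setTI.
by apply: measurable_coord => //; exact: mB.
Qed.

Lemma env_measurableE : @measurable _ (env I E) = <<s rects >>.
Proof.
apply/seteqP; split; last first.
  apply: smallest_sub; first exact: sigma_algebra_measurable.
  by move=> _ [B mB ->]; exact: measurable_rect.
apply: smallest_sub; first exact: smallest_sigma_algebra.
move=> _ [i _ [B mB <-]]; apply: sub_sigma_algebra.
exists (fun j => if j == i then B else setT).
  by move=> j; case: (j == i).
rewrite setTI; apply/seteqP; split => c /=.
  by move=> Bc j; case: eqP => // ->.
by move=> /(_ i); rewrite eqxx.
Qed.

(** Rectangles are stable under intersection, contain the whole space and generate the cylinder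
    sigma-algebra. *)
Lemma env_measure_unique (m1 m2 : {measure set (env I E) -> \bar R}) :
  (forall B, (forall i, measurable (B i)) -> m1 (rect B) = m2 (rect B)) ->
  m1 setT < +oo -> forall A, measurable A -> m1 A = m2 A.
Proof.
move=> m12 m1T A mA.
apply: (measure_unique rects (fun=> setT)) => //.
- exact: env_measurableE.
- move=> _ _ [B mB ->] [C mC ->]; exists (fun i => B i `&` C i).
    by move=> i; exact: measurableI.
  apply/seteqP; split => c /=; first by move=> [Bc Cc] i; split.
  by move=> BC; split=> i; case: (BC i).
- move=> _; exists (fun=> setT) => //.
  by apply/seteqP; split.
- by rewrite bigcup_const//; exists 0%N.
- by move=> _ [B mB ->]; exact: m12.
Qed.

Definition indep_law {d'} {T : measurableType d'} (P : probability T R)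
    (X : I -> T -> E) (nu : I -> probability E R) : Prop :=
  forall B : I -> set E, (forall i, measurable (B i)) ->
    P [set w | forall i, B i (X i w)] = (\prod_(i : I) fine (nu i (B i)))%:E.

Context {d'} {T : measurableType d'} {P : probability T R}
  {X : I -> T -> E} {nu : I -> probability E R}.
Hypothesis mX : forall i, measurable_fun setT (X i).
Hypothesis iX : indep_law P X nu.

Let Xenv (w : T) : env I E := fun i => X i w.

Let mXenv : measurable_fun setT Xenv.
Proof. exact: measurable_env. Qed.

(** Resampling: replacing [X i] by an independent draw from [nu i] does not change the law of the
    family. Both laws are measures on [env I E], and independence makes them agree on rectangles. *)
Lemma indep_integral_update i (f : env I E -> \bar R) :
  measurable_fun setT f -> (forall c, 0 <= f c) ->
  \int[P]_w f (fun j => X j w) =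
  \int[P]_w \int[nu i]_t f (update (fun j => X j w) i t).
Proof.
move=> mf f0.
pose phi (p : T * E) := update (Xenv p.1) i p.2.
have mphi : measurable_fun setT phi.
  apply: (@measurableT_comp _ _ _ _ _ _ (fun p : env I E * E => update p.1 i p.2)
    _ (fun p : T * E => (Xenv p.1, p.2))); first exact: measurable_update.
  apply: measurable_fun_pair; last exact: measurable_snd.
  exact: measurableT_comp mXenv measurable_fst.
have -> : \int[P]_w \int[nu i]_t f (update (fun j => X j w) i t) =
          \int[pushforward (P \x nu i) phi]_c f c.
  rewrite (ge0_integral_pushforward mphi)//= preimage_setT.
  rewrite (fubini_tonelli1 (f \o phi))//; first exact: measurableT_comp.
  by move=> p; exact: f0.
have -> : \int[P]_w f (fun j => X j w) = \int[pushforward P Xenv]_c f c.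
  by rewrite (ge0_integral_pushforward mXenv)//= preimage_setT.
apply: eq_measure_integral => /= A mA _.
apply: (env_measure_unique (pushforward P Xenv) (pushforward (P \x nu i) phi)) => //.
  2: by rewrite /= /pushforward preimage_setT probability_setT ltry.
move=> B mB.
change (P (Xenv @^-1` rect B) = (P \x nu i)%E (phi @^-1` rect B)).
pose B' j := if j == i then setT else B j.
have mB' j : measurable (B' j) by rewrite /B'; case: (j == i).
have -> : phi @^-1` rect B = (Xenv @^-1` rect B') `*` B i.
  apply/seteqP; split => -[w t] /=.
    move=> h; split; last by move: (h i); rewrite /phi /update eqxx.
    move=> j /=; rewrite /B'; case: (j =P i) => // /eqP ji.
    by move: (h j); rewrite /phi /update (negbTE ji).
  move=> [h Bt] j; rewrite /phi /update /=; case: (j =P i) => [->//|/eqP ji].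
  by move: (h j); rewrite /B' (negbTE ji).
have mXB : measurable (Xenv @^-1` rect B').
  by rewrite -[X in measurable X]setTI; apply: mXenv => //; exact: measurable_rect.
rewrite product_measure1E//.
have -> : Xenv @^-1` rect B' = [set w | forall i, B' i (X i w)] by [].
have -> : (P [set w | forall j, B' j (X j w)] * nu i (B i) =
  (\prod_(j : I) fine (nu j (B' j)))%:E * nu i (B i))%E by rewrite iX.
rewrite -[nu i (B i)]fineK ?fin_num_measure//.
have -> : P (Xenv @^-1` rect B) = (\prod_(j : I) fine (nu j (B j)))%:E.
  exact: iX.
rewrite -EFinM (bigD1 i)//= [in RHS](bigD1 i)//= {1}/B' eqxx probability_setT mul1r.
rewrite mulrC; congr (_ * _)%:E; apply: eq_bigr => j ji.
by rewrite /B' (negbTE ji).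
Qed.

(** Each index is resampled in turn. As [l] exhausts the indices, nothing of [X] is left in the
    iterated integral: the base point [c] is arbitrary and the outer integral is that of a
    constant. *)
Theorem indep_integral (l : seq I) (f : env I E -> \bar R) c :
  (forall i, i \in l) -> measurable_fun setT f -> (forall c, 0 <= f c) ->
  \int[P]_w f (fun j => X j w) = itint nu l f c.
Proof.
move=> lI mf f0.
have itl l' : \int[P]_w f (fun j => X j w) =
    \int[P]_w itint nu l' f (fun j => X j w).
  elim: l' => [//|i l' IH]; rewrite IH (indep_integral_update i)//.
    exact: measurable_itint.
  by move=> c'; exact: itint_ge0.
rewrite (itl l).
have cst l' c1 c2 : (forall i, i \notin l' -> c1 i = c2 i) ->
    itint nu l' f c1 = itint nu l' f c2.
  elim: l' c1 c2 => [|i l' IH] c1 c2 h /=.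
    by congr f; apply/funext => i; exact: h.
  apply: eq_integral => t _; apply: IH => j jl; rewrite /update.
  by case: eqP => // /eqP ji; apply: h; rewrite inE negb_or ji.
transitivity (\int[P]_w (itint nu l f c)).
  by apply: eq_integral => w _; apply: cst => i; rewrite lI.
exact: integral_probability_cst.
Qed.

End IndependentLaws.

(** * The Gaussian measure *)

Section Density.
Context {R : realType} {d : measure_display} {T : measurableType d}.
Local Open Scope ereal_scope.
Import HBNNSimple.

(** Simple functions and monotone convergence. It serves for the Gaussian density, and again for the
    law of a row on the event that its label has a given sign. *)
Lemma integral_density (m nu : {measure set T -> \bar R}) (g : T -> R)
    (f : T -> \bar R) :
  measurable_fun setT g -> (forall x, (0 <= g x)%R) ->
  (forall A, measurable A -> m A = \int[nu]_(x in A) (g x)%:E) ->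
  measurable_fun setT f -> (forall x, 0 <= f x) ->
  \int[m]_x f x = \int[nu]_x (f x * (g x)%:E).
Proof.
move=> mg g0 mE mf f0; pose h := nnsfun_approx measurableT mf.
have hf x : (h n x)%:E @[n --> \oo] --> f x by exact: cvg_nnsfun_approx.
have nd x a b : (a <= b)%N -> (h a x <= h b x)%R.
  by move=> ab; exact/lefP/nd_nnsfun_approx.
have mgE : measurable_fun setT (fun x => (g x)%:E) by exact/measurable_EFinP.
have mhE n : measurable_fun setT (fun x => (h n x)%:E) by exact/measurable_EFinP.
have -> : \int[m]_x f x = limn (fun n => \int[m]_x (h n x)%:E).
  rewrite -monotone_convergence//; last 2 first.
  - by move=> n x _; rewrite lee_fin.
  - by move=> x _ a b ab; rewrite lee_fin nd.
  by apply: eq_integral => x _; apply/esym/cvg_lim => //; exact: hf.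
have -> : \int[nu]_x (f x * (g x)%:E) =
    limn (fun n => \int[nu]_x ((h n x)%:E * (g x)%:E)).
  rewrite -monotone_convergence//.
  - apply: eq_integral => x _; apply/esym/cvg_lim => //.
    by apply: cvgeZr => //; exact: hf.
  - by move=> n; exact: emeasurable_funM.
  - by move=> n x _; rewrite mule_ge0// lee_fin.
  - by move=> x _ a b ab; rewrite lee_wpmul2r ?lee_fin//; exact: nd.
congr (limn _); apply/funext => n.
have mr r : measurable_fun setT (fun x => (r * \1_(h n @^-1` [set r]) x)%:E).
  by apply/measurable_EFinP; exact: measurable_funM.
have h0 r x : 0 <= (r * \1_(h n @^-1` [set r]) x)%:E.
  exact: nnfun_muleindic_ge0.
transitivity (\int[m]_x (\sum_(r \in range (h n))
    (r * \1_(h n @^-1` [set r]) x)%:E)).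
  by apply: eq_integral => x _; rewrite /= fimfunE -fsumEFin.
rewrite ge0_integral_fsum//.
transitivity (\int[nu]_x (\sum_(r \in range (h n))
    ((r * \1_(h n @^-1` [set r]) x)%:E * (g x)%:E))); last first.
  apply: eq_integral => x _; rewrite -ge0_mule_fsuml//.
  by rewrite fsumEFin// -(fimfunE _ x).
rewrite ge0_integral_fsum//; last 2 first.
- by move=> r; exact: emeasurable_funM.
- by move=> r x _; rewrite mule_ge0// lee_fin.
apply: eq_fsbigr => r; rewrite inE => -[x0 _ rE].
have r0 : 0 <= r%:E by rewrite lee_fin -rE.
have mA : measurable (h n @^-1` [set r]).
  by rewrite -[X in measurable X]setTI; exact: measurable_funP.
have mi : measurable_fun setT (fun x => (\1_(h n @^-1` [set r]) x)%:E : \bar R).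
  exact/measurable_EFinP.
have i0 (x : T) : 0 <= (\1_(h n @^-1` [set r]) x)%:E :> \bar R by rewrite lee_fin.
under eq_integral do rewrite EFinM.
rewrite (ge0_integralZl m measurableT mi (fun x _ => i0 x) r0).
rewrite integral_indic// setIT mE//.
under [RHS]eq_integral do rewrite EFinM -muleA.
have mig : measurable_fun setT (fun x => (\1_(h n @^-1` [set r]) x)%:E * (g x)%:E).
  exact: emeasurable_funM.
have ig0 x : 0 <= (\1_(h n @^-1` [set r]) x)%:E * (g x)%:E.
  by rewrite mule_ge0// lee_fin.
rewrite (ge0_integralZl nu measurableT mig (fun x _ => ig0 x) r0).
congr (_ * _); rewrite integral_mkcond; apply: eq_integral => x _.
by rewrite /patch indicE; case: ifP => _; rewrite ?mul1e ?mul0e.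
Qed.

End Density.

Section Gauss.
Context {R : realType}.
Local Open Scope ereal_scope.
Local Notation leb := (@lebesgue_measure R).

(** The standard normal law, declared anew on the measurable type on which [mu] lives, so that the
    two can replace each other in an iterated integral; [integral_normal_gauss] transfers
    integrals. *)
Definition gauss : set R -> \bar R := normal_prob 0%R 1%R.

Let gauss0 : gauss set0 = 0.
Proof. exact: (measure0 (@normal_prob R 0%R 1%R)). Qed.
Let gauss_ge0 A : 0 <= gauss A.
Proof. exact: (measure_ge0 (@normal_prob R 0%R 1%R)). Qed.
Let gauss_sigma : semi_sigma_additive gauss.
Proof. exact: (@measure_semi_sigma_additive _ _ _ (@normal_prob R 0%R 1%R)). Qed.
HB.instance Definition _ := isMeasure.Build _ R R gauss gauss0 gauss_ge0 gauss_sigma.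
Let gaussT : gauss setT = 1.
Proof. exact: (@probability_setT _ _ _ (@normal_prob R 0%R 1%R)). Qed.
HB.instance Definition _ := Measure_isProbability.Build _ _ _ gauss gaussT.

Lemma integral_normal_gauss (f : R -> \bar R) :
  measurable_fun setT f -> (forall x, 0 <= f x) ->
  \int[normal_prob 0%R 1%R]_t f t = \int[gauss]_t f t.
Proof.
move=> mf f0.
have mi : measurable_fun setT (fun x : measurableTypeR R => x : R).
  by move=> _ Y mY; rewrite setTI.
transitivity (\int[pushforward (@normal_prob R 0%R 1%R)
    (fun x : measurableTypeR R => x : R)]_t f t).
  by rewrite (ge0_integral_pushforward mi)//= preimage_setT.
exact: eq_measure_integral.
Qed.

Definition gpdf : R -> R := normal_pdf 0%R 1%R.

Lemma gpdf_ge0 x : (0 <= gpdf x)%R. Proof. exact: normal_pdf_ge0. Qed.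

Lemma gpdfE x : gpdf x = (gpdf 0 * expR (- x ^+ 2 / 2))%R.
Proof.
rewrite /gpdf normal_pdfE ?oner_neq0// /normal_fun !subr0 expr0n/= oppr0 mul0r.
by rewrite expR0 mulr1 expr1n.
Qed.

Lemma measurable_gpdf : measurable_fun setT (gpdf : measurableTypeR R -> R).
Proof. exact: measurable_normal_pdf. Qed.

Lemma integral_gauss (f : R -> \bar R) :
  measurable_fun setT f -> (forall x, 0 <= f x) ->
  \int[gauss]_t f t = \int[leb]_t (f t * (gpdf t)%:E).
Proof.
move=> mf f0; rewrite -integral_normal_gauss//.
apply: (@integral_density R _ (measurableTypeR R)) => //.
- exact: measurable_gpdf.
- exact: gpdf_ge0.
Qed.

Lemma integral_leb_shift (f : measurableTypeR R -> \bar R) (c : R) :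
  measurable_fun setT f -> (forall x, 0 <= f x) ->
  \int[leb]_x f (x + c)%R = \int[leb]_x f x.
Proof.
move=> mf f0.
have ms : measurable_fun setT (fun x : measurableTypeR R => (x + c)%R : measurableTypeR R).
  exact: measurable_funD.
rewrite -[LHS](@ge0_integral_pushforward _ _ _ _ _ _ ms leb setT f)//.
apply: eq_measure_integral => A mA _.
apply/esym; apply: (@lebesgue_measure_unique _
  (pushforward leb (fun x : measurableTypeR R => (x + c)%R : measurableTypeR R))) => //.
move=> _ [[a b] _ <-].
change (leb `]a, b]%classic = leb ((fun x : R => (x + c)%R) @^-1` `]a, b]%classic)).
have -> : (fun x : R => (x + c)%R) @^-1` `]a, b]%classic = `](a - c)%R, (b - c)%R]%classic.
  by apply/seteqP; split => x /=; rewrite !in_itv/= lerBrDr ltrBlDr.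
rewrite !lebesgue_measure_itv/= !lte_fin ltrD2r.
by case: ifP => // _; rewrite -!EFinB; congr EFin; ring.
Qed.

Lemma leb_shear (k : measurableTypeR R * measurableTypeR R -> \bar R) (t : R) :
  measurable_fun setT k -> (forall p, 0 <= k p) ->
  \int[leb]_x \int[leb]_y k (x, (y + t * x)%R) = \int[leb]_x \int[leb]_y k (x, y).
Proof.
move=> mk k0; apply: eq_integral => x _.
apply: (@integral_leb_shift (fun y => k (x, y))) => //.
exact: measurableT_comp mk (measurable_pair1 x).
Qed.

Lemma leb_shear_fst (k : measurableTypeR R * measurableTypeR R -> \bar R) (t : R) :
  measurable_fun setT k -> (forall p, 0 <= k p) ->
  \int[leb]_x \int[leb]_y k ((x + t * y)%R, y) = \int[leb]_x \int[leb]_y k (x, y).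
Proof.
move=> mk k0.
have mk' : measurable_fun setT
    (fun p : measurableTypeR R * measurableTypeR R => k ((p.1 + t * p.2)%R, p.2)).
  apply: (measurableT_comp mk).
  apply: measurable_fun_pair => //=; apply: measurable_funD => //.
  exact: measurable_funM.
rewrite (@fubini_tonelli _ _ _ _ R leb leb (fun p => k ((p.1 + t * p.2)%R, p.2)) mk' (fun p => k0 _)).
rewrite [RHS](@fubini_tonelli _ _ _ _ R leb leb k mk k0) /=.
apply: eq_integral => y _.
apply: (@integral_leb_shift (fun x => k (x, y))) => //.
exact: measurableT_comp mk (measurable_pair2 y).
Qed.

(** A plane rotation is a product of three shears, here with coefficients t, -b, t, where t = b / (1
    + a) is the tangent of the half-angle; [0 < a] keeps 1 + a away from 0. Each shear preserves the
    integral by translation invariance in one variable. *)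
Lemma leb_rotation (k : measurableTypeR R * measurableTypeR R -> \bar R) (a b : R) :
  measurable_fun setT k -> (forall p, 0 <= k p) ->
  (0 < a)%R -> (a ^+ 2 + b ^+ 2 = 1)%R ->
  \int[leb]_x \int[leb]_y k ((a * x + b * y)%R, (a * y - b * x)%R) =
  \int[leb]_x \int[leb]_y k (x, y).
Proof.
move=> mk k0 a0 ab; have a1 : (1 + a != 0)%R by rewrite gt_eqF// ltr_wpDl.
pose t := (b / (1 + a))%R.
have mp1 (s : R) : measurable_fun setT
    (fun p : measurableTypeR R * measurableTypeR R => ((p.1 + s * p.2)%R, p.2) : measurableTypeR R * measurableTypeR R).
  apply: measurable_fun_pair => //=; apply: measurable_funD => //.
  exact: measurable_funM.
have mp2 (s : R) : measurable_fun setT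
    (fun p : measurableTypeR R * measurableTypeR R => (p.1, (p.2 + s * p.1)%R) : measurableTypeR R * measurableTypeR R).
  apply: measurable_fun_pair => //=; apply: measurable_funD => //.
  exact: measurable_funM.
rewrite -[RHS](leb_shear_fst k t mk k0).
pose k1 p := k ((p.1 + t * p.2)%R, p.2).
have mk1 : measurable_fun setT k1 by exact: measurableT_comp mk (mp1 t).
have k10 p : 0 <= k1 p by exact: k0.
rewrite -[RHS](leb_shear k1 (- b) mk1 k10).
pose k2 p := k1 (p.1, (p.2 + - b * p.1)%R).
have mk2 : measurable_fun setT k2 by exact: measurableT_comp mk1 (mp2 (- b)%R).
have k20 p : 0 <= k2 p by exact: k0.
rewrite -[RHS](leb_shear_fst k2 t mk2 k20).
apply: eq_integral => x _; apply: eq_integral => y _; rewrite /k2 /k1 /=.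
have tb : (t * b = 1 - a)%R.
  rewrite /t mulrAC -expr2; apply: (mulIf a1); rewrite divfK//.
  by have -> : (b ^+ 2 = 1 - a ^+ 2)%R; [rewrite -ab; ring|ring].
have ta : (t + t * a = b)%R.
  by rewrite /t -[X in (X + _)%R]mulr1 -mulrDr divfK.
congr (k (_, _)).
  rewrite [RHS](_ : _ = (1 - t * b) * x + (t + t * (1 - t * b)) * y)%R; last by ring.
  by rewrite tb subKr ta.
rewrite [RHS](_ : _ = (1 - t * b) * y - b * x)%R; last by ring.
by rewrite tb subKr.
Qed.

(** The product of two standard densities is a function of x^2 + y^2, which the rotation leaves
    unchanged. *)
Lemma gauss_rotation (f : R * R -> \bar R) (a b : R) :
  measurable_fun setT f -> (forall p, 0 <= f p) ->
  (0 < a)%R -> (a ^+ 2 + b ^+ 2 = 1)%R ->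
  \int[gauss]_x \int[gauss]_y f ((a * x + b * y)%R, (a * y - b * x)%R) =
  \int[gauss]_x \int[gauss]_y f (x, y).
Proof.
move=> mf f0 a0 ab.
have gg (h : R * R -> \bar R) : measurable_fun setT h -> (forall p, 0 <= h p) ->
    \int[gauss]_x \int[gauss]_y h (x, y) =
    \int[leb]_x \int[leb]_y (h (x, y) * (gpdf x * gpdf y)%:E).
  move=> mh h0.
  have mh1 x : measurable_fun setT (fun y => h (x, y)).
    exact: measurableT_comp mh (measurable_pair1 x).
  have mh2 : measurable_fun setT (fun x => \int[gauss]_y h (x, y)).
    exact: (@measurable_fun_fubini_tonelli_F _ _ R R R gauss h).
  have h2 x : 0 <= \int[gauss]_y h (x, y) by apply: integral_ge0 => y _; exact: h0.
  rewrite (integral_gauss _ mh2 h2).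
  apply: eq_integral => x _; rewrite (integral_gauss _ (mh1 x) (fun y => h0 _)).
  have mhg : measurable_fun setT (fun y : measurableTypeR R => h (x, y) * (gpdf y)%:E).
    apply: emeasurable_funM; first exact: mh1.
    by apply/measurable_EFinP; exact: measurable_gpdf.
  have hg0 y : 0 <= h (x, y) * (gpdf y)%:E by rewrite mule_ge0// lee_fin gpdf_ge0.
  have gx0 : 0 <= (gpdf x)%:E by rewrite lee_fin gpdf_ge0.
  rewrite -(ge0_integralZr leb measurableT mhg (fun y _ => hg0 y) gx0).
  by apply: eq_integral => y _; rewrite -muleA -EFinM [(gpdf y * _)%R]mulrC.
have mrot : measurable_fun setT (fun p : R * R => ((a * p.1 + b * p.2)%R, (a * p.2 - b * p.1)%R)).
  by apply: measurable_fun_pair => //=; [apply: measurable_funD|apply: measurable_funB] => //=; exact: measurable_funM.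
pose fr p := f ((a * p.1 + b * p.2)%R, (a * p.2 - b * p.1)%R).
have mfr : measurable_fun setT fr by exact: measurableT_comp mf mrot.
rewrite (gg fr mfr (fun p => f0 _)) (gg f mf f0).
pose k (p : measurableTypeR R * measurableTypeR R) := f p * (gpdf p.1 * gpdf p.2)%:E.
have mk : measurable_fun setT k.
  apply: emeasurable_funM; first exact: mf.
  apply/measurable_EFinP; apply: measurable_funM.
    exact: measurableT_comp measurable_gpdf measurable_fst.
  exact: measurableT_comp measurable_gpdf measurable_snd.
have k0 p : 0 <= k p by rewrite mule_ge0// lee_fin mulr_ge0 ?gpdf_ge0.
rewrite -[RHS](leb_rotation k a b mk k0 a0 ab).
apply: eq_integral => x _; apply: eq_integral => y _; rewrite /k /fr /=; congr (_ * _%:E).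
rewrite (gpdfE x) (gpdfE y) (gpdfE (_ + _)%R) (gpdfE (_ - _)%R) !mulrA.
rewrite [(gpdf 0 * _ * gpdf 0)%R]mulrAC [in RHS](mulrAC (gpdf 0)) -!mulrA -!expRD.
congr (_ * (_ * expR _))%R.
rewrite -!mulrDl; congr (_ / 2)%R.
have -> : (- x ^+ 2 - y ^+ 2 = - (a ^+ 2 + b ^+ 2) * (x ^+ 2 + y ^+ 2))%R.
  by rewrite ab; ring.
ring.
Qed.

End Gauss.

(** * Inequalities between powers, exp and cosh *)

Section Calculus.
Context {R : realType}.

(* The derivative is only controlled on the right half-line. *)
Lemma ler_derive0 (f df : R -> R) (x : R) : 0 <= x ->
  (forall t : R, is_derive t 1 f (df t)) -> (forall t : R, 0 <= t -> 0 <= df t) ->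
  f 0 <= f x.
Proof.
move=> x0 fdf df0.
have fc : {within `[0, x], continuous f}.
  apply: continuous_subspaceT => t; apply: differentiable_continuous.
  by apply/derivable1_diffP; case: (fdf t).
have [c cx fE] := @MVT_segment R f df 0 x x0 (fun t _ => fdf t) fc.
rewrite -subr_ge0 fE subr0 mulr_ge0// df0//.
by move: cx; rewrite in_itv/= => /andP[].
Qed.

Lemma expR_sub1_le (x : R) : expR x - 1 <= x * expR x.
Proof.
have := expR_ge1Dx (- x); rewrite expRN => h.
have e0 := expR_gt0 x.
have : (1 - x) * expR x <= 1.
  by apply: le_trans (ler_wpM2r (ltW e0) h) _; rewrite mulVf ?gt_eqF.
by lra.
Qed.

Lemma sqr_le_cosh (u : R) : u ^+ 2 <= expR u + expR (- u) - 2.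
Proof.
wlog u0 : u / 0 <= u => [H|].
  case: (lerP 0 u) => [/H//|/ltW u0].
  by have := H (- u); rewrite sqrrN opprK [expR (- u) + _]addrC; apply; rewrite oppr_ge0.
pose f t : R := expR t + expR (- t) - t ^+ 2.
pose f1 t : R := expR t - expR (- t) - t *+ 2.
have df (t : R) : is_derive t 1 f (f1 t).
  rewrite /f; apply: is_derive_eq; rewrite /f1 /=.
  by rewrite !scaler1 /GRing.scale/= ; ring.
have df1 (t : R) : is_derive t 1 f1 (expR t + expR (- t) - 2).
  rewrite /f1; apply: is_derive_eq; rewrite /=.
  by rewrite ?scaler1 /GRing.scale/= ; ring.
have c2 (t : R) : 0 <= expR t + expR (- t) - 2.
  have : 0 <= (expR (t / 2) - expR (- (t / 2))) ^+ 2 by exact: sqr_ge0.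
  have e1 : expR (t / 2) * expR (- (t / 2)) = 1 by rewrite expRxMexpNx_1.
  have e2 : expR t = expR (t / 2) ^+ 2 by rewrite expr2 -expRD -splitr.
  have e3 : expR (- t) = expR (- (t / 2)) ^+ 2.
    by rewrite expr2 -expRD -opprD -splitr.
  by rewrite e2 e3; nra.
have f10 (t : R) : 0 <= t -> 0 <= f1 t.
  move=> t0; have := ler_derive0 f1 _ t t0 df1 (fun s _ => c2 s).
  by rewrite {1}/f1 oppr0 expR0 subrr mul0rn subr0.
have := ler_derive0 f f1 u u0 df f10.
by rewrite /f oppr0 expR0 expr0n/= subr0; lra.
Qed.

(** With v = u / 2 the left side is (2 sinh v)^2, and sinh v <= v cosh v on the half-line ([th]).
    Together with [sqr_le_cosh] this encloses cosh tightly enough to identify the Gaussian second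
    moment. *)
Lemma cosh_sub1_le (u : R) :
  expR u + expR (- u) - 2 <= u ^+ 2 / 2 * (expR u + expR (- u)).
Proof.
wlog u0 : u / 0 <= u => [H|].
  case: (lerP 0 u) => [/H//|/ltW u0].
  have := H (- u); rewrite sqrrN opprK [expR (- u) + _]addrC; apply.
  by rewrite oppr_ge0.
pose v := u / 2.
have v0 : 0 <= v by rewrite divr_ge0.
have uv : u = v + v by rewrite /v -splitr.
pose g (t : R) := t * (expR t + expR (- t)) - (expR t - expR (- t)).
have dg (t : R) : is_derive t 1 g (t * (expR t - expR (- t))).
  rewrite /g; apply: is_derive_eq; rewrite /=.
  by rewrite ?scaler1 /GRing.scale/= ; ring.
have sh (t : R) : 0 <= t -> 0 <= expR t - expR (- t).
  by move=> t0; rewrite subr_ge0 ler_expR; lra.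
have := ler_derive0 g _ v v0 dg (fun t t0 => mulr_ge0 t0 (sh t t0)).
rewrite /g mul0r oppr0 expR0 subrr subr0 subr_ge0 => th.
have s0 := sh v v0.
have e1 : expR v * expR (- v) = 1 by rewrite expRxMexpNx_1.
have -> : expR u = expR v ^+ 2 by rewrite expr2 -expRD -uv.
have -> : expR (- u) = expR (- v) ^+ 2 by rewrite expr2 -expRD uv opprD.
have p1 := expR_gt0 v; have p2 := expR_gt0 (- v).
have -> : u ^+ 2 / 2 = 2 * v ^+ 2 by rewrite uv; field.
have : (expR v - expR (- v)) ^+ 2 <= (v * (expR v + expR (- v))) ^+ 2.
  by rewrite lerXn2r// ?nnegrE// mulr_ge0// addr_ge0 ?ltW.
have : 0 <= v ^+ 2 * (expR v - expR (- v)) ^+ 2 by rewrite mulr_ge0 ?sqr_ge0.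
clearbody v; set a := expR v in e1 *; set b := expR (- v) in e1 *.
move=> h1 h2.
have -> : a ^+ 2 + b ^+ 2 - 2 = (a - b) ^+ 2 by rewrite -e1; ring.
by clear -h1 h2; lra.
Qed.

Lemma exp4_le_cosh (t : R) : t ^+ 4 <= 24 * (expR t + expR (- t)).
Proof.
wlog t0 : t / 0 <= t => [H|].
  case: (lerP 0 t) => [/H//|/ltW t0].
  by have := H (- t); rewrite exprNn opprK [expR (- t) + _]addrC -signr_odd expr0 mul1r; apply; rewrite oppr_ge0.
have := @expR_ge1Dxn R t 3 t0; have := expR_gt0 (- t).
by rewrite (_ : (4`!)%:R = 24)//; lra.
Qed.

Lemma expR_half_le2 : expR (2^-1) <= 2 :> R.
Proof.
have := expR_ge1Dx (- 2^-1 : R); rewrite expRN => h.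
have e0 := expR_gt0 (2^-1 : R).
have : (1 - 2^-1) * expR (2^-1) <= 1 :> R.
  by apply: le_trans (ler_wpM2r (ltW e0) h) _; rewrite mulVf ?gt_eqF.
by lra.
Qed.

End Calculus.

Ltac meas := repeat first
  [ assumption | exact: measurable_cst | exact: measurable_id
  | exact: measurable_fst | exact: measurable_snd
  | exact: measurable_coord
  | apply: measurable_funD | apply: measurable_funB | apply: measurable_funM
  | apply: measurable_funX | apply: measurable_funN
  | apply: (measurableT_comp (@measurable_expR _))
  | apply: measurable_sum ].

Section RealIntegrals.
Context {R : realType} {d : measure_display} {T : measurableType d}
  (P : probability T R).
Implicit Types f g : T -> R.
Local Open Scope ereal_scope.

Lemma intD f g : measurable_fun setT f -> measurable_fun setT g ->
  (forall x, (0 <= f x)%R) -> (forall x, (0 <= g x)%R) ->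
  \int[P]_x (f x + g x)%:E = \int[P]_x (f x)%:E + \int[P]_x (g x)%:E.
Proof.
move=> mf mg f0 g0; have mf' := (measurable_EFinP setT f).2 mf.
have mg' := (measurable_EFinP setT g).2 mg.
rewrite -(@ge0_integralD _ _ _ P setT measurableT (EFin \o f) (EFin \o g) (fun x _ => f0 x) mf' (fun x _ => g0 x) mg').
by apply: eq_integral => x _; rewrite EFinD.
Qed.

Lemma intZ f (k : R) : measurable_fun setT f -> (0 <= k)%R ->
  (forall x, (0 <= f x)%R) ->
  \int[P]_x (k * f x)%:E = k%:E * \int[P]_x (f x)%:E.
Proof.
move=> mf k0 f0; have mf' := (measurable_EFinP setT f).2 mf.
rewrite -(@ge0_integralZl _ _ _ P setT measurableT (EFin \o f) mf' k%:E (fun x _ => f0 x) k0).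
by apply: eq_integral => x _; rewrite EFinM.
Qed.

Lemma le_int f g : measurable_fun setT f -> measurable_fun setT g ->
  (forall x, (0 <= f x)%R) -> (forall x, (f x <= g x)%R) ->
  \int[P]_x (f x)%:E <= \int[P]_x (g x)%:E.
Proof.
move=> mf mg f0 fg; apply: ge0_le_integral => //.
- by move=> x _; rewrite lee_fin.
- exact/measurable_EFinP.
- exact/measurable_EFinP.
- by move=> x _; rewrite lee_fin.
Qed.

Lemma int_cst (r : R) : \int[P]_x r%:E = r%:E.
Proof. exact: integral_probability_cst. Qed.

Lemma int_ge0 f : (forall x, (0 <= f x)%R) -> 0 <= \int[P]_x (f x)%:E.
Proof. by move=> f0; apply: integral_ge0 => x _; rewrite lee_fin. Qed.

End RealIntegrals.

(** * Moments and tails of the Gaussian law *)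

Section GaussMoments.
Context {R : realType}.
Local Open Scope ereal_scope.
Local Notation leb := (@lebesgue_measure R).
Local Notation gauss := (@gauss R).

Lemma gauss_sym (f : R -> \bar R) :
  measurable_fun setT f -> (forall x, 0 <= f x) ->
  \int[gauss]_x f (- x)%R = \int[gauss]_x f x.
Proof.
move=> mf f0.
have mN : measurable_fun setT (fun x : R => f (- x)%R).
  exact: measurableT_comp mf (@oppr_measurable R setT).
rewrite (integral_gauss _ mN (fun x => f0 _)) (integral_gauss _ mf f0).
pose h (t : measurableTypeR R) := f t * (gpdf t)%:E.
have mh : measurable_fun setT h.
  apply: emeasurable_funM; first exact: mf.
  by apply/measurable_EFinP; exact: measurable_gpdf.
have h0 t : 0 <= h t by rewrite mule_ge0// lee_fin gpdf_ge0.
have ms : measurable_fun setT (fun x : measurableTypeR R => (- x)%R : measurableTypeR R).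
  by meas.
transitivity (\int[leb]_x h (- x)%R).
  apply: eq_integral => x _; rewrite /h; congr (_ * _%:E).
  by rewrite (gpdfE x) (gpdfE (- x)) sqrrN.
rewrite -[LHS](@ge0_integral_pushforward _ _ _ _ _ _ ms leb setT h)//.
apply: eq_measure_integral => A mA _; exact: lebesgue_measureN.
Qed.

(** Completing the square: the exponential weight is absorbed by a translation of the variable by
    s. *)
Lemma gauss_tilt (f : R -> \bar R) (s : R) :
  measurable_fun setT f -> (forall x, 0 <= f x) ->
  \int[gauss]_x (f x * (expR (s * x))%:E) =
  (expR (s ^+ 2 / 2))%:E * \int[gauss]_x f (x + s)%R.
Proof.
move=> mf f0.
have mE : measurable_fun setT (fun x : R => expR (s * x)) by meas.
have m1 : measurable_fun setT (fun x => f x * (expR (s * x))%:E).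
  by apply: emeasurable_funM => //; exact/measurable_EFinP.
have m2 : measurable_fun setT (fun x : R => f (x + s)%R).
  by apply: (measurableT_comp mf); meas.
have h1 (x : R) : 0 <= f x * (expR (s * x))%:E by rewrite mule_ge0// lee_fin expR_ge0.
rewrite (integral_gauss _ m1 h1) (integral_gauss _ m2 (fun x => f0 _)).
have m3 : measurable_fun setT (fun x : measurableTypeR R => f (x + s)%R * (gpdf x)%:E).
  apply: emeasurable_funM; first exact: m2.
  by apply/measurable_EFinP; exact: measurable_gpdf.
have h3 x : 0 <= f (x + s)%R * (gpdf x)%:E by rewrite mule_ge0// lee_fin gpdf_ge0.
have e0 : 0 <= (expR (s ^+ 2 / 2))%:E by rewrite lee_fin expR_ge0.
rewrite -(ge0_integralZl leb measurableT m3 (fun x _ => h3 x) e0).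
pose h (x : measurableTypeR R) := f x * (expR (s * x))%:E * (gpdf x)%:E.
have mh : measurable_fun setT h.
  apply: emeasurable_funM; first exact: m1.
  by apply/measurable_EFinP; exact: measurable_gpdf.
have h0 x : 0 <= h x by rewrite mule_ge0// lee_fin gpdf_ge0.
rewrite -(integral_leb_shift h s mh h0); apply: eq_integral => x _.
rewrite /h [RHS]muleCA -muleA; congr (_ * _); rewrite -!EFinM; congr (_%:E).
rewrite (gpdfE x) (gpdfE (x + s)) mulrCA [RHS]mulrCA -!expRD.
congr (_ * expR _)%R; last by field.
Qed.

Lemma gauss_mgf (s : R) :
  \int[gauss]_x (expR (s * x))%:E = (expR (s ^+ 2 / 2))%:E.
Proof.
have := gauss_tilt (fun=> 1) s (measurable_cst _) (fun=> lee01).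
rewrite int_cst mule1 => <-.
by apply: eq_integral => x _; rewrite mul1e.
Qed.

Lemma gauss_cosh (s : R) :
  \int[gauss]_x (expR (s * x) + expR (- (s * x)))%:E =
  (2 * expR (s ^+ 2 / 2))%:E.
Proof.
rewrite intD; last 4 first. 1,2: by meas. 1,2: by move=> x; exact: expR_ge0.
rewrite gauss_mgf; under eq_integral do rewrite -mulNr.
by rewrite gauss_mgf sqrrN -EFinD mulrDl mul1r.
Qed.

Lemma gauss_fourth_moment : \int[gauss]_x (x ^+ 4)%:E <= 100%:E.
Proof.
apply: (@le_trans _ _ (\int[gauss]_x (24 * (expR (1 * x) + expR (- (1 * x))))%:E)).
  apply: le_int => [||x|x]; [by meas|by meas|exact: exprn_even_ge0|].
  by rewrite mul1r exp4_le_cosh.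
rewrite intZ; [|by meas|by []|by move=> x; rewrite addr_ge0 ?expR_ge0].
rewrite gauss_cosh -EFinM lee_fin expr1n mul1r.
by have := @expR_half_le2 R; lra.
Qed.

(** The value is read off from the moment generating function. The quantity 2 cosh(s x) - 2 lies
    between (s x)^2 and (s x)^2 cosh(s x); after integration and division by s^2, letting s tend to
    0 leaves only m = 1. *)
Lemma gauss_second_moment : \int[gauss]_x (x ^+ 2)%:E = 1.
Proof.
have mx2 : measurable_fun setT (fun x : R => x ^+ 2)%R by meas.
have x20 (x : R) : (0 <= x ^+ 2)%R by exact: sqr_ge0.
have m_fin : \int[gauss]_x (x ^+ 2)%:E <= 4%:E.
  apply: (@le_trans _ _ (\int[gauss]_x (expR (1 * x) + expR (- (1 * x)))%:E)).
    apply: le_int => //; first by meas.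
    by move=> x; rewrite mul1r; have := sqr_le_cosh x; lra.
  rewrite gauss_cosh lee_fin expr1n mul1r.
  by have := @expR_half_le2 R; lra.
have fn : \int[gauss]_x (x ^+ 2)%:E \is a fin_num.
  rewrite ge0_fin_numE; last exact: int_ge0.
  exact: le_lt_trans m_fin (ltry _).
set m2 := \int[gauss]_x (x ^+ 2)%:E in m_fin fn *.
pose m := fine m2; have mE : m2 = m%:E by rewrite fineK.
have m0 : (0 <= m)%R by rewrite -lee_fin -mE; exact: int_ge0.
have coshs0 s (x : R) : (0 <= expR (s * x) + expR (- (s * x)))%R.
  by rewrite addr_ge0 ?expR_ge0.
have mcosh (s : R) : measurable_fun setT (fun x : R => expR (s * x) + expR (- (s * x)))%R.
  by meas.
have U s : (s ^+ 2 * m + 2 <= 2 * expR (s ^+ 2 / 2))%R.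
  rewrite -lee_fin -gauss_cosh EFinD EFinM -mE -(int_cst gauss 2) -intZ; [|by []|exact: sqr_ge0|by []].
  rewrite -intD; [|by meas|by meas|by move=> x; rewrite mulr_ge0// ?sqr_ge0|by []].
  apply: le_int => //; first by meas.
    by move=> x; rewrite addr_ge0// mulr_ge0// ?sqr_ge0.
  by move=> x; rewrite -exprMn; have := sqr_le_cosh (s * x)%R; lra.
have L s : (2 * expR (s ^+ 2 / 2) <=
    2 + s ^+ 2 / 2 * (expR (s ^+ 2 / 2) * (2 * m + 2 * s ^+ 2)))%R.
  have tE : \int[gauss]_x (x ^+ 2 * (expR (s * x) + expR (- (s * x))))%:E =
      (expR (s ^+ 2 / 2) * (2 * m + 2 * s ^+ 2))%:E.
    under eq_integral do rewrite mulrDr -mulNr.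
    rewrite intD; [|by meas|by meas|by move=> x; rewrite mulr_ge0 ?expR_ge0
      |by move=> x; rewrite mulr_ge0 ?expR_ge0].
    under eq_integral do rewrite EFinM.
    under [X in _ + X]eq_integral do rewrite EFinM.
    have mx2E : measurable_fun setT (fun x : R => (x ^+ 2)%:E) by exact/measurable_EFinP.
    rewrite (gauss_tilt (fun x => (x ^+ 2)%:E))// (gauss_tilt (fun x => (x ^+ 2)%:E))//.
    rewrite sqrrN EFinM -muleDr//; last first.
      by rewrite ge0_adde_def// inE; apply: int_ge0 => x; exact: sqr_ge0.
    congr (_ * _); rewrite -intD; [|by meas|by meas|by move=> x; exact: sqr_ge0|by move=> x; exact: sqr_ge0].
    rewrite EFinD EFinM -mE -(int_cst gauss (2 * s ^+ 2)) -intZ; [|by []|by []|by []].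
    rewrite -intD; [|by meas|by meas|by move=> x; rewrite mulr_ge0|by move=> x; rewrite mulr_ge0// ?sqr_ge0].
    by apply: eq_integral => x _; congr (_%:E); ring.
  rewrite -lee_fin -gauss_cosh EFinD EFinM -tE -(int_cst gauss 2) -intZ; [|by meas|by rewrite divr_ge0// sqr_ge0|by move=> x; rewrite mulr_ge0].
  rewrite -intD; [|by meas|by meas|by move=> x|move=> x; apply: mulr_ge0; [by apply: divr_ge0 => //; exact: sqr_ge0|by apply: mulr_ge0; [exact: sqr_ge0|exact: coshs0]]].
  apply: le_int => //; first by meas.
  move=> x; have := cosh_sub1_le (s * x)%R; rewrite exprMn.
  set q := (_ + expR (- _))%R.
  have -> : (s ^+ 2 / 2 * (x ^+ 2 * q) = s ^+ 2 * x ^+ 2 / 2 * q)%R by ring.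
  by lra.
have bnd (x : R) : (0 < x <= 2^-1 -> expR x <= 1 + 2 * x)%R.
  move=> /andP[x0 x1]; have := expR_sub1_le x.
  have : (expR x <= 2)%R by apply: le_trans (@expR_half_le2 R); rewrite ler_expR.
  by nra.
(* Take s^2 = 2x in [U] and [L], and divide by x. *)
have key (x : R) : (0 < x <= 2^-1 -> m <= 1 + 2 * x /\ 1 <= (m + 2 * x) * (1 + 2 * x))%R.
  move=> xb; have /andP[x0 x1] := xb.
  have sx : (Num.sqrt (2 * x) ^+ 2 = 2 * x)%R by rewrite sqr_sqrtr// mulr_ge0// ltW.
  have := U (Num.sqrt (2 * x)); have := L (Num.sqrt (2 * x)); rewrite sx.
  have -> : (2 * x / 2 = x)%R by field.
  have e1 := bnd x xb; have e2 := expR_ge1Dx x; have e3 := expR_sub1_le x.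
  move=> hL hU; split.
    have : (x * m <= x * expR x)%R by nra.
    by rewrite ler_pM2l// => /le_trans; apply.
  have : (x * 1 <= x * ((m + 2 * x) * expR x))%R by nra.
  rewrite ler_pM2l// => /le_trans; apply.
  by apply: ler_wpM2l => //; rewrite addr_ge0// mulr_ge0// ltW.
rewrite -/m2 mE; congr (_%:E); apply/eqP; rewrite eq_le; apply/andP; split.
  apply/ler_addgt0Pr => e e0.
  have [|h _] := key (Num.min (e / 2) 2^-1)%R.
    by rewrite lt_min divr_gt0//= invr_gt0// ltr0n/= ge_min lexx orbT.
  apply: le_trans h _; rewrite lerD2l.
  have : (Num.min (e / 2) 2^-1 <= e / 2)%R by rewrite ge_min lexx.
  by lra.
have m1 : (m <= 2)%R by have [|h _] := key 2^-1%R; [lra|lra].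
apply/ler_addgt0Pr => e e0.
(* With m <= 2 and x <= 1/2, the product (m + 2x)(1 + 2x) exceeds m by at most 8x; hence e / 8. *)
have [|_ h] := key (Num.min (e / 8) 2^-1)%R.
  by rewrite lt_min divr_gt0//= invr_gt0// ltr0n/= ge_min lexx orbT.
apply: le_trans h _.
have h1 : (Num.min (e / 8) 2^-1 <= e / 8)%R by rewrite ge_min lexx.
have h2 : (Num.min (e / 8) 2^-1 <= 2^-1 :> R)%R by rewrite ge_min lexx orbT.
have h3 : (0 < Num.min (e / 8) 2^-1)%R by rewrite lt_min divr_gt0//= invr_gt0// ltr0n.
by nra.
Qed.

Lemma gpdf0_ge : (4^-1 <= gpdf 0 :> R)%R.
Proof.
rewrite /gpdf normal_pdfE ?oner_neq0// /normal_fun subrr expr0n/= oppr0 mul0r expR0 mulr1.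
rewrite /normal_peak lef_pV2 ?posrE//; last first.
  by rewrite sqrtr_gt0 expr1n mul1r mulrn_wgt0// pi_gt0.
have -> : (4 = Num.sqrt (4 ^+ 2) :> R)%R by rewrite sqrtr_sqr ger0_norm.
rewrite ler_sqrt; last exact: sqr_ge0.
rewrite expr1n mul1r -mulr_natr; have := @pihalf_lt2 R; lra.
Qed.

(** On [u, u + 1] the density is at least [gpdf 0] times exp(-(u + 1)^2 / 2), and (u + 1)^2 / 2 <=
    u^2 + 1. The factor 16 covers [gpdf 0] >= 1/4 and e <= 4. *)
Lemma gauss_tail (u : R) : (0 <= u)%R ->
  (expR (- u ^+ 2) / 16)%:E <= gauss [set t | (u <= t)%R].
Proof.
move=> u0.
have mI : measurable (`[u, (u + 1)%R] : set R) by [].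
have mS : measurable [set t : R | (u <= t)%R].
  by rewrite -[X in measurable X]/([set t | (u <= t)%R]) -set_itvcy.
apply: (@le_trans _ _ (gauss (`[u, (u + 1)%R]%classic : set R))); last first.
  apply: le_measure; rewrite ?inE//.
  by move=> t /=; rewrite in_itv/= => /andP[].
have -> : gauss (`[u, (u + 1)%R]%classic : set R) =
  \int[leb]_(x in (`[u, (u + 1)%R]%classic : set (measurableTypeR R))) (gpdf x)%:E by [].
apply: (@le_trans _ _ (\int[leb]_(x in (`[u, (u + 1)%R]%classic : set (measurableTypeR R)))
   (cst (expR (- u ^+ 2) / 16)%:E) x)).
  rewrite integral_cst//= lebesgue_measure_itv/= lte_fin ltrDl ltr01 -EFinB.
  by rewrite addrAC subrr add0r mule1.
apply: ge0_le_integral => //.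
- by move=> x _; rewrite lee_fin divr_ge0 ?expR_ge0.
- by apply/measurable_EFinP; apply: measurable_funTS; exact: measurable_gpdf.
move=> x /=; rewrite in_itv/= => /andP[ux xu]; rewrite lee_fin gpdfE.
have e1 : (expR 1 <= 4 :> R)%R.
  have -> : (1 = 2^-1 + 2^-1 :> R)%R by field.
  rewrite expRD; have := @expR_half_le2 R; have := expR_ge0 (2^-1 : R); nra.
have e2 : (expR (- u ^+ 2) <= 4 * expR (- x ^+ 2 / 2))%R.
  apply: (@le_trans _ _ (expR 1 * expR (- x ^+ 2 / 2))%R); last first.
    by rewrite ler_wpM2r// expR_ge0.
  rewrite -expRD ler_expR.
  have hx : (x ^+ 2 <= (u + 1) ^+ 2)%R.
    by rewrite lerXn2r// nnegrE; lra.
  by have := sqr_ge0 (u - 1); lra.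
have := gpdf0_ge; have := expR_ge0 (- x ^+ 2 / 2)%R; nra.
Qed.

End GaussMoments.

(** * Sub-gaussian laws *)

Section Subgaussian.
Context {R : realType}.
Variables (mu : probability R R) (kappa : R).
Hypothesis mu_sg : subgaussian_norm mu = kappa%:E.
Local Open Scope ereal_scope.

Lemma measurable_normX k : measurable_fun setT (fun t : R => `|t| ^+ k)%R.
Proof. by apply: measurable_funX; exact: normr_measurable. Qed.

Lemma subgaussian_moment (k : nat) : (0 < k)%N ->
  \int[mu]_t (`|t| ^+ k)%:E <= (((kappa ^+ 2 * k%:R) `^ 2^-1) ^+ k)%:E /\ (0 <= kappa)%R.
Proof.
move=> k0; have k1 : (1 <= k%:R :> R)%R by rewrite ler1n.
have kR : (0 < k%:R :> R)%R by rewrite ltr0n.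
have kn0 : (k%:R != 0 :> R)%R by rewrite gt_eqF.
set I := \int[mu]_t _; have I0 : 0 <= I by apply: integral_ge0 => t _; rewrite lee_fin exprn_ge0.
have h : ((k%:R : R) `^ (- 2^-1))%:E * (I `^ (k%:R^-1)) <= kappa%:E.
  rewrite -mu_sg; apply: ereal_sup_ubound; exists (k%:R : R) => //.
  congr (_ * (_ `^ _)); apply: eq_integral => t _.
  by rewrite powR_mulrn.
have p0 : (0 < (k%:R : R) `^ (- 2^-1))%R by rewrite powR_gt0.
have kap0 : (0 <= kappa)%R.
  by rewrite -lee_fin; apply: le_trans h; rewrite mule_ge0 ?poweR_ge0// lee_fin ltW.
split => //; move: I0 h; case: I => [r| |]//; last first.
  (* An infinite moment would make the norm infinite. *)
  move=> _; rewrite poweRyr ?invr_eq0//.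
  by rewrite gt0_muley ?lte_fin// leye_eq.
rewrite !lee_fin => r0 h0.
have h : ((k%:R : R) `^ (- 2^-1) * r `^ k%:R^-1 <= kappa)%R by [].
clear h0.
have h2 : (r `^ k%:R^-1 <= (kappa ^+ 2 * k%:R) `^ 2^-1)%R.
  rewrite powRM ?sqr_ge0 ?ler0n// [((kappa ^+ 2) `^ _)%R]powR12_sqrt ?sqr_ge0// sqrtr_sqr ger0_norm//.
  by move: h; rewrite powRN ler_pdivrMl ?powR_gt0// [(kappa * _)%R]mulrC.
have -> : r = ((r `^ k%:R^-1) ^+ k)%R.
  by rewrite -powR_mulrn ?powR_ge0// -powRrM mulVf// powRr1.
by rewrite lerXn2r// nnegrE powR_ge0.
Qed.

Lemma subgaussian_even_moment (k : nat) :
  \int[mu]_t ((t ^+ 2) ^+ k)%:E <= ((kappa ^+ 2 * (2 * k)%:R) ^+ k)%:E.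
Proof.
case: k => [|k].
  rewrite expr0; under eq_integral do rewrite expr0.
  by rewrite int_cst.
have [h kap0] := subgaussian_moment (2 * k.+1) isT.
apply: le_trans (le_trans h _).
  apply: le_int => [||t|t].
  - by meas.
  - exact: measurable_normX.
  - by rewrite exprn_ge0// sqr_ge0.
  - by rewrite exprM -[(`|t| ^+ 2)%R]normrX ger0_norm// sqr_ge0.
rewrite lee_fin exprM powR12_sqrt ?mulr_ge0 ?sqr_ge0//.
by rewrite sqr_sqrtr// mulr_ge0 ?sqr_ge0.
Qed.

Lemma subgaussian_norm_ge0 : (0 <= kappa)%R.
Proof. by have [] := subgaussian_moment 1 isT. Qed.

Lemma subgaussian_fourth : \int[mu]_t (t ^+ 4)%:E <= (16 * kappa ^+ 4)%:E.
Proof.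
have := subgaussian_even_moment 2.
under eq_integral do rewrite -exprM.
by move/le_trans; apply; rewrite lee_fin; have := sqr_ge0 (kappa ^+ 2); lra.
Qed.

Hypothesis mu_var : \int[mu]_t (t ^+ 2)%:E = 1.

(** The case q = 2 of the norm. Through it powers of kappa absorb absolute constants. *)
Lemma subgaussian_norm_sqr_ge : (2^-1 <= kappa ^+ 2)%R.
Proof.
have := subgaussian_even_moment 1.
by under eq_integral do rewrite expr1; rewrite mu_var lee_fin expr1; lra.
Qed.

Lemma subgaussian_norm_gt0 : (0 < kappa)%R.
Proof.
have := subgaussian_norm_sqr_ge; rewrite lt_neqAle subgaussian_norm_ge0 andbT.
by apply: contraTneq => <-; rewrite expr0n/= -ltNge invr_gt0.
Qed.

Lemma expR_nneseries (x : R) : (0 <= x)%R ->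
  (expR x)%:E = \sum_(k <oo) (x ^+ k / k`!%:R)%:E.
Proof.
move=> x0; rewrite /expR -EFin_lim; last exact: is_cvg_series_exp_coeff.
congr (limn _); apply/funext => n /=; rewrite /series/= -sumEFin.
by apply: eq_bigr.
Qed.

(** The exponential e^k is at least the term k^k / k! of its series, and e <= 4. *)
Lemma pow_le_fact (k : nat) : (k%:R ^+ k <= 4 ^+ k * k`!%:R :> R)%R.
Proof.
case: k => [|k]; first by rewrite !expr0 mul1r.
have e1 : (expR 1 <= 4 :> R)%R.
  have -> : (1 = 2^-1 + 2^-1 :> R)%R by field.
  rewrite expRD; have := @expR_half_le2 R; have := expR_ge0 (2^-1 : R); nra.
have := @expR_ge1Dxn R k.+1%:R k (ler0n _ _).
have -> : (expR k.+1%:R = expR 1 ^+ k.+1 :> R)%R by rewrite -expRM_natl mulr1.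
have : (expR 1 ^+ k.+1 <= 4 ^+ k.+1 :> R)%R.
  by rewrite lerXn2r// nnegrE ?expR_ge0.
have f0 : (0 < k.+1`!%:R :> R)%R by rewrite ltr0n fact_gt0.
move=> h1 h2; rewrite -ler_pdivrMr//.
by apply: le_trans h1; apply: le_trans h2; rewrite lerDr.
Qed.

(** Expand in a series: by the even moments the k-th term is at most k^k / (8^k k!) <= 2^-k, and
    these bounds add up to 2. *)
Lemma subgaussian_exp_sqr :
  \int[mu]_t (expR (t ^+ 2 / (4 * kappa) ^+ 2))%:E <= 2%:E.
Proof.
have kap0 := subgaussian_norm_gt0.
have c0 : (0 < (4 * kappa) ^+ 2)%R by rewrite exprn_gt0// mulr_gt0.
have x0 (t : R) : (0 <= t ^+ 2 / (4 * kappa) ^+ 2)%R.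
  by rewrite divr_ge0// ?sqr_ge0.
under eq_integral => t _ do rewrite (expR_nneseries _ (x0 t)).
rewrite integral_nneseries//; last 2 first.
- move=> k; apply/measurable_EFinP; by meas.
- by move=> k t _; rewrite lee_fin divr_ge0// exprn_ge0.
apply: (@le_trans _ _ (\sum_(k <oo) ((1 / (2 ^ k.+1)%:R : R))%:E * 2%:E)).
  apply: lee_nneseries => [k _ _|k _].
    by apply: integral_ge0 => t _; rewrite lee_fin divr_ge0// exprn_ge0.
  have f0 : (0 < k`!%:R :> R)%R by rewrite ltr0n fact_gt0.
  have -> : \int[mu]_t ((t ^+ 2 / (4 * kappa) ^+ 2) ^+ k / k`!%:R)%:E =
      (((4 * kappa) ^+ 2) ^- k / k`!%:R)%:E * \int[mu]_t ((t ^+ 2) ^+ k)%:E.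
    rewrite -intZ; [|by meas|by rewrite divr_ge0// invr_ge0 exprn_ge0// ltW
      |by move=> t; rewrite exprn_ge0// sqr_ge0].
    by apply: eq_integral => t _; congr (_%:E); rewrite exprMn exprVn; ring.
  apply: (@le_trans _ _ ((((4 * kappa) ^+ 2) ^- k / k`!%:R)%:E *
      ((kappa ^+ 2 * (2 * k)%:R) ^+ k)%:E)).
    apply: lee_wpmul2l (subgaussian_even_moment k).
    by rewrite lee_fin divr_ge0// invr_ge0 exprn_ge0// ltW.
  rewrite -EFinM lee_fin natrM natrX.
  have q0 : (kappa ^+ 2 != 0)%R by rewrite expf_neq0// gt_eqF.
  rewrite [leLHS](_ : _ = (8 ^+ k)^-1 * (k%:R ^+ k / k`!%:R))%R; last first.
    have -> : ((4 * kappa) ^+ 2 = 8 * 2 * kappa ^+ 2)%R by ring.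
    set q := (kappa ^+ 2)%R in q0 *.
    rewrite !exprMn; field.
    by rewrite !expf_neq0// gt_eqF.
  rewrite [leRHS](_ : _ = (8 ^+ k)^-1 * 4 ^+ k)%R; last first.
    have -> : (8 = 2 * 4 :> R)%R by ring.
    rewrite exprMn exprS; field.
    by rewrite !expf_neq0.
  apply: ler_wpM2l; first by rewrite invr_ge0 exprn_ge0.
  by rewrite ler_pdivrMr// pow_le_fact.
under eq_eseriesr do rewrite muleC.
rewrite nneseriesZl//.
have -> : \sum_(k <oo) ((1 / (2 ^ k.+1)%:R : R))%:E = 1%:E.
  apply/cvg_lim => //.
  have := @cvg_geometric_eseries_half R 1 0.
  rewrite expr0 divr1.
  have -> // : (fun k => (1 / (2 ^ (k + 1))%:R)%:E : \bar R) =
      (fun k => (1 / (2 ^ k.+1)%:R)%:E).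
  by apply/funext => k; rewrite addn1.
by rewrite mule1.
Qed.

End Subgaussian.

(** * Convex domination of a sub-gaussian law by a Gaussian *)

Section Domination.
Context {R : realType}.
Local Notation gauss := (@gauss R).

Definition cvx1 (f : R -> R) : Prop := forall x y t, 0 <= t -> t <= 1 ->
  f (t * x + (1 - t) * y) <= t * f x + (1 - t) * f y.

Definition sym_integral (nu : probability R R) : Prop :=
  forall f : R -> \bar R, measurable_fun setT f -> (forall x, 0 <= f x)%E ->
  (\int[nu]_x f (- x)%R = \int[nu]_x f x)%E.

Lemma symmetric_law_integral (mu : probability R R) :
  symmetric_law mu -> sym_integral mu.
Proof.
move=> smu f mf f0.
rewrite -[LHS](@ge0_integral_pushforward _ _ _ _ _ _ (@oppr_measurable R setT) mu setT f)//.
apply: eq_measure_integral => A mA _.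
apply: (etrans _ (smu A mA)); congr (mu _).
apply/seteqP; split => x /=.
  by move=> Ax; exists (- x) => //; rewrite opprK.
by move=> [t At <-]; rewrite opprK.
Qed.

(** Let psi(t) = f(t) + f(-t), convex with its minimum at 0, and let j be the Gaussian integral of
    psi(32 M g). For t >= 0, if g >= t / M, convexity gives psi(32 M g) >= psi(0) + 32 (psi(t) -
    psi(0)). This event has probability at least exp(-(t/M)^2) / 16, so psi(t) - psi(0) is at most
    (j - psi(0)) exp((t/M)^2) / 2, and [mu] integrates this exponential to at most 2. Thus 32 is 16
    times 2, and 128 is 32 times the 4 of M = 4 kappa. *)
Lemma gauss_dominates (mu : probability R R) (kappa : R) (f : R -> R) :
  symmetric_law mu -> subgaussian_norm mu = kappa%:E ->
  (\int[mu]_t (t ^+ 2)%:E = 1)%E ->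
  measurable_fun setT f -> (forall x, 0 <= f x) -> cvx1 f ->
  (\int[mu]_t (f t)%:E <= \int[gauss]_t (f (128 * kappa * t))%:E)%E.
Proof.
move=> smu mu_sg mu_var mf f0 fcvx.
have kap0 : 0 < kappa := subgaussian_norm_gt0 _ _ mu_sg mu_var.
pose M := 4 * kappa; have M0 : 0 < M by rewrite mulr_gt0.
have -> : 128 * kappa = 32 * M by rewrite /M; ring.
pose psi t := f t + f (- t).
have psi_even t : psi (- t) = psi t by rewrite /psi opprK addrC.
have psi_ge0 t : 0 <= psi t by rewrite addr_ge0.
have psi_cvx : cvx1 psi.
  move=> x y t t0 t1; rewrite /psi.
  have h1 := fcvx x y t t0 t1; have h2 := fcvx (- x) (- y) t t0 t1.
  have -> : - (t * x + (1 - t) * y) = t * - x + (1 - t) * - y by ring.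
  by lra.
have psi0_le t : psi 0 <= psi t.
  have := fcvx t (- t) 2^-1; rewrite /psi oppr0.
  have -> : 2^-1 * t + (1 - 2^-1) * - t = 0 by field.
  by move=> /(_ _ _); lra.
have psi_mono s t : 0 <= s -> s <= t -> psi s <= psi t.
  move=> s0 st; have := s0; rewrite le_eqVlt => /predU1P[<-//|s1].
  have t0 : 0 < t by exact: lt_le_trans st.
  have l0 : 0 <= s / t by rewrite divr_ge0// ltW.
  have l1 : s / t <= 1 by rewrite ler_pdivrMr// mul1r.
  have := psi_cvx t 0 (s / t) l0 l1.
  rewrite mulr0 addr0 divfK ?gt_eqF//; move/le_trans; apply.
  by have := psi0_le t; nra.
have mpsi : measurable_fun setT psi.
  apply: measurable_funD => //.
  by apply: (measurableT_comp mf); exact: oppr_measurable.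
have mlin (c : R) : measurable_fun setT (fun t : R => c * t) by meas.
have mflin (c : R) : measurable_fun setT (fun t : R => f (c * t)).
  exact: (measurableT_comp mf (mlin c)).
have mpsilin (c : R) : measurable_fun setT (fun t : R => psi (c * t)).
  exact: (measurableT_comp mpsi (mlin c)).
have dbl (nu : probability R R) (c : R) : sym_integral nu ->
    (\int[nu]_t (psi (c * t))%:E = 2%:E * \int[nu]_t (f (c * t))%:E)%E.
  move=> snu; rewrite /psi intD; [|by []|by under eq_fun do rewrite -mulrN; apply: (measurableT_comp (mflin c)); exact: oppr_measurable|by []|by []].
  have -> : (\int[nu]_x (f (- (c * x)))%:E = \int[nu]_x (f (c * x))%:E)%E.
    rewrite -[RHS](snu (fun x => (f (c * x))%:E)).
    - by apply: eq_integral => x _; rewrite mulrN.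
    - exact/measurable_EFinP.
    - by move=> x; rewrite lee_fin.
  have -> : (2%:E = 1 + 1 :> \bar R)%E by rewrite -EFinD.
  by rewrite ge0_muleDl ?mul1e ?lee01.
have sg : sym_integral gauss by move=> h mh h0; exact: gauss_sym.
have := dbl gauss (32 * M) sg.
have := dbl mu 1 (symmetric_law_integral _ smu).
under eq_integral do rewrite mul1r.
under [X in _ = (_ * X)%E -> _]eq_integral do rewrite mul1r.
have gf0 : (0 <= \int[gauss]_t (f (32 * M * t))%:E)%E by exact: int_ge0.
move: gf0; case: (\int[gauss]_t (f (32 * M * t))%:E)%E => [b| |] //; last first.
  by move=> *; exact: leey.
rewrite lee_fin => b0 dmu; rewrite -EFinM => dg.
pose j := 2 * b.
have key t : psi 0 + 32 * (psi t - psi 0) * (expR (- (t / M) ^+ 2) / 16) <= j.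
  wlog t0 : t / 0 <= t => [H|].
    case: (lerP 0 t) => [/H//|/ltW tN].
    by have := H (- t); rewrite psi_even mulNr sqrrN; apply; rewrite oppr_ge0.
  have u0 : 0 <= t / M by rewrite divr_ge0// ltW.
  have mS : measurable [set s : R | t / M <= s].
    by rewrite -set_itvcy.
  have mI : measurable_fun setT (\1_[set s : R | t / M <= s] : R -> R).
    exact: measurable_indic.
  have D0 : 0 <= 32 * (psi t - psi 0) by rewrite mulr_ge0// subr_ge0.
  rewrite -lee_fin -dg EFinD EFinM.
  apply: (@le_trans _ _ ((psi 0)%:E + (32 * (psi t - psi 0))%:E *
      \int[gauss]_s (\1_[set s : R | t / M <= s] s)%:E)%E).
    rewrite leeD2l// integral_indic// setIT.
    by apply: lee_wpmul2l; [rewrite lee_fin|exact: gauss_tail].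
  rewrite -intZ; [|by []|by []|by []].
  rewrite -(int_cst gauss (psi 0)) -intD; [|by []|by apply: measurable_funM|by []|by move=> s; rewrite mulr_ge0].
  apply: le_int => [||s|s].
  - by apply: measurable_funD => //; apply: measurable_funM.
  - exact: mpsilin.
  - by rewrite addr_ge0// mulr_ge0.
  rewrite indicE; have [|_] := boolP (s \in [set s : R | t / M <= s]) => /=; last by rewrite mulr0 addr0 psi0_le.
  rewrite inE /= mulr1 => us.
  have Kt : 0 <= 32 * t by rewrite mulr_ge0.
  have st : 32 * t <= 32 * M * s.
    by rewrite -mulrA ler_pM2l//; move: us; rewrite ler_pdivrMr// mulrC.
  have := psi_mono _ _ Kt st.
  have := psi_cvx (32 * t) 0 32^-1; rewrite mulr0 addr0 mulKf ?gt_eqF//.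
  by move=> /(_ _ _); lra.
have j0 : psi 0 <= j.
  by have := key 0; rewrite mul0r expr0n/= oppr0 expR0 subrr mulr0 mul0r addr0.
have : (\int[mu]_t (32 * psi t)%:E <= (32 * j)%:E)%E.
  pose e t := expR (t ^+ 2 / M ^+ 2).
  have me : measurable_fun setT e by rewrite /e; meas.
  have e0 t : 0 <= e t by exact: expR_ge0.
  have c0 : 0 <= 16 * (j - psi 0) by rewrite mulr_ge0// subr_ge0.
  apply: (@le_trans _ _ (\int[mu]_t (32 * psi 0 + 16 * (j - psi 0) * e t)%:E)%E).
    apply: le_int => [||t|t].
    - by apply: measurable_funM.
    - by apply: measurable_funD => //; apply: measurable_funM.
    - by rewrite mulr_ge0.
    have := key t; have e1 : e t * expR (- (t / M) ^+ 2) = 1.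
      by rewrite /e -expRD expr_div_n subrr expR0.
    set q := expR _ in e1 * => h.
    have : e t * (psi 0 + 32 * (psi t - psi 0) * (q / 16)) <= e t * j.
      exact: ler_wpM2l.
    have -> : e t * (psi 0 + 32 * (psi t - psi 0) * (q / 16)) =
      e t * psi 0 + 2 * (psi t - psi 0) * (e t * q) by field.
    by rewrite e1; lra.
  rewrite intD; [|by []|by apply: measurable_funM|by move=> _; rewrite mulr_ge0|by move=> t; rewrite mulr_ge0].
  rewrite int_cst intZ; [|by []|by []|by []].
  apply: (@le_trans _ _ ((32 * psi 0)%:E + (16 * (j - psi 0))%:E * 2%:E)%E).
    rewrite leeD2l//; apply: lee_wpmul2l; first by rewrite lee_fin.
    exact: subgaussian_exp_sqr.
  by rewrite -EFinM -EFinD lee_fin; lra.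
rewrite intZ; [|by []|by []|by []].
rewrite dmu /j.
have fmu0 : (0 <= \int[mu]_t (f t)%:E)%E by exact: int_ge0.
move: fmu0; case: (\int[mu]_t (f t)%:E)%E => [a| |] //.
  by rewrite -!EFinM !lee_fin; lra.
by move=> _; rewrite gt0_muley ?lte_fin// gt0_muley ?lte_fin.
Qed.

Definition std_law (nu : probability R R) (M : R) : Prop :=
  [/\ sym_integral nu, (\int[nu]_t (t ^+ 2)%:E = 1)%E &
      (\int[nu]_t (t ^+ 4)%:E <= M%:E)%E].

Lemma gauss_std_law (M : R) : 100 <= M -> std_law gauss M.
Proof.
move=> M100; split.
- by move=> f mf f0; exact: gauss_sym.
- exact: gauss_second_moment.
- by apply: le_trans gauss_fourth_moment _; rewrite lee_fin.
Qed.

(** The moment bound gives 16 kappa^4. The larger constant 400 makes the bound at least 100, as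
    kappa^4 >= 1/4, so that one value serves for [mu] and for the Gaussian. *)
Lemma subgaussian_std_law (mu : probability R R) (kappa : R) :
  symmetric_law mu -> subgaussian_norm mu = kappa%:E ->
  (\int[mu]_t (t ^+ 2)%:E = 1)%E -> std_law mu (400 * kappa ^+ 4).
Proof.
move=> smu sg var; split => //; first exact: symmetric_law_integral.
apply: le_trans (subgaussian_fourth _ _ sg) _; rewrite lee_fin.
by have := sqr_ge0 (kappa ^+ 2); lra.
Qed.

End Domination.

(** * Gaussian vectors and concentration *)

Section ItintTools.
Context {R : realType} {d : measure_display} {E : measurableType d} {I : eqType}.
Local Open Scope ereal_scope.

Lemma eq_itint_on (nu : I -> probability E R) l (f g : env I E -> \bar R) c :
  (forall c' : env I E, (forall j, j \notin l -> c' j = c j) -> f c' = g c') ->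
  itint nu l f c = itint nu l g c.
Proof.
elim: l c => [|i l IH] c fg /=; first exact: fg.
apply: eq_integral => t _; apply: IH => c' c'E; apply: fg => j.
rewrite inE negb_or => /andP[ji jl]; rewrite c'E// /update.
by rewrite (negbTE ji).
Qed.

Lemma itint_map (nu : probability E R) (rho : E -> E) l (f : env I E -> \bar R) c :
  (forall g : E -> \bar R, measurable_fun setT g -> (forall x, 0 <= g x) ->
     \int[nu]_x g (rho x) = \int[nu]_x g x) ->
  measurable_fun setT f -> (forall c, 0 <= f c) ->
  itint (fun=> nu) l (fun c' => f (fun j => rho (c' j))) c =
  itint (fun=> nu) l f (fun j => rho (c j)).
Proof.
move=> hrho mf f0; elim: l c => [|i l IH] c //=.
rewrite -[RHS](hrho (fun t => itint (fun=> nu) l f (update (fun j => rho (c j)) i t))).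
- apply: eq_integral => t _; rewrite IH; congr itint.
  by apply/funext => j; rewrite /update; case: (j == i).
- by apply: measurable_comp_update; exact: measurable_itint.
- by move=> t; exact: itint_ge0.
Qed.

(** The coordinates are replaced one at a time. Tonelli brings the replaced variable to the
    innermost place, where the test function is a slice of [H] itself; convexity along each
    coordinate is therefore enough. *)
Lemma itint_dominated (nu1 nu2 : probability R R) l (H : env I R -> R) c :
  (forall f : R -> R, measurable_fun setT f -> (forall x, (0 <= f x)%R) -> cvx1 f ->
     \int[nu1]_x (f x)%:E <= \int[nu2]_x (f x)%:E) ->
  measurable_fun setT H -> (forall c, (0 <= H c)%R) ->
  (forall c i, cvx1 (fun t => H (update c i t))) -> uniq l ->
  itint (fun=> nu1) l (fun c => (H c)%:E) c <= itint (fun=> nu2) l (fun c => (H c)%:E) c.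
Proof.
move=> dom mH H0 cH; have mHE : measurable_fun setT (fun c => (H c)%:E).
  exact/measurable_EFinP.
have H0E (c' : env I R) : 0 <= (H c')%:E by rewrite lee_fin.
elim: l c => [|i l IH] c //= /andP[il ul].
apply: (@le_trans _ _ (\int[nu1]_t itint (fun=> nu2) l (fun c => (H c)%:E) (update c i t))).
  apply: ge0_le_integral => //.
  - by move=> t _; exact: itint_ge0.
  - by apply: measurable_comp_update; exact: measurable_itint.
  - by apply: measurable_comp_update; exact: measurable_itint.
  - by move=> t _; exact: IH.
rewrite !itint_integral_updateC//.
apply: le_itint.
- exact: (measurable_integral_update nu1 i (fun c => (H c)%:E)).
- by move=> c1; exact: (integral_update_ge0 nu1 i (fun c => (H c)%:E)).
- exact: (measurable_integral_update nu2 i (fun c => (H c)%:E)).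
move=> c'; apply: dom; last exact: cH.
- by apply: (measurableT_comp mH); exact: measurable_updater.
- by move=> x; exact: H0.
Qed.

End ItintTools.

Section ItintPair.
Context {R : realType} {I : eqType} (nu : probability R R).
Local Open Scope ereal_scope.

Definition pair_env (c1 c2 : env I R) : env I (R * R)%type := fun j => (c1 j, c2 j).
Definition fst_env (c : env I (R * R)%type) : env I R := fun j => (c j).1.
Definition snd_env (c : env I (R * R)%type) : env I R := fun j => (c j).2.

Lemma measurable_fst_env : measurable_fun setT fst_env.
Proof.
by apply: measurable_env => i; apply: (measurableT_comp measurable_fst); exact: measurable_coord.
Qed.

Lemma measurable_snd_env : measurable_fun setT snd_env.
Proof.
by apply: measurable_env => i; apply: (measurableT_comp measurable_snd); exact: measurable_coord.
Qed.

Lemma measurable_itint_fst l (f : env I R * env I R -> \bar R) c2 :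
  measurable_fun setT f -> (forall p, 0 <= f p) ->
  measurable_fun setT (fun u => itint (fun=> nu) l (fun v => f (u, v)) c2).
Proof.
move=> mf f0.
have mf' : measurable_fun setT (fun p : env I R * env I R => f (p.1, p.2)).
  by apply: (measurableT_comp mf); exact: measurable_fun_pair.
have mi := measurable_itint_param _ _ (fun=> nu) l (fun u v => f (u, v)) mf' (fun _ _ => f0 _).
apply: (@measurableT_comp _ _ _ _ _ _ (fun p : env I R * env I R =>
    itint (fun=> nu) l (fun v => f (p.1, v)) p.2) _ (fun u => (u, c2))) => //.
Qed.

(** Regrouping two independent copies coordinate by coordinate lets a rotation of the plane act on
    each pair separately. *)
Lemma itint_pair l (f : env I R * env I R -> \bar R) c1 c2 : uniq l ->
  measurable_fun setT f -> (forall p, 0 <= f p) ->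
  itint (fun=> nu) l (fun u => itint (fun=> nu) l (fun v => f (u, v)) c2) c1 =
  itint (fun=> (nu \x nu)%E : probability (R * R)%type R) l
    (fun c => f (fst_env c, snd_env c)) (pair_env c1 c2).
Proof.
move=> ul mf f0.
have mg : measurable_fun setT (fun c => f (fst_env c, snd_env c)).
  apply: (measurableT_comp mf); apply: measurable_fun_pair.
    exact: measurable_fst_env.
  exact: measurable_snd_env.
elim: l c1 c2 ul => [|i l IH] c1 c2 //= /andP[il ul].
have mu' : measurable_fun setT (fun p : R * R =>
    itint (fun=> (nu \x nu)%E : probability (R * R)%type R) l
    (fun c => f (fst_env c, snd_env c)) (update (pair_env c1 c2) i p)).
  by apply: measurable_comp_update; apply: measurable_itint.
rewrite [RHS](fubini_tonelli1 (fun p => itint (fun=> (nu \x nu)%E : probability (R * R)%type R) l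
    (fun c => f (fst_env c, snd_env c)) (update (pair_env c1 c2) i p)) mu'); last first.
  by move=> p; exact: itint_ge0.
apply: eq_integral => s _ /=; rewrite /fubini_F.
rewrite -integral_itint; last 2 first.
- apply: (@measurableT_comp _ _ _ _ _ _ (fun q : env I R * env I R =>
    itint (fun=> nu) l (fun v => f (q.1, v)) q.2) _
    (fun p : R * env I R => (p.2, update c2 i p.1))); last first.
    apply: measurable_fun_pair => //.
    by apply: (measurableT_comp (measurable_updater i c2)).
  by apply: (measurable_itint_param _ _ (fun=> nu) l (fun u v => f (u, v))) => //; apply: (measurableT_comp mf); exact: measurable_fun_pair.
- by move=> t c; exact: itint_ge0.
apply: eq_integral => t _; rewrite IH//; congr itint.
by apply/funext => j; rewrite /pair_env /update; case: (j == i).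
Qed.

End ItintPair.

Section GaussVector.
Context {R : realType} {I : finType} {dQ : measure_display}
  {Q : measurableType dQ} {PQ : probability Q R} {G : I -> Q -> R}.
Hypothesis mG : forall i, measurable_fun setT (G i).
Local Notation gauss := (@gauss R).
Hypothesis iG : indep_law PQ G (fun=> gauss).
Local Open Scope ereal_scope.

Definition vec (w : Q) : env I R := fun j => G j w.

Lemma measurable_vec : measurable_fun setT vec.
Proof. exact: measurable_env. Qed.

Let c0 : env I R := fun=> 0%R.

Lemma gauss_vecE (f : env I R -> \bar R) :
  measurable_fun setT f -> (forall c, 0 <= f c) ->
  \int[PQ]_w f (vec w) = itint (fun=> gauss) (enum I) f c0.
Proof.
by move=> mf f0; apply: (indep_integral mG iG) => // i; rewrite mem_enum.
Qed.

Lemma gauss_vec_pairE (f : env I R * env I R -> \bar R) :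
  measurable_fun setT f -> (forall c, 0 <= f c) ->
  \int[PQ]_w \int[PQ]_w' f (vec w, vec w') =
  itint (fun=> (gauss \x gauss)%E : probability (R * R)%type R) (enum I)
    (fun c => f (fst_env c, snd_env c)) (pair_env c0 c0).
Proof.
move=> mf f0; rewrite -itint_pair ?enum_uniq//.
rewrite -(gauss_vecE (fun u => itint (fun=> gauss) (enum I) (fun v => f (u, v)) c0)).
- apply: eq_integral => w _.
  rewrite (gauss_vecE (fun v => f (vec w, v)))//.
  by apply: (measurableT_comp mf); exact: measurable_pair1.
- exact: measurable_itint_fst.
- by move=> c; exact: itint_ge0.
Qed.

Lemma gauss_vec_rotation (f : env I R * env I R -> \bar R) (a b : R) :
  measurable_fun setT f -> (forall p, 0 <= f p) ->
  (0 < a)%R -> (a ^+ 2 + b ^+ 2 = 1)%R ->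
  \int[PQ]_w \int[PQ]_w'
    f (fun j => (a * vec w j + b * vec w' j)%R, fun j => (a * vec w' j - b * vec w j)%R) =
  \int[PQ]_w \int[PQ]_w' f (vec w, vec w').
Proof.
move=> mf f0 a0 ab.
pose rho (p : R * R) := ((a * p.1 + b * p.2)%R, (a * p.2 - b * p.1)%R).
have mrho : measurable_fun setT rho.
  by apply: measurable_fun_pair; meas.
have mg : measurable_fun setT (fun c : env I (R * R)%type => f (fst_env c, snd_env c)).
  apply: (measurableT_comp mf); apply: measurable_fun_pair.
    exact: measurable_fst_env.
  exact: measurable_snd_env.
pose fr (q : env I R * env I R) := f (fun j => (a * q.1 j + b * q.2 j)%R, fun j => (a * q.2 j - b * q.1 j)%R).
have mfr : measurable_fun setT fr.
  apply: (measurableT_comp mf); apply: measurable_fun_pair; apply: measurable_env => j.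
    apply: measurable_funD; apply: measurable_funM => //.
      by apply: (measurableT_comp (measurable_coord j)).
    by apply: (measurableT_comp (measurable_coord j)).
  apply: measurable_funB; apply: measurable_funM => //.
    by apply: (measurableT_comp (measurable_coord j)).
  by apply: (measurableT_comp (measurable_coord j)).
transitivity (\int[PQ]_w \int[PQ]_w' fr (vec w, vec w')); first by [].
rewrite (gauss_vec_pairE fr mfr (fun q => f0 _)).
rewrite [RHS](gauss_vec_pairE f mf f0).
transitivity (itint (fun=> (gauss \x gauss)%E : probability (R * R)%type R) (enum I)
    (fun c => f (fst_env (fun j => rho (c j)), snd_env (fun j => rho (c j)))) (pair_env c0 c0)).
  by [].
rewrite (itint_map ((gauss \x gauss)%E : probability (R * R)%type R) rho (enum I)
  (fun c => f (fst_env c, snd_env c)))//.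
  congr itint; apply/funext => j; rewrite /pair_env /rho /c0 /=.
  by rewrite !mulr0 addr0 subr0.
move=> g mg' g0.
have mgr : measurable_fun setT (fun p => g (rho p)) by exact: measurableT_comp mg' mrho.
rewrite [LHS](@fubini_tonelli1 _ _ R R R gauss gauss (fun p => g (rho p)) mgr (fun=> g0 _)).
rewrite [RHS](@fubini_tonelli1 _ _ R R R gauss gauss g mg' g0).
exact: gauss_rotation.
Qed.

(** Rotate the pair (X, Y) so that (a X + b Y) / r becomes its first component, r being the square
    root of a^2 + b^2; the second component then integrates out. *)
Lemma gauss_vec_add (f : env I R -> \bar R) (a b : R) :
  measurable_fun setT f -> (forall p, 0 <= f p) -> (0 < a)%R -> (0 <= b)%R ->
  \int[PQ]_w \int[PQ]_w' f (fun j => (a * vec w j + b * vec w' j)%R) =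
  \int[PQ]_w f (fun j => (Num.sqrt (a ^+ 2 + b ^+ 2) * vec w j)%R).
Proof.
move=> mf f0 a0 b0; pose r := Num.sqrt (a ^+ 2 + b ^+ 2).
have r0 : (0 < r)%R by rewrite sqrtr_gt0 ltr_wpDr ?sqr_ge0// exprn_gt0.
have rn0 : r != 0%R by rewrite gt_eqF.
have r2 : (r ^+ 2 = a ^+ 2 + b ^+ 2)%R.
  by rewrite sqr_sqrtr// addr_ge0 ?sqr_ge0.
pose h (q : env I R * env I R) := f (fun j => (r * q.1 j)%R).
have mh : measurable_fun setT h.
  apply: (measurableT_comp mf); apply: measurable_env => j.
  by apply: measurable_funM => //; apply: (measurableT_comp (measurable_coord j)).
have ar : (0 < a / r)%R by rewrite divr_gt0.
have abr : ((a / r) ^+ 2 + (b / r) ^+ 2 = 1)%R.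
  by rewrite !expr_div_n -mulrDl -r2 divff// expf_neq0.
have := gauss_vec_rotation h (a / r) (b / r) mh (fun=> f0 _) ar abr.
rewrite /h /= => e.
transitivity (\int[PQ]_w \int[PQ]_w' f (fun j : I => (r * vec w j)%R)); last first.
  by apply: eq_integral => w _; rewrite integral_probability_cst.
rewrite -e; apply: eq_integral => w _; apply: eq_integral => w' _.
congr f; apply/funext => j; field.
exact: rn0.
Qed.

Lemma gauss_vec_mgf (z : I -> R) :
  \int[PQ]_w (expR (\sum_i z i * vec w i))%:E =
  (expR ((\sum_i z i ^+ 2) / 2))%:E.
Proof.
have msum (l : seq I) : measurable_fun setT (fun c : env I R => \sum_(i <- l) z i * c i)%R.
  by apply: measurable_sum => i; meas.
have mf (l : seq I) (a : R) : measurable_fun setT (fun c : env I R => (expR (a + \sum_(i <- l) z i * c i))%:E).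
  apply/measurable_EFinP; apply: (measurableT_comp (@measurable_expR _)).
  by apply: measurable_funD.
have key l c a : uniq l ->
    itint (fun=> gauss) l (fun c' => (expR (a + \sum_(i <- l) z i * c' i))%:E) c =
    (expR (a + (\sum_(i <- l) z i ^+ 2) / 2))%:E.
  elim: l a c => [|i l IH] a c /=; first by rewrite !big_nil mul0r.
  move=> /andP[il ul].
  under eq_integral => t _.
    rewrite (eq_itint_on _ _ _ (fun c' => (expR ((a + z i * t) + \sum_(i <- l) z i * c' i))%:E)); last first.
      move=> c' /(_ i il); rewrite /update eqxx => <-.
      by rewrite big_cons addrA.
    rewrite IH//; over.
  under eq_integral => t _ do rewrite addrAC expRD.
  rewrite intZ; [|by meas|exact: expR_ge0|by move=> x; exact: expR_ge0].
  rewrite gauss_mgf -EFinM -expRD big_cons; congr ((expR _)%:E).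
  by field.
have h0 (c : env I R) : 0 <= (expR (\sum_i z i * c i))%:E by rewrite lee_fin expR_ge0.
rewrite (gauss_vecE (fun c => (expR (\sum_i z i * c i))%:E))//; last first.
  by have := mf (index_enum I) 0%R; under eq_fun do rewrite add0r.
have := key (enum I) c0 0%R (enum_uniq _).
rewrite add0r -big_enum /= => <-.
by congr itint; apply/funext => c; rewrite add0r big_enum.
Qed.

End GaussVector.

(** * Concentration of a supremum of Gaussian linear forms *)

Section Concentration.
Context {R : realType} {I : finType} {dQ : measure_display}
  {Q : measurableType dQ} {PQ : probability Q R} {G : I -> Q -> R}.
Hypothesis mG : forall i, measurable_fun setT (G i).
Local Notation gauss := (@gauss R).
Hypothesis iG : indep_law PQ G (fun=> gauss).
Local Notation vec := (@vec R I dQ Q G).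
Local Open Scope ereal_scope.

Definition lin (a b : R) (q : env I R * env I R) : env I R :=
  fun j => (a * q.1 j + b * q.2 j)%R.

Lemma measurable_lin a b : measurable_fun setT (lin a b).
Proof.
apply: measurable_env => j; apply: measurable_funD; apply: measurable_funM => //.
  by apply: (measurableT_comp (measurable_coord j)).
by apply: (measurableT_comp (measurable_coord j)).
Qed.

Lemma measurable_vec_int (f : env I R * env I R -> R) :
  measurable_fun setT f -> (forall q, (0 <= f q)%R) ->
  measurable_fun setT (fun w => \int[PQ]_w' (f (vec w, vec w'))%:E).
Proof.
move=> mf f0.
apply: (@measurable_fun_fubini_tonelli_F _ _ Q Q R PQ
  (fun p => (f (vec p.1, vec p.2))%:E)).
  apply/measurable_EFinP; apply: (measurableT_comp mf).
  apply: measurable_fun_pair; apply: (measurableT_comp (measurable_vec mG)).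
    exact: measurable_fst.
  exact: measurable_snd.
by move=> p; rewrite lee_fin.
Qed.

Lemma measurable_vec_snd (f : env I R * env I R -> R) w :
  measurable_fun setT f -> measurable_fun setT (fun w' => f (vec w, vec w')).
Proof.
move=> mf; apply: (measurableT_comp mf); apply: measurable_fun_pair => //.
exact: measurable_vec mG.
Qed.

Variable F : env I R -> R.
Hypothesis mF : measurable_fun setT F.
Hypothesis F_ge0 : forall v, (0 <= F v)%R.
Hypothesis F_supp : forall v, exists z : I -> R, [/\ (\sum_i z i ^+ 2 <= 4)%R,
  F v = (\sum_i z i * v i)%R & forall v', (\sum_i z i * v' i <= F v')%R].
Hypothesis F_exp : forall s : R, \int[PQ]_w (expR (s * F (vec w)))%:E < +oo.
Variable W : R.
Hypothesis F_mean : \int[PQ]_w (F (vec w))%:E = W%:E.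

Let phi (s : R) := \int[PQ]_w (expR (s * F (vec w)))%:E.

Let mFv : measurable_fun setT (fun w => F (vec w)).
Proof. exact: (measurableT_comp mF (measurable_vec mG)). Qed.

Let mexpF (s : R) : measurable_fun setT (fun w => expR (s * F (vec w))).
Proof. by apply: (measurableT_comp (@measurable_expR _)); apply: measurable_funM. Qed.

Let phi_fin (s : R) : phi s = (fine (phi s))%:E.
Proof.
rewrite fineK// ge0_fin_numE; first exact: F_exp.
by apply: int_ge0 => w; exact: expR_ge0.
Qed.

Let g (a s : R) (q : env I R * env I R) := expR (s * (F q.1 - F (lin a a q)))%R.

Let mg a s : measurable_fun setT (g a s).
Proof.
apply: (measurableT_comp (@measurable_expR _)); apply: measurable_funM => //.
apply: measurable_funB; first by apply: (measurableT_comp mF).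
by apply: (measurableT_comp mF); exact: measurable_lin.
Qed.

(** For fixed X, the supporting form z of [F] at X gives F(a X + a Y) >= a F(X) + a <z,Y>. The
    exponent is then at most s (1 - a) F(X) - s a <z,Y>, and integrating over Y costs exp(s^2 a^2
    |z|^2 / 2), which is at most exp(s^2) since a^2 = 1/2 and |z|^2 <= 4. *)
Lemma gauss_partial_resample (a s : R) : (0 <= s)%R -> (a ^+ 2 = 2^-1)%R ->
  \int[PQ]_w \int[PQ]_w' (g a s (vec w, vec w'))%:E <=
  (expR (s ^+ 2))%:E * phi (s * (1 - a)).
Proof.
move=> s0 a2; rewrite -intZ; [|exact: mexpF|exact: expR_ge0|by move=> w; exact: expR_ge0].
apply: ge0_le_integral; first exact: measurableT.
- by move=> w _; apply: int_ge0 => w'; exact: expR_ge0.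
- by apply: measurable_vec_int => // q; exact: expR_ge0.
- by apply/measurable_EFinP; apply: measurable_funM => //; exact: mexpF.
move=> w _; have [z [z4 Fz zF]] := F_supp (vec w).
pose y i := (- (s * a) * z i)%R.
have mz : measurable_fun setT (fun w' => expR (\sum_i y i * vec w' i)).
  apply: (measurableT_comp (@measurable_expR _)); apply: measurable_sum => i.
  by apply: measurable_funM => //; exact: mG.
apply: (@le_trans _ _ (\int[PQ]_w' (expR (s * (1 - a) * F (vec w)) * expR (\sum_i y i * vec w' i))%:E)).
  apply: le_int => [||w'|w'].
  - exact: measurable_vec_snd.
  - by apply: measurable_funM.
  - exact: expR_ge0.
  rewrite -expRD ler_expR /=.
  have := zF (lin a a (vec w, vec w')).
  have -> : (\sum_i z i * lin a a (vec w, vec w') i =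
      a * F (vec w) + a * \sum_i z i * vec w' i)%R.
    rewrite Fz !mulr_sumr -big_split; apply: eq_bigr => i _ /=.
    by rewrite /lin /=; ring.
  have -> : (\sum_i y i * vec w' i = - (s * a) * \sum_i z i * vec w' i)%R.
    by rewrite mulr_sumr; apply: eq_bigr => i _; rewrite /y mulrA.
  set S := (\sum_i z i * vec w' i)%R => h.
  have -> : (s * (1 - a) * F (vec w) + - (s * a) * S =
     s * (F (vec w) - (a * F (vec w) + a * S)))%R by ring.
  by apply: ler_wpM2l => //; rewrite lerD2l lerN2.
rewrite intZ; [|exact: mz|exact: expR_ge0|by move=> x; exact: expR_ge0].
rewrite (gauss_vec_mgf mG iG) -EFinM lee_fin mulrC ler_wpM2r ?expR_ge0// ler_expR.
have -> : (\sum_i y i ^+ 2 = s ^+ 2 / 2 * \sum_i z i ^+ 2)%R.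
  rewrite mulr_sumr; apply: eq_bigr => i _.
  by rewrite /y exprMn sqrrN exprMn a2.
have := sqr_ge0 s; nra.
Qed.

(** The rotation sends (X, Y) to (a X + a Y, a Y - a X), and applying [lin a a] to this new pair
    gives 2 a^2 Y = Y. The integral is thus the one of [gauss_partial_resample] in rotated
    coordinates. *)
Lemma gauss_partial_resample_swap (a s : R) : (0 <= s)%R -> (0 < a)%R ->
  (a ^+ 2 = 2^-1)%R ->
  \int[PQ]_w \int[PQ]_w' (expR (s * (F (lin a a (vec w, vec w')) - F (vec w'))))%:E <=
  (expR (s ^+ 2))%:E * phi (s * (1 - a)).
Proof.
move=> s0 a0 a2; apply: le_trans (gauss_partial_resample a s s0 a2).
have aa : (a ^+ 2 + a ^+ 2 = 1)%R by rewrite a2; field.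
have mgE : measurable_fun setT (fun q => (g a s q)%:E) by exact/measurable_EFinP.
have g0 q : 0 <= (g a s q)%:E by rewrite lee_fin expR_ge0.
rewrite -(gauss_vec_rotation mG iG (fun q => (g a s q)%:E) a a mgE g0 a0 aa).
rewrite le_eqVlt; apply/orP; left; apply/eqP.
apply: eq_integral => w _; apply: eq_integral => w' _; rewrite /g /=.
congr ((expR (s * (F _ - F _)))%:E).
apply/funext => j; rewrite /lin /=.
have -> : (a * (a * vec w j + a * vec w' j) + a * (a * vec w' j - a * vec w j) =
  (a ^+ 2 + a ^+ 2) * vec w' j)%R by ring.
by rewrite aa mul1r.
Qed.

(** Jensen's inequality by the tangent of exp(-s u) at u = W. The linear term is kept on the larger
    side, so that only nonnegative functions are integrated. *)
Lemma exp_neg_mean (s : R) : (0 <= s)%R ->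
  (expR (- (s * W)))%:E <= \int[PQ]_w (expR (- s * F (vec w)))%:E.
Proof.
move=> s0; set e := expR (- (s * W)).
have e0 : (0 <= e)%R by exact: expR_ge0.
have : (e * (1 + s * W))%:E <= \int[PQ]_w (expR (- s * F (vec w)) + e * s * F (vec w))%:E.
  rewrite -(int_cst PQ); apply: le_int => [||w|w] //.
  - by apply: measurable_funD; [exact: mexpF|apply: measurable_funM].
  - rewrite mulr_ge0// addr_ge0// mulr_ge0// -lee_fin -F_mean.
    by apply: int_ge0.
  have := expR_ge1Dx (- s * (F (vec w) - W)).
  move=> /(ler_wpM2l e0); rewrite {2}/e -expRD.
  have -> : (- (s * W) + - s * (F (vec w) - W) = - s * F (vec w) - (s * W) * 0)%R.
    by ring.
  by rewrite mulr0 subr0; lra.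
rewrite intD; [|exact: mexpF|by apply: measurable_funM|by move=> w; exact: expR_ge0|by move=> w; rewrite !mulr_ge0].
rewrite intZ; [|exact: mFv|by rewrite mulr_ge0|by []].
rewrite F_mean -EFinM -leeBlDr// -EFinB.
by apply: le_trans; rewrite lee_fin; lra.
Qed.

(* Y - X is split through the rotated midpoint (X + Y) / sqrt 2, which makes
   the exponential moment at s controlled by the one at (2 - sqrt 2) s < s. *)
Theorem gauss_concentration (s : R) : (0 <= s)%R ->
  \int[PQ]_w (expR (s * F (vec w)))%:E <=
  (expR (5 / 2 * (s * W + 4 * s ^+ 2)))%:E.
Proof.
move=> s0; have W0 : (0 <= W)%R by rewrite -lee_fin -F_mean; exact: int_ge0.
pose a : R := Num.sqrt 2^-1.
have a2 : (a ^+ 2 = 2^-1)%R by rewrite sqr_sqrtr.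
have a0 : (0 < a)%R by rewrite sqrtr_gt0 invr_gt0.
pose c := (2 * (1 - a))%R.
have a_lt1 : (a <= 1)%R by nra.
have a_ge : (7 / 10 <= a)%R by nra.
have s20 : (0 <= 2 * s)%R by rewrite mulr_ge0.
pose h1 (q : env I R * env I R) := expR (2 * s * (F (lin a a q) - F q.2))%R.
have mh1 : measurable_fun setT h1.
  apply: (measurableT_comp (@measurable_expR _)); apply: measurable_funM => //.
  apply: measurable_funB; last by apply: (measurableT_comp mF).
  by apply: (measurableT_comp mF); exact: measurable_lin.
pose h (q : env I R * env I R) := expR (s * (F q.1 - F q.2))%R.
have mh : measurable_fun setT h.
  apply: (measurableT_comp (@measurable_expR _)); apply: measurable_funM => //.
  by apply: measurable_funB; apply: (measurableT_comp mF).
(* The inequality xy <= (x^2 + y^2) / 2 separates the step from X to the midpoint and the step from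
   the midpoint to Y; squaring doubles s, hence c s = 2 s (1 - a). *)
have up : \int[PQ]_w \int[PQ]_w' (h (vec w, vec w'))%:E <=
    (expR (4 * s ^+ 2))%:E * phi (c * s).
  pose A1 w := \int[PQ]_w' (g a (2 * s) (vec w, vec w'))%:E.
  pose A2 w := \int[PQ]_w' (h1 (vec w, vec w'))%:E.
  have mA1 : measurable_fun setT A1 by apply: measurable_vec_int => // q; exact: expR_ge0.
  have mA2 : measurable_fun setT A2 by apply: measurable_vec_int => // q; exact: expR_ge0.
  have A10 w : 0 <= A1 w by apply: int_ge0 => w'; exact: expR_ge0.
  have A20 w : 0 <= A2 w by apply: int_ge0 => w'; exact: expR_ge0.
  apply: (@le_trans _ _ (\int[PQ]_w ((2^-1)%:E * (A1 w + A2 w)))).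
    apply: ge0_le_integral; first exact: measurableT.
    - by move=> w _; apply: int_ge0 => w'; exact: expR_ge0.
    - by apply: measurable_vec_int => // q; exact: expR_ge0.
    - exact: (measurable_funeM (2^-1)%:E (emeasurable_funD mA1 mA2)).
    move=> w _; rewrite /A1 /A2 -intD; [|exact: measurable_vec_snd|exact: measurable_vec_snd|by move=> w'; exact: expR_ge0|by move=> w'; exact: expR_ge0].
    rewrite -intZ; [|by apply: measurable_funD; apply: measurable_vec_snd|by rewrite invr_ge0|by move=> w'; rewrite addr_ge0// expR_ge0].
    apply: le_int => [||w'|w'].
    - exact: measurable_vec_snd.
    - by apply: measurable_funM => //; apply: measurable_funD; apply: measurable_vec_snd.
    - exact: expR_ge0.
    rewrite /h /g /h1 /=; set x := F (vec w); set y := F (lin a a _); set z := F (vec w').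
    have -> : (s * (x - z) = s * (x - y) + s * (y - z))%R by ring.
    rewrite expRD.
    have -> : (2 * s * (x - y) = s * (x - y) + s * (x - y))%R by ring.
    have -> : (2 * s * (y - z) = s * (y - z) + s * (y - z))%R by ring.
    rewrite !expRD; have := sqr_ge0 (expR (s * (x - y)) - expR (s * (y - z))); lra.
  have h20 : 0 <= (2^-1)%:E :> \bar R by rewrite lee_fin invr_ge0.
  have mA12 : measurable_fun setT (fun w => A1 w + A2 w) by exact: emeasurable_funD.
  rewrite (ge0_integralZl PQ measurableT mA12 (fun w _ => adde_ge0 (A10 w) (A20 w)) h20).
  rewrite (ge0_integralD PQ measurableT (fun w _ => A10 w) mA1 (fun w _ => A20 w) mA2).
  have b1 := gauss_partial_resample a (2 * s) s20 a2.
  have b2 := gauss_partial_resample_swap a (2 * s) s20 a0 a2.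
  apply: (@le_trans _ _ ((2^-1)%:E * ((expR ((2 * s) ^+ 2))%:E * phi (2 * s * (1 - a)) +
     (expR ((2 * s) ^+ 2))%:E * phi (2 * s * (1 - a))))).
    by apply: lee_wpmul2l => //; exact: leeD b1 b2.
  have -> : (2 * s * (1 - a) = c * s)%R by rewrite /c; ring.
  rewrite (phi_fin (c * s)). set p := fine _.
  set e2 := expR _; set e4 := expR _.
  have -> : (2^-1)%:E * (e2%:E * p%:E + e2%:E * p%:E) = (2^-1 * (e2 * p + e2 * p))%:E by [].
  rewrite -EFinM lee_fin /e2 /e4.
  have -> : ((2 * s) ^+ 2 = 4 * s ^+ 2)%R by ring.
  by rewrite le_eqVlt; apply/orP; left; apply/eqP; field.
(* The integrand is a product; Jensen in the second copy bounds its factor from below by exp(-s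
   W). *)
have low : (expR (- (s * W)))%:E * phi s <= \int[PQ]_w \int[PQ]_w' (h (vec w, vec w'))%:E.
  rewrite -intZ; [|exact: mexpF|exact: expR_ge0|by move=> w; exact: expR_ge0].
  apply: ge0_le_integral; first exact: measurableT.
  - by move=> w _; rewrite lee_fin mulr_ge0 ?expR_ge0.
  - by apply/measurable_EFinP; apply: measurable_funM => //; exact: mexpF.
  - by apply: measurable_vec_int => // q; exact: expR_ge0.
  move=> w _.
  have -> : \int[PQ]_w' (h (vec w, vec w'))%:E =
      (expR (s * F (vec w)))%:E * \int[PQ]_w' (expR (- s * F (vec w')))%:E.
    rewrite -intZ; [|exact: mexpF|exact: expR_ge0|by move=> w'; exact: expR_ge0].
    by apply: eq_integral => w' _; rewrite /h /= -expRD; congr ((expR _)%:E); ring.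
  rewrite mulrC EFinM; apply: lee_wpmul2l; first by rewrite lee_fin expR_ge0.
  exact: exp_neg_mean.
have := le_trans low up; rewrite (phi_fin s) (phi_fin (c * s)) -!EFinM lee_fin => hh.
have p1 : (1 <= fine (phi s))%R.
  rewrite -lee_fin -phi_fin -(int_cst PQ 1); apply: le_int => // w.
  by rewrite -expR0 ler_expR mulr_ge0.
have p0 : (0 < fine (phi s))%R by exact: lt_le_trans ltr01 p1.
pose t := ln (fine (phi s)).
have et : expR t = fine (phi s) by rewrite lnK// posrE.
(* This is phi(c s) <= phi(s)^c for 0 <= c <= 1, with t = ln phi(s): weighted AM-GM applied to the
   exponent recentred at t. *)
have tang : (fine (phi (c * s)) <= expR (c * t))%R.
  have c0 : (0 <= c)%R by rewrite /c; lra.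
  have c1 : (0 <= 1 - c)%R by rewrite /c; lra.
  rewrite -lee_fin -phi_fin.
  apply: (@le_trans _ _ (\int[PQ]_w (expR (c * t) * (1 - c) + expR (c * t) * c * expR (- t) * expR (s * F (vec w)))%:E)).
    apply: le_int => [||w|w].
    - exact: mexpF.
    - by apply: measurable_funD => //; apply: measurable_funM => //; exact: mexpF.
    - exact: expR_ge0.
    set u := (s * F (vec w))%R.
    (* weighted AM-GM: e^(c x) <= c e^x + 1 - c *)
    have wamgm (x : R) : (expR (c * x) <= c * expR x + (1 - c))%R.
      have h2 := expR_ge1Dx ((1 - c) * x); have h3 := expR_ge1Dx (- c * x).
      have e2 : expR x = (expR (c * x) * expR ((1 - c) * x))%R.
        by rewrite -expRD; congr expR; ring.
      have e3 : (expR (c * x) * expR (- c * x) = 1)%R.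
        by rewrite -expRD mulNr subrr expR0.
      have e0 := expR_ge0 (c * x).
      rewrite e2.
      have m1 : (expR (c * x) * (1 + (1 - c) * x) <= expR (c * x) * expR ((1 - c) * x))%R by exact: ler_wpM2l.
      have m2 : (expR (c * x) * (1 + - c * x) <= 1)%R by rewrite -[leRHS]e3; exact: ler_wpM2l.
      have := ler_wpM2l c0 m1; have := ler_wpM2l c1 m2.
      set A := expR (c * x); set B := expR _; lra.
    have := wamgm (u - t)%R.
    have -> : (c * s * F (vec w) = c * t + c * (u - t))%R by rewrite /u; ring.
    rewrite [expR (c * t + _)]expRD [expR (u - t)]expRD => h5.
    by have := ler_wpM2l (expR_ge0 (c * t)) h5; lra.
  have cc : (0 <= expR (c * t) * c * expR (- t))%R by apply: mulr_ge0; [apply: mulr_ge0; [exact: expR_ge0|exact: c0]|exact: expR_ge0].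
  rewrite intD; [|by []|by apply: measurable_funM => //; exact: mexpF|by move=> _; apply: mulr_ge0; [exact: expR_ge0|exact: c1]|by move=> w; apply: mulr_ge0; [exact: cc|exact: expR_ge0]].
  rewrite int_cst intZ; [|exact: mexpF|by []|by move=> w; exact: expR_ge0].
  rewrite -/(phi s) (phi_fin s) -EFinM -EFinD lee_fin -et.
  have -> : (expR (c * t) * c * expR (- t) * expR t = expR (c * t) * c)%R.
    by rewrite -mulrA -expRD addNr expR0 mulr1.
  by lra.
rewrite -/(phi s) (phi_fin s) lee_fin -et ler_expR.
have : (expR (- (s * W) + t) <= expR (4 * s ^+ 2 + c * t))%R.
  rewrite !expRD et; apply: le_trans hh _.
  by apply: ler_wpM2l; rewrite ?expR_ge0.
rewrite ler_expR => ht.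
have sW : (0 <= s * W + 4 * s ^+ 2)%R by rewrite addr_ge0 ?mulr_ge0// ?sqr_ge0.
have t0 : (0 <= t)%R by rewrite ln_ge0.
(* The self-bounding inequality (1 - c) t <= s W + 4 s^2 is solved with 1 - c = 2 a - 1 >= 2/5,
   which holds as a >= 7/10; hence the factor 5/2. *)
have : (2 / 5 * t <= (1 - c) * t)%R by apply: ler_wpM2r => //; rewrite /c; lra.
by lra.
Qed.

End Concentration.

(** * Gaussian domination of signed rows *)

Section GaussScaled.
Context {R : realType}.
Local Notation gauss := (@gauss R).
Local Open Scope ereal_scope.

Definition scale (a : R) : R -> R := fun t => (a * t)%R.

Lemma measurable_scale a : measurable_fun setT (scale a).
Proof. by apply: measurable_funM. Qed.

HB.instance Definition _ a := isMeasurableFun.Build _ _ _ _ (scale a) (measurable_scale a).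

Definition gauss_scaled (a : R) : probability R R := distribution gauss (scale a).

Lemma integral_gauss_scaled a (f : R -> \bar R) :
  measurable_fun setT f -> (forall x, 0 <= f x) ->
  \int[gauss_scaled a]_x f x = \int[gauss]_x f (a * x)%R.
Proof. by move=> mf f0; rewrite ge0_integral_distribution. Qed.

Lemma indep_gauss_scaled {I : finType} {dQ : measure_display}
  {Q : measurableType dQ} {PQ : probability Q R} {G : I -> Q -> R} a :
  indep_law PQ G (fun=> gauss) ->
  indep_law PQ (fun j w => (a * G j w)%R) (fun=> gauss_scaled a).
Proof.
move=> iG B mB; rewrite (iG (fun i => scale a @^-1` B i)) // => i.
by rewrite -[X in measurable X]setTI; exact: measurable_scale.
Qed.

End GaussScaled.

Section Rows.
Context {R : realType} {I : finType} {dQ : measure_display}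
  {Q : measurableType dQ} {PQ : probability Q R} {G : I -> Q -> R}.
Hypothesis mG : forall i, measurable_fun setT (G i).
Local Notation gauss := (@gauss R).
Hypothesis iG : indep_law PQ G (fun=> gauss).
Local Notation vec := (@vec R I dQ Q G).
Variable F : env I R -> R.
Hypothesis mF : measurable_fun setT F.
Hypothesis F_supp : forall v, exists z : I -> R,
  F v = \sum_i z i * v i /\ forall v', \sum_i z i * v' i <= F v'.
Local Open Scope ereal_scope.

Lemma supp_cvx (x y : env I R) (t : R) : (0 <= t)%R -> (t <= 1)%R ->
  (F (fun j => t * x j + (1 - t) * y j) <= t * F x + (1 - t) * F y)%R.
Proof.
move=> t0 t1; have [z [-> zF]] := F_supp (fun j => t * x j + (1 - t) * y j)%R.
have -> : (\sum_i z i * (t * x i + (1 - t) * y i) =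
    t * (\sum_i z i * x i) + (1 - t) * \sum_i z i * y i)%R.
  by rewrite !mulr_sumr -big_split; apply: eq_bigr => i _ /=; ring.
by apply: lerD; apply: ler_wpM2l; rewrite ?subr_ge0.
Qed.

Lemma expR_cvx (a b t : R) : (0 <= t)%R -> (t <= 1)%R ->
  (expR (t * a + (1 - t) * b) <= t * expR a + (1 - t) * expR b)%R.
Proof.
move=> t0 t1; set c := (t * a + (1 - t) * b)%R.
have u0 : (0 <= 1 - t)%R by rewrite subr_ge0.
have h x : (expR c * (1 + (x - c)) <= expR x)%R.
  have -> : expR x = (expR c * expR (x - c))%R by rewrite -expRD addrC subrK.
  by rewrite ler_wpM2l ?expR_ge0// expR_ge1Dx.
have := h a; have := h b; set e := expR c; clearbody e; rewrite /c => hb ha.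
have := ler_wpM2l t0 ha; have := ler_wpM2l u0 hb; lra.
Qed.

Lemma exp_supp_cvx (x y : env I R) (t : R) : (0 <= t)%R -> (t <= 1)%R ->
  (expR (F (fun j => t * x j + (1 - t) * y j)) <=
   t * expR (F x) + (1 - t) * expR (F y))%R.
Proof.
move=> t0 t1; apply: le_trans (expR_cvx _ _ _ t0 t1).
by rewrite ler_expR supp_cvx.
Qed.

Definition aff (c : env I R) (r : R) (u : env I R) : env I R := fun j => (c j + r * u j)%R.

Lemma measurable_aff c r : measurable_fun setT (aff c r).
Proof.
apply: measurable_env => j; apply: measurable_funD => //.
by apply: measurable_funM => //; exact: measurable_coord.
Qed.

Lemma measurable_exp_aff c r : measurable_fun setT (fun u => expR (F (aff c r u))).
Proof.
apply: (measurableT_comp (@measurable_expR _)); apply: (measurableT_comp mF).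
exact: measurable_aff.
Qed.

Context {d : measure_display} {T : measurableType d} {P : probability T R}.
Variables (mu : probability R R) (Lam : R).
Hypothesis mu_dom : forall f : R -> R, measurable_fun setT f ->
  (forall x, (0 <= f x)%R) -> cvx1 f ->
  \int[mu]_x (f x)%:E <= \int[gauss]_x (f (Lam * x)%R)%:E.

Lemma indep_row_dominated (A : I -> T -> R) (c : env I R) (r : R) :
  (forall i, measurable_fun setT (A i)) -> indep_law P A (fun=> mu) ->
  \int[P]_w (expR (F (aff c r (fun j => A j w))))%:E <=
  \int[PQ]_w (expR (F (aff c (r * Lam) (vec w))))%:E.
Proof.
move=> mA iA; pose H u := expR (F (aff c r u)).
have mH : measurable_fun setT H := measurable_exp_aff c r.
have mHE : measurable_fun setT (fun u => (H u)%:E) by exact/measurable_EFinP.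
have H0 u : 0 <= (H u)%:E by rewrite lee_fin expR_ge0.
have lI (i : I) : i \in enum I by rewrite mem_enum.
rewrite (indep_integral mA iA (enum I) (fun u => (H u)%:E) (fun=> 0%R) lI mHE H0).
have -> : \int[PQ]_w (expR (F (aff c (r * Lam) (vec w))))%:E =
    itint (fun=> gauss_scaled Lam) (enum I) (fun u => (H u)%:E) (fun=> 0%R).
  have mLG i : measurable_fun setT (fun w => Lam * G i w)%R.
    by apply: measurable_funM => //; exact: mG.
  rewrite -(indep_integral mLG (indep_gauss_scaled Lam iG) (enum I) (fun u => (H u)%:E) (fun=> 0%R) lI mHE H0).
  apply: eq_integral => w _; congr ((expR (F _))%:E).
  by apply/funext => j; rewrite /aff mulrA.
apply: itint_dominated => //; last exact: enum_uniq.
- move=> f mf f0 cf; rewrite (integral_gauss_scaled Lam (fun x => (f x)%:E)).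
  + exact: mu_dom.
  + exact/measurable_EFinP.
  + by move=> x; rewrite lee_fin.
move=> u i x y t t0 t1; rewrite /H.
apply: le_trans (exp_supp_cvx _ _ _ t0 t1); rewrite ler_expR.
rewrite le_eqVlt; apply/orP; left; apply/eqP; congr F; apply/funext => j.
by rewrite /aff /update; case: (j == i); ring.
Qed.

(** By symmetry of the Gaussian vector the sign of [r] disappears after domination, so both signs of
    a row obey one bound. *)
Lemma indep_row_dominatedN (A : I -> T -> R) (c : env I R) (r : R) :
  (forall i, measurable_fun setT (A i)) -> indep_law P A (fun=> mu) ->
  \int[P]_w (expR (F (aff c (- r) (fun j => A j w))))%:E <=
  \int[PQ]_w (expR (F (aff c (r * Lam) (vec w))))%:E.
Proof.
move=> mA iA; apply: le_trans (indep_row_dominated A c (- r)%R mA iA) _.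
rewrite le_eqVlt; apply/orP; left; apply/eqP.
pose H u := expR (F (aff c (r * Lam) u)).
have mHE : measurable_fun setT (fun u => (H u)%:E).
  by apply/measurable_EFinP; exact: measurable_exp_aff.
have H0 u : 0 <= (H u)%:E by rewrite lee_fin expR_ge0.
rewrite (gauss_vecE mG iG _ mHE H0).
have mN : measurable_fun setT (fun u : env I R => (fun j => - u j)%R : env I R).
  by apply: measurable_env => j; apply: (measurableT_comp (@oppr_measurable R setT)); exact: measurable_coord.
have mHN : measurable_fun setT (fun u : env I R => (H (fun j => - u j)%R)%:E).
  exact: (measurableT_comp mHE mN).
transitivity (\int[PQ]_w (H (fun j => - vec w j)%R)%:E).
  apply: eq_integral => w _; congr ((expR (F _))%:E).
  by apply/funext => j; rewrite /aff; ring.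
rewrite (gauss_vecE mG iG _ mHN (fun u => H0 _)).
rewrite (itint_map gauss (fun x => - x)%R (enum I) (fun u => (H u)%:E))//.
  by congr itint; apply/funext => j; rewrite oppr0.
by move=> g mg g0; exact: gauss_sym.
Qed.

Section SignedRow.
Variables (A : I -> T -> R) (Y : T -> R) (v : I -> R).
Hypothesis mA : forall i, measurable_fun setT (A i).
Hypothesis mY : measurable_fun setT Y.
Hypothesis iA : indep_law P A (fun=> mu).
Hypothesis Y1 : forall w, Y w = 1%R \/ Y w = (-1)%R.
Let U (w : T) : env I R := fun j => (Y w * A j w)%R.
Hypothesis intU : forall j, P.-integrable setT (fun w => (U w j)%:E).
Hypothesis meanU : forall j, \int[P]_w (U w j)%:E = (v j)%:E.

Lemma measurable_signed_row : measurable_fun setT U.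
Proof. by apply: measurable_env => j; apply: measurable_funM. Qed.

(** The supporting form z of [F] at [aff c r v] and the tangent of exp give a lower bound that is
    affine in [U], whose mean is [v]. When the right side is infinite there is nothing to prove;
    otherwise the exponential is integrable. *)
Lemma jensen_signed_row (c : env I R) (r : R) :
  (expR (F (aff c r v)))%:E <= \int[P]_w (expR (F (aff c r (U w))))%:E.
Proof.
set J := \int[P]_w _.
have J0 : 0 <= J by apply: int_ge0 => w; exact: expR_ge0.
have [->|Joo] := eqVneq J +oo; first exact: leey.
have [z [Fz zF]] := F_supp (aff c r v).
set e := expR (F (aff c r v)).
have mE : measurable_fun setT (fun w => expR (F (aff c r (U w)))).
  by apply: (measurableT_comp (measurable_exp_aff c r)); exact: measurable_signed_row.
have iE : P.-integrable setT (fun w => (expR (F (aff c r (U w))))%:E).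
  apply/integrableP; split; first exact/measurable_EFinP.
  under eq_integral do rewrite /= ger0_norm ?expR_ge0//.
  by rewrite ltey.
pose L w := (\sum_i ((e * r * z i)%:E * (U w i)%:E + (- (e * r * z i * v i))%:E)).
have iL i : P.-integrable setT (fun w => (e * r * z i)%:E * (U w i)%:E + (- (e * r * z i * v i))%:E).
  apply: integrableD => //; first exact: integrableZl.
  by apply: finite_measure_integrable_cst.
have LE w : L w = (e * r * (\sum_i z i * U w i - \sum_i z i * v i))%:E.
  rewrite /L -sumrB mulr_sumr -sumEFin; apply: eq_bigr => i _.
  by rewrite -EFinM -EFinD; congr (_%:E); ring.
have intL : \int[P]_w L w = 0.
  rewrite /L integral_sum//= big1// => i _.
  rewrite integralD//=; last 2 first.
  - exact: integrableZl.
  - by apply: finite_measure_integrable_cst.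
  by rewrite integralZl// meanU int_cst -EFinM -EFinD subrr.
have iLL : P.-integrable setT L by apply: integrable_sum.
have -> : e%:E = \int[P]_w (e%:E + L w).
  rewrite integralD//=; last exact: finite_measure_integrable_cst.
  by rewrite intL int_cst adde0.
apply: le_integral => //.
  by apply: integrableD => //; exact: finite_measure_integrable_cst.
move=> w _; rewrite LE -EFinD lee_fin.
have h := zF (aff c r (U w)).
apply: le_trans (_ : _ <= expR (\sum_i z i * aff c r (U w) i))%R _; last by rewrite ler_expR.
have -> : (\sum_i z i * aff c r (U w) i =
   F (aff c r v) + r * (\sum_i z i * U w i - \sum_i z i * v i))%R.
  rewrite Fz -sumrB mulr_sumr -big_split; apply: eq_bigr => i _ /=.
  by rewrite /aff; ring.
rewrite expRD -/e -mulrA -[X in (X + _)%R]mulr1 -mulrDr.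
by rewrite ler_wpM2l ?expR_ge0// expR_ge1Dx.
Qed.

(* Jensen replaces the mean v by the random row with the opposite sign; since
   the sign Y is 1 or -1, averaging the two signs removes it. *)
Lemma signed_row_dominated (c : env I R) (r : R) :
  \int[P]_w (expR (F (aff c r (fun j => U w j - v j)%R)))%:E <=
  \int[PQ]_w (expR (F (aff c (2 * r * Lam) (vec w))))%:E.
Proof.
have hf0 : (0 <= 2^-1 :> R)%R by rewrite invr_ge0.
have mUe r' : measurable_fun setT (fun w => expR (F (aff c r' (U w)))).
  by apply: (measurableT_comp (measurable_exp_aff c r')); exact: measurable_signed_row.
have mAe r' : measurable_fun setT (fun w => expR (F (aff c r' (fun j => A j w)))).
  by apply: (measurableT_comp (measurable_exp_aff c r')); exact: measurable_env.
have e0 x : (0 <= expR x :> R)%R by exact: expR_ge0.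
apply: (@le_trans _ _ (\int[P]_w (2^-1 * expR (F (aff c (2 * r) (U w))) +
     2^-1 * expR (F (aff c (- (2 * r)) v)))%:E)).
  apply: le_int => [||w|w].
  - apply: (measurableT_comp (measurable_exp_aff c r)); apply: measurable_env => j.
    by apply: measurable_funB => //; apply: measurable_funM.
  - by apply: measurable_funD => //; apply: measurable_funM.
  - exact: expR_ge0.
  have h1 : (2^-1 <= 1 :> R)%R by rewrite invf_le1// ler1n.
  have := exp_supp_cvx (aff c (2 * r) (U w)) (aff c (- (2 * r)) v) 2^-1 hf0 h1.
  have -> : (1 - 2^-1 = 2^-1 :> R)%R by field.
  apply: le_trans; rewrite ler_expR le_eqVlt; apply/orP; left; apply/eqP.
  by congr F; apply/funext => j; rewrite /aff; field.
rewrite intD; [|by apply: measurable_funM|by []|by move=> w; rewrite mulr_ge0|by move=> w; rewrite mulr_ge0].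
rewrite int_cst intZ; [|by []|by []|by []].
rewrite EFinM.
have hE : 0 <= (2^-1)%:E :> \bar R by rewrite lee_fin.
apply: (@le_trans _ _ ((2^-1)%:E * \int[P]_w (expR (F (aff c (2 * r) (U w))))%:E +
    (2^-1)%:E * \int[P]_w (expR (F (aff c (- (2 * r)) (U w))))%:E)).
  by apply: leeD => //; apply: lee_wpmul2l => //; exact: jensen_signed_row.
rewrite -muleDr//; last by rewrite ge0_adde_def// inE; apply: int_ge0.
rewrite -intD; [|by []|by []|by []|by []].
have -> : \int[P]_w (expR (F (aff c (2 * r) (U w))) + expR (F (aff c (- (2 * r)) (U w))))%:E =
   \int[P]_w (expR (F (aff c (2 * r) (fun j => A j w))) + expR (F (aff c (- (2 * r)) (fun j => A j w))))%:E.
  apply: eq_integral => w _; congr (_%:E).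
  have [Yw|Yw] := Y1 w.
    by congr (expR (F _) + expR (F _))%R; apply/funext => j; rewrite /aff /U Yw mul1r.
  by rewrite addrC; congr (expR (F _) + expR (F _))%R; apply/funext => j; rewrite /aff /U Yw; ring.
rewrite intD; [|by []|by []|by []|by []].
set q := \int[PQ]_w _.
apply: (@le_trans _ _ ((2^-1)%:E * (q + q))).
  apply: lee_wpmul2l => //; apply: leeD.
    exact: indep_row_dominated.
  exact: indep_row_dominatedN.
have q0 : 0 <= q by apply: int_ge0.
by rewrite ge0_muleDr// -ge0_muleDl// -EFinD (_ : 2^-1 + 2^-1 = 1)%R ?mul1e//; field.
Qed.

End SignedRow.

End Rows.

(** * Gaussian domination of the sum over the rows *)

Section RowSums.
Context {R : realType} {I : finType} {dQ : measure_display}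
  {Q : measurableType dQ} {PQ : probability Q R} {G : I -> Q -> R}.
Hypothesis mG : forall i, measurable_fun setT (G i).
Local Notation gauss := (@gauss R).
Hypothesis iG : indep_law PQ G (fun=> gauss).
Local Notation vec := (@vec R I dQ Q G).
Variable F : env I R -> R.
Hypothesis mF : measurable_fun setT F.
Context {J : eqType} (nu : J -> probability (env I R) R) (v : I -> R) (Lam r : R).
Hypothesis Lr0 : 0 < 2 * r * Lam.
Local Open Scope ereal_scope.
Hypothesis nu_dom : forall i (c : env I R),
  \int[nu i]_u (expR (F (aff c r (fun j => u j - v j)%R)))%:E <=
  \int[PQ]_w (expR (F (aff c (2 * r * Lam) (vec w))))%:E.

Lemma rows_dominated (l : seq J) (c : env I R) u0 : uniq l ->
  itint nu l (fun u : env J (env I R) =>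
    (expR (F (fun j => c j + \sum_(i <- l) r * (u i j - v j))%R))%:E) u0 <=
  \int[PQ]_w (expR (F (aff c (2 * r * Lam * Num.sqrt (size l)%:R) (vec w))))%:E.
Proof.
elim: l c u0 => [|i l IH] c u0 /=.
  move=> _; rewrite sqrtr0 mulr0 -(int_cst PQ) le_eqVlt; apply/orP; left; apply/eqP.
  apply: eq_integral => w _; congr ((expR (F _))%:E).
  by apply/funext => j; rewrite /aff big_nil mul0r.
move=> /andP[il ul].
pose s := (2 * r * Lam * Num.sqrt (size l)%:R)%R.
have s0 : (0 <= s)%R by rewrite mulr_ge0// ltW.
pose shift (u : env I R) : env I R := aff c r (fun j => u j - v j)%R.
have mshift : measurable_fun setT shift.
  apply: (measurableT_comp (measurable_aff c r)); apply: measurable_env => j.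
  by apply: measurable_funB => //; exact: measurable_coord.
have mexpF : measurable_fun setT (fun y => expR (F y)).
  exact: (measurableT_comp (@measurable_expR _)).
pose k (p : env I R * Q) := (expR (F (aff (shift p.1) s (vec p.2))))%:E.
have mk : measurable_fun setT k.
  apply/measurable_EFinP; apply: (measurableT_comp mexpF).
  apply: measurable_env => j; apply: measurable_funD.
    exact: (measurableT_comp (measurable_coord j) (measurableT_comp mshift measurable_fst)).
  by apply: measurable_funM => //; exact: (measurableT_comp (mG j) measurable_snd).
have k0 p : 0 <= k p by rewrite lee_fin expR_ge0.
have mul c' : measurable_fun setT (fun u : env J (env I R) =>
   (expR (F (fun j => c' j + \sum_(i <- l) r * (u i j - v j))%R))%:E).
  apply/measurable_EFinP; apply: (measurableT_comp mexpF); apply: measurable_env => j.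
  apply: measurable_funD => //; apply: measurable_sum => i'.
  apply: measurable_funM => //; apply: measurable_funB => //.
  exact: (measurableT_comp (measurable_coord j) (measurable_coord i')).
apply: (@le_trans _ _ (\int[nu i]_u \int[PQ]_w k (u, w))).
  apply: ge0_le_integral; first exact: measurableT.
  - by move=> u _; apply: itint_ge0 => u'; rewrite lee_fin expR_ge0.
  - apply: (measurable_comp_update i (itint nu l (fun u : env J (env I R) =>
      (expR (F (fun j => c j + \sum_(i <- i :: l) r * (u i j - v j))%R))%:E)) u0).
    apply: measurable_itint; last by move=> u'; rewrite lee_fin expR_ge0.
    apply/measurable_EFinP; apply: (measurableT_comp mexpF); apply: measurable_env => j.
    apply: measurable_funD => //; apply: measurable_sum => i'.
    apply: measurable_funM => //; apply: measurable_funB => //.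
    exact: (measurableT_comp (measurable_coord j) (measurable_coord i')).
  - exact: (@measurable_fun_fubini_tonelli_F _ _ (env I R) Q R PQ k).
  move=> u _.
  rewrite (eq_itint_on _ _ _ (fun u' : env J (env I R) =>
    (expR (F (fun j => shift u j + \sum_(i <- l) r * (u' i j - v j))%R))%:E)); last first.
    move=> u' /(_ i il); rewrite /update eqxx => ui.
    congr ((expR (F _))%:E); apply/funext => j.
    by rewrite big_cons addrA ui.
  exact: IH.
rewrite (@fubini_tonelli _ _ (env I R) Q R (nu i) PQ k mk k0).
pose f (y : env I R) := (expR (F (aff c 1 y)))%:E.
have mf : measurable_fun setT f.
  apply/measurable_EFinP; apply: (measurableT_comp mexpF); exact: measurable_aff.
have f0 y : 0 <= f y by rewrite lee_fin expR_ge0.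
have -> : (2 * r * Lam * Num.sqrt (size l).+1%:R =
   Num.sqrt ((2 * r * Lam) ^+ 2 + s ^+ 2))%R.
  rewrite /s; have a0 := Lr0; set a := (2 * r * Lam)%R in a0 *.
  rewrite [((a * _) ^+ 2)%R]exprMn sqr_sqrtr//.
  have -> : (a ^+ 2 + a ^+ 2 * (size l)%:R = a ^+ 2 * (size l).+1%:R)%R by rewrite -nat1r; ring.
  by rewrite sqrtrM ?sqr_ge0// sqrtr_sqr ger0_norm// ltW.
have -> : \int[PQ]_w (expR (F (aff c (Num.sqrt ((2 * r * Lam) ^+ 2 + s ^+ 2)) (vec w))))%:E =
   \int[PQ]_w f (fun j => (Num.sqrt ((2 * r * Lam) ^+ 2 + s ^+ 2) * vec w j)%R).
  apply: eq_integral => w _; congr ((expR (F _))%:E); apply/funext => j.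
  by rewrite /aff mul1r.
rewrite -(gauss_vec_add mG iG f _ _ mf f0 Lr0 s0).
pose h (p : Q * Q) := (expR (F (aff (aff c s (vec p.2)) (2 * r * Lam) (vec p.1))))%:E.
have mh : measurable_fun setT h.
  apply/measurable_EFinP; apply: (measurableT_comp mexpF).
  apply: measurable_env => j; apply: measurable_funD; last first.
    by apply: measurable_funM => //; apply: (measurableT_comp (mG j)).
  apply: measurable_funD => //.
  by apply: measurable_funM => //; apply: (measurableT_comp (mG j)).
have h0 p : 0 <= h p by rewrite lee_fin expR_ge0.
have -> : \int[PQ]_w \int[PQ]_w' f (fun j => 2 * r * Lam * vec w j + s * vec w' j)%R =
    \int[PQ]_w \int[PQ]_w' h (w, w').
  apply: eq_integral => w _; apply: eq_integral => w' _.
  by congr ((expR (F _))%:E); apply/funext => j; rewrite /aff /=; ring.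
rewrite (@fubini_tonelli _ _ Q Q R PQ PQ h mh h0).
apply: ge0_le_integral; first exact: measurableT.
- by move=> w _; apply: integral_ge0 => u _; exact: k0.
- exact: (@measurable_fun_fubini_tonelli_G _ _ (env I R) Q R (nu i) k).
- exact: (@measurable_fun_fubini_tonelli_G _ _ Q Q R PQ h).
move=> w _; apply: le_trans (nu_dom i (aff c s (vec w))).
rewrite le_eqVlt; apply/orP; left; apply/eqP.
apply: eq_integral => u _; congr ((expR (F _))%:E).
by apply/funext => j; rewrite /shift /aff /=; ring.
Qed.

End RowSums.

(** * Finite suprema of linear forms *)

Section MaxFunctional.
Context {R : realType} {n : nat}.
Implicit Types (Z : seq 'rV[R]_n) (v : env 'I_n R).

Definition pairing (z : 'rV[R]_n) v : R := \sum_i z 0 i * v i.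

(** Starting the maximum at 0 makes the functional nonnegative, and costs nothing in the comparison
    with the mean width because K - K contains 0. *)
Definition maxF Z v : R := \big[Num.max/0]_(z <- Z) pairing z v.

Lemma maxF_ge0 Z v : 0 <= maxF Z v.
Proof.
rewrite /maxF; elim: Z => [|z Z IH]; first by rewrite big_nil.
by rewrite big_cons le_max IH orbT.
Qed.

Lemma maxF_ge Z z v : z \in Z -> pairing z v <= maxF Z v.
Proof.
rewrite /maxF; elim: Z => [//|y Z IH]; rewrite inE big_cons le_max.
by case/predU1P => [->|/IH ->]; rewrite ?lexx ?orbT.
Qed.

Lemma maxF_le Z v x : 0 <= x -> (forall z, z \in Z -> pairing z v <= x) -> maxF Z v <= x.
Proof.
move=> x0; rewrite /maxF; elim: Z => [|y Z IH] h; first by rewrite big_nil.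
rewrite big_cons ge_max h ?mem_head// IH// => z zZ; apply: h.
by rewrite inE zZ orbT.
Qed.

Lemma maxF_attained Z v : maxF Z v = 0 \/ exists2 z, z \in Z & maxF Z v = pairing z v.
Proof.
rewrite /maxF; elim: Z => [|y Z IH]; first by left; rewrite big_nil.
rewrite big_cons maxEge; case: ifP => _.
  by right; exists y; rewrite ?mem_head.
case: IH => [->|[z zZ ->]]; first by left.
by right; exists z => //; rewrite inE zZ orbT.
Qed.

(** The supporting form is a maximizing element of [Z], or 0 when the default value wins. The bound
    4 comes from the squared diameter of the unit ball. *)
Lemma maxF_supp Z v : (forall z, z \in Z -> dotv z z <= 4) ->
  exists z : 'I_n -> R, [/\ \sum_i z i ^+ 2 <= 4,
    maxF Z v = \sum_i z i * v i & forall v', \sum_i z i * v' i <= maxF Z v'].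
Proof.
move=> Z4; have [->|[z zZ ->]] := maxF_attained Z v.
  exists (fun=> 0); split.
  - by rewrite big1// => i _; rewrite expr0n.
  - by rewrite big1// => i _; rewrite mul0r.
  - by move=> v'; rewrite big1 ?maxF_ge0// => i _; rewrite mul0r.
exists (fun i => z 0 i); split => //; last by move=> v'; exact: maxF_ge.
by apply: le_trans (Z4 z zZ); rewrite /dotv le_eqVlt; apply/orP; left; apply/eqP/eq_bigr => i _; rewrite expr2.
Qed.

Lemma measurable_pairing z : measurable_fun setT (pairing z).
Proof. by apply: measurable_sum => i; apply: measurable_funM => //; exact: measurable_coord. Qed.

Lemma measurable_maxF Z : measurable_fun setT (maxF Z).
Proof.
elim: Z => [|z Z IH].
  by rewrite (_ : maxF [::] = cst 0)//; apply/funext => v; rewrite /maxF big_nil.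
rewrite (_ : maxF (z :: Z) = (fun v => Num.max (pairing z v) (maxF Z v))); last first.
  by apply/funext => v; rewrite /maxF big_cons.
by apply: measurable_maxr => //; exact: measurable_pairing.
Qed.

Lemma maxF_scale Z (r : R) v : 0 <= r -> maxF Z (fun j => r * v j) = r * maxF Z v.
Proof.
move=> r0; rewrite /maxF; elim: Z => [|z Z IH]; first by rewrite !big_nil mulr0.
rewrite !big_cons IH maxr_pMr//; congr (Num.max _ _).
by rewrite /pairing mulr_sumr; apply: eq_bigr => i _; rewrite mulrCA.
Qed.

Context {dQ : measure_display}
  {Q : measurableType dQ} {PQ : probability Q R} {G : 'I_n -> Q -> R}.
Hypothesis mG : forall i, measurable_fun setT (G i).
Local Notation gauss := (@gauss R).
Hypothesis iG : indep_law PQ G (fun=> gauss).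
Local Notation vec := (@vec R 'I_n dQ Q G).
Local Open Scope ereal_scope.

Lemma measurable_maxF_vec Z : measurable_fun setT (fun w => maxF Z (vec w)).
Proof. exact: (measurableT_comp (measurable_maxF Z) (measurable_vec mG)). Qed.

(** A maximum is one of its entries, so its exponential is at most the sum of the exponentials, each
    with an explicit Gaussian mean. *)
Lemma maxF_exp_moment Z (s : R) :
  \int[PQ]_w (expR (s * maxF Z (vec w)))%:E < +oo.
Proof.
have me (Z' : seq 'rV[R]_n) : measurable_fun setT (fun w => expR (s * maxF Z' (vec w))).
  apply: (measurableT_comp (@measurable_expR _)); apply: measurable_funM => //.
  exact: measurable_maxF_vec.
elim: Z => [|z Z IH].
  under eq_integral do rewrite /maxF big_nil mulr0.
  by rewrite int_cst ltry.
have mz : measurable_fun setT (fun w => expR (\sum_i (s * z 0 i) * vec w i)).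
  apply: (measurableT_comp (@measurable_expR _)); apply: measurable_sum => i.
  by apply: measurable_funM => //; exact: mG.
apply: (@le_lt_trans _ _ (\int[PQ]_w (expR (\sum_i (s * z 0 i) * vec w i) +
   expR (s * maxF Z (vec w)))%:E)).
  apply: le_int => [||w|w].
  - exact: me.
  - by apply: measurable_funD.
  - exact: expR_ge0.
  have -> : (\sum_i s * z 0 i * vec w i = s * pairing z (vec w))%R.
    by rewrite /pairing mulr_sumr; apply: eq_bigr => i _; rewrite mulrA.
  rewrite /maxF big_cons -/(maxF Z (vec w)) maxEge; case: ifP => _.
    by rewrite lerDl expR_ge0.
  by rewrite lerDr expR_ge0.
rewrite intD; [|exact: mz|exact: me|by move=> w; exact: expR_ge0|by move=> w; exact: expR_ge0].
by rewrite (gauss_vec_mgf mG iG) lte_add_pinfty// ltry.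
Qed.

End MaxFunctional.

(** * Conditional signs *)

Section ItintRows.
Context {R : realType} {J I : eqType} (mu : probability R R).
Local Open Scope ereal_scope.

Definition rowe (i : J) (c : env (J * I)%type R) : env I R := fun j => c (i, j).

Lemma measurable_rowe i : measurable_fun setT (rowe i).
Proof. by apply: measurable_env => j; exact: measurable_coord. Qed.

Lemma itint_rowe i (l : seq I) (f : env I R -> \bar R) c :
  itint (fun=> mu) [seq (i, j) | j <- l] (fun c => f (rowe i c)) c =
  itint (fun=> mu) l f (rowe i c).
Proof.
elim: l c => [//|j l IH] c /=; apply: eq_integral => t _; rewrite IH.
congr itint; apply/funext => k; rewrite /rowe /update.
by rewrite xpair_eqE eqxx.
Qed.

Lemma itintZ (nu : J -> probability R R) (l : seq J) (f : env J R -> R) (k : R) c :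
  measurable_fun setT f -> (forall c, (0 <= f c)%R) -> (0 <= k)%R ->
  itint nu l (fun c => (k * f c)%:E) c = k%:E * itint nu l (fun c => (f c)%:E) c.
Proof.
move=> mf f0 k0; elim: l c => [|i l IH] c /=; first by rewrite EFinM.
under eq_integral do rewrite IH.
have mi : measurable_fun setT (fun t => itint nu l (fun c => (f c)%:E) (update c i t)).
  by apply: measurable_comp_update; apply: measurable_itint => [|c']; [exact/measurable_EFinP|rewrite lee_fin].
rewrite ge0_integralZl//.
by move=> t _; apply: itint_ge0 => c'; rewrite lee_fin.
Qed.

End ItintRows.

Section ItintProd.
Context {R : realType} {J I : eqType} (mu : probability R R).
Local Open Scope ereal_scope.

(** The entries are listed row by row. While the later rows are integrated the factor of row [i]
    stays fixed, so each row contributes its own constant. *)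
Lemma itint_prod_rows (l : seq J) (s : seq I) (g : J -> env I R -> R) (e : J -> R)
    (c : env (J * I)%type R) : uniq l ->
  (forall i, measurable_fun setT (g i)) -> (forall i a, (0 <= g i a)%R) ->
  (forall i a, itint (fun=> mu) s (fun a => (g i a)%:E) a = (e i)%:E) ->
  itint (fun=> mu) (flatten [seq [seq (i, j) | j <- s] | i <- l])
    (fun c => (\prod_(i <- l) g i (rowe i c))%:E) c = (\prod_(i <- l) e i)%:E.
Proof.
move=> + mg g0 ge; elim: l c => [|i l IH] c /=; first by rewrite !big_nil.
move=> /andP[il ul]; rewrite itint_cat.
have mp : measurable_fun setT (fun c : env (J * I)%type R => \prod_(i <- l) g i (rowe i c))%R.
  by apply: measurable_prod => k _; apply: (measurableT_comp (mg k)); exact: measurable_rowe.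
have p0 (c' : env (J * I)%type R) : (0 <= \prod_(i <- l) g i (rowe i c'))%R by exact: prodr_ge0.
transitivity (itint (fun=> mu) [seq (i, j) | j <- s]
    (fun c' => (g i (rowe i c'))%:E * (\prod_(i <- l) e i)%:E) c).
  apply: eq_itint => c'.
  rewrite (eq_itint_on _ _ _ (fun c'' => (g i (rowe i c') * \prod_(i <- l) g i (rowe i c''))%:E)).
    by rewrite itintZ// IH.
  move=> c'' h; rewrite big_cons; congr ((g i _ * _)%:E).
  apply/funext => j; rewrite /rowe h//.
  apply/negP => /flatten_mapP[k kl /mapP[j' _ [ik _]]].
  by rewrite ik kl in il.
have e0 k : (0 <= e k)%R.
  by rewrite -lee_fin -(ge k (fun=> 0%R)); apply: itint_ge0 => a; rewrite lee_fin.
under eq_itint do rewrite -EFinM mulrC.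
rewrite (itintZ (fun=> mu) _ (fun c => g i (rowe i c))); last 3 first.
- by apply: (measurableT_comp (mg i)); exact: measurable_rowe.
- by move=> c'; exact: g0.
- by rewrite prodr_ge0.
by rewrite (itint_rowe mu i s (fun a => (g i a)%:E)) ge big_cons -EFinM mulrC.
Qed.

End ItintProd.

Section ConditionalSigns.
Context {R : realType} {d : measure_display} {T : measurableType d}
  {P : probability T R} {m n : nat}.
Variables (mu : probability R R) (A : 'I_m -> 'I_n -> T -> R) (Y : 'I_m -> T -> R)
  (th : env 'I_n R -> R).
Hypothesis mA : forall i j, measurable_fun setT (A i j).
Hypothesis mY : forall i, measurable_fun setT (Y i).
Hypothesis iA : indep_law P (fun k : 'I_m * 'I_n => A k.1 k.2) (fun=> mu).
Hypothesis Y1 : forall i w, Y i w = 1 \/ Y i w = -1.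
Hypothesis mth : measurable_fun setT th.
Hypothesis th1 : forall a, -1 <= th a <= 1.
Hypothesis model : cond_pm1_model P (gen_sigma (fun k : 'I_m * 'I_n => A k.1 k.2))
  Y (fun i w => th (fun j => A i j w)).
Local Open Scope ereal_scope.

Let arow (i : 'I_m) (w : T) : env 'I_n R := fun j => A i j w.

Let marow i : measurable_fun setT (arow i).
Proof. by apply: measurable_env => j; exact: mA. Qed.

Definition sgn (b : bool) : R := if b then 1%R else (-1)%R.
(** The conditional probability that the label is [sgn b], given that the row equals [a]. *)
Definition wsgn (b : bool) (a : env 'I_n R) : R := ((1 + sgn b * th a) / 2)%R.

Lemma wsgn_ge0 b a : (0 <= wsgn b a)%R.
Proof. by rewrite /wsgn /sgn; have := th1 a; case: b => /andP[]; lra. Qed.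

Lemma measurable_wsgn b : measurable_fun setT (wsgn b).
Proof.
rewrite (_ : wsgn b = fun a => ((1 + sgn b * th a) * 2^-1)%R)//.
by meas.
Qed.

Lemma indep_row i : indep_law P (A i) (fun=> mu).
Proof.
move=> B mB.
pose B' (k : 'I_m * 'I_n) := if k.1 == i then B k.2 else setT.
have := iA B'; rewrite (_ : [set w | _] = [set w | forall j, B j (A i j w)]); last first.
  apply/seteqP; split => w /= h.
    by move=> j; have := h (i, j); rewrite /B' /= eqxx.
  by move=> [i' j]; rewrite /B' /=; case: eqP => // ->; exact: h.
move=> ->; last by move=> k; rewrite /B'; case: ifP.
congr (_%:E).
rewrite (reindex_onto (fun k => k) (fun k => k))//=.
transitivity (\prod_(i' : 'I_m) \prod_(j : 'I_n) fine (mu (B' (i', j))))%R.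
  by rewrite pair_bigA/=; apply: eq_big => [k|k _]; rewrite ?eqxx -?surjective_pairing.
rewrite (bigD1 i)//= [X in (_ * X)%R]big1 ?mulr1.
  by apply: eq_bigr => j _; rewrite /B' eqxx.
move=> k ki; rewrite big1// => j _; rewrite /B' /= (negbTE ki).
have -> : mu setT = 1 by exact: probability_setT.
by [].
Qed.

Lemma integral_prod_rows (g : 'I_m -> env 'I_n R -> R) :
  (forall i, measurable_fun setT (g i)) -> (forall i a, (0 <= g i a <= 1)%R) ->
  \int[P]_w (\prod_i g i (arow i w))%:E =
  (\prod_i fine (\int[P]_w (g i (arow i w))%:E))%:E.
Proof.
move=> mg g01.
have g0 i a : (0 <= g i a)%R by have /andP[] := g01 i a.
have gE i a : itint (fun=> mu) (enum 'I_n) (fun a => (g i a)%:E) a =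
    (fine (\int[P]_w (g i (arow i w))%:E))%:E.
  rewrite fineK; last first.
    rewrite ge0_fin_numE; last by apply: int_ge0.
    apply: (@le_lt_trans _ _ 1); last exact: ltry.
    rewrite -[leRHS](int_cst P); apply: le_int => [||w|w] //.
      exact: (measurableT_comp (mg i) (marow i)).
    by have /andP[] := g01 i (arow i w).
  rewrite (indep_integral (mA i) (indep_row i) (enum 'I_n) (fun a => (g i a)%:E) a)//.
  - by move=> j; rewrite mem_enum.
  - exact/measurable_EFinP.
  - by move=> c; rewrite lee_fin.
pose l := flatten [seq [seq (i, j) | j <- enum 'I_n] | i <- enum 'I_m].
have := itint_prod_rows mu (enum 'I_m) (enum 'I_n) g _ (fun=> 0%R) (enum_uniq _) mg g0 gE.
rewrite [in RHS]big_enum /= => <-.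
rewrite -(indep_integral (fun k => mA k.1 k.2) iA).
- by apply: eq_integral => w _; rewrite big_enum.
- move=> [i j]; apply/flatten_mapP; exists i; rewrite ?mem_enum//.
  by apply/mapP; exists j; rewrite ?mem_enum.
- apply/measurable_EFinP; apply: measurable_prod => i _.
  by apply: (measurableT_comp (mg i)); exact: measurable_rowe.
- by move=> c; rewrite lee_fin prodr_ge0.
Qed.

Lemma gen_sigma_preimage (C : set (env ('I_m * 'I_n)%type R)) : measurable C ->
  gen_sigma (fun k : 'I_m * 'I_n => A k.1 k.2) [set w | C (fun k => A k.1 k.2 w)].
Proof.
move=> mC.
pose f (w : T) : env ('I_m * 'I_n)%type R := fun k => A k.1 k.2 w.
pose S := [set C : set (env ('I_m * 'I_n)%type R) |
  gen_sigma (fun k : 'I_m * 'I_n => A k.1 k.2) (f @^-1` C)].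
suff : measurable `<=` S by move=> /(_ C mC).
apply: smallest_sub.
  split.
  - by rewrite /S /= preimage_set0; exact: sigma_algebra0.
  - move=> C' SC'; rewrite /S /= setTD preimage_setC -setTD.
    exact: sigma_algebraCD.
  - by move=> C' SC'; rewrite /S /= preimage_bigcup; exact: sigma_algebra_bigcup.
move=> _ [k _ [B mB <-]]; rewrite /S /=; apply: sub_sigma_algebra.
exists k => //; exists B => //; rewrite !setTI.
Qed.

(** Split over the label patterns s. For a fixed pattern the condition on the rows lies in the
    sigma-algebra that they generate, so the model applies, and the rows factor by independence. The
    sum over s of the products is a product of sums. *)
Lemma signed_rows_prob (B : 'I_m -> bool -> set (env 'I_n R)) :
  (forall i b, measurable (B i b)) ->
  P [set w | forall i, B i (Y i w == 1%R) (arow i w)] =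
  (\prod_i \sum_(b : bool) fine (\int[P]_w (\1_(B i b) (arow i w) * wsgn b (arow i w))%:E))%:E.
Proof.
move=> mB.
pose GA (s : {ffun 'I_m -> bool}) := [set w : T | forall i, B i (s i) (arow i w)].
pose ev (s : {ffun 'I_m -> bool}) := GA s `&` [set w | forall i, Y i w = (if s i then 1%R else (-1)%R)].
have mGA s : measurable (GA s).
  have -> : GA s = \bigcap_(i in [set: 'I_m]) (arow i @^-1` B i (s i)).
    by apply/seteqP; split => [w h i _|w h i]; [exact: h|exact: (h i I)].
  apply: fin_bigcap_measurable; first exact: finite_finset.
  by move=> i _; rewrite -[X in measurable X]setTI; exact: marow.
have mev s : measurable (ev s).
  apply: measurableI => //.
  have -> : [set w | forall i, Y i w = (if s i then 1%R else (-1)%R)] =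
      \bigcap_(i in [set: 'I_m]) (Y i @^-1` [set (if s i then 1%R else (-1)%R)]).
    by apply/seteqP; split => [w h i _|w h i]; [exact: h|exact: (h i I)].
  apply: fin_bigcap_measurable; first exact: finite_finset.
  by move=> i _; rewrite -[X in measurable X]setTI; exact: mY.
have n11 : ((-1)%R == 1%R :> R) = false.
  by rewrite eq_sym -subr_eq0 opprK (_ : 1 + 1 = 2)%R// pnatr_eq0.
have -> : [set w | forall i, B i (Y i w == 1%R) (arow i w)] =
    \bigcup_(s in [set: {ffun 'I_m -> bool}]) ev s.
  apply/seteqP; split => w /=.
    move=> h; exists [ffun i => Y i w == 1%R] => //.
    split => i /=; rewrite ffunE; first exact: h.
    by case: (Y1 i w) => ->; rewrite ?eqxx// n11.
  move=> [s _ [h1 h2]] i; have -> : (Y i w == 1%R) = s i; last exact: h1.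
  by rewrite h2; case: (s i); rewrite ?eqxx// n11.
have tev : trivIset [set: {ffun 'I_m -> bool}] ev.
  move=> s s' _ _ [w [[_ h1] [_ h2]]]; apply/ffunP => i.
  have := h1 i; rewrite h2; case: (s i); case: (s' i) => // /eqP.
    by rewrite n11.
  by rewrite eq_sym n11.
rewrite (measure_fin_bigcup P finite_finset tev (fun s _ => mev s)).
rewrite (fsbigE (index_enum {ffun 'I_m -> bool})) ?index_enum_uniq//; last first.
  by move=> s _; rewrite mem_index_enum.
under eq_bigl do rewrite in_setT.
transitivity (\sum_(s : {ffun 'I_m -> bool})
   (\prod_i fine (\int[P]_w (\1_(B i (s i)) (arow i w) * wsgn (s i) (arow i w))%:E))%:E); last first.
  by rewrite sumEFin bigA_distr_bigA.
apply: eq_bigr => s _.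
have gGA : gen_sigma (fun k : 'I_m * 'I_n => A k.1 k.2) (GA s).
  apply: (gen_sigma_preimage [set c | forall i, B i (s i) (rowe i c)]).
  have -> : [set c : env ('I_m * 'I_n)%type R | forall i, B i (s i) (rowe i c)] =
      \bigcap_(i in [set: 'I_m]) (rowe i @^-1` B i (s i)).
    by apply/seteqP; split => [w h i _|w h i]; [exact: h|exact: (h i I)].
  apply: fin_bigcap_measurable; first exact: finite_finset.
  by move=> i _; rewrite -[X in measurable X]setTI; exact: measurable_rowe.
apply: (etrans (model s (GA s) gGA)); rewrite integral_mkcond.
rewrite -(integral_prod_rows (fun i a => \1_(B i (s i)) a * wsgn (s i) a)%R).
- apply: eq_integral => w _; rewrite /patch; case: ifPn => [|wG].
    rewrite inE => wG; congr (_%:E); apply: eq_bigr => i _.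
    by rewrite indicE mem_set ?mul1r//; exact: wG.
  have [i nBi] : exists i, ~ B i (s i) (arow i w).
    apply/existsNP => h; move/negP: wG; apply; rewrite inE; exact: h.
  by rewrite (bigD1 i)//= indicE memNset// mul0r mul0r.
- by move=> i; apply: measurable_funM; [exact: measurable_indic|exact: measurable_wsgn].
- move=> i a; rewrite indicE; apply/andP; split; first by rewrite mulr_ge0// wsgn_ge0.
  have w1 : (wsgn (s i) a <= 1)%R.
    by rewrite /wsgn /sgn; have := th1 a; case: (s i) => /andP[]; lra.
  by case: (_ \in _); rewrite ?mul1r// mul0r.
Qed.

End ConditionalSigns.

Section LawOf.
Context {R : realType} {d d' : measure_display} {T : measurableType d}
  {E : measurableType d'} (P : probability T R).
Local Open Scope ereal_scope.

Definition law_of (X : T -> E) (mX : measurable_fun setT X) : probability E R :=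
  distribution P (mfun_Sub (mem_set mX)).

Lemma law_ofE (X : T -> E) (mX : measurable_fun setT X) B : law_of X mX B = P (X @^-1` B).
Proof. by []. Qed.

Lemma integral_law_of (X : T -> E) (mX : measurable_fun setT X) (f : E -> \bar R) :
  measurable_fun setT f -> (forall x, 0 <= f x) ->
  \int[law_of X mX]_x f x = \int[P]_w f (X w).
Proof. by move=> mf f0; rewrite ge0_integral_distribution. Qed.

End LawOf.

Section SignedRows.
Context {R : realType} {d : measure_display} {T : measurableType d}
  {P : probability T R} {m n : nat}.
Variables (mu : probability R R) (A : 'I_m -> 'I_n -> T -> R) (Y : 'I_m -> T -> R)
  (th : env 'I_n R -> R).
Hypothesis mA : forall i j, measurable_fun setT (A i j).
Hypothesis mY : forall i, measurable_fun setT (Y i).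
Hypothesis iA : indep_law P (fun k : 'I_m * 'I_n => A k.1 k.2) (fun=> mu).
Hypothesis Y1 : forall i w, Y i w = 1 \/ Y i w = -1.
Hypothesis mth : measurable_fun setT th.
Hypothesis th1 : forall a, -1 <= th a <= 1.
Hypothesis model : cond_pm1_model P (gen_sigma (fun k : 'I_m * 'I_n => A k.1 k.2))
  Y (fun i w => th (fun j => A i j w)).
Local Open Scope ereal_scope.
Local Notation wsgn := (wsgn th).

Definition arow (i : 'I_m) (w : T) : env 'I_n R := fun j => A i j w.
Definition urow (i : 'I_m) (w : T) : env 'I_n R := fun j => (Y i w * A i j w)%R.

Lemma measurable_arow i : measurable_fun setT (arow i).
Proof. by apply: measurable_env => j; exact: mA. Qed.

Lemma measurable_urow i : measurable_fun setT (urow i).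
Proof. by apply: measurable_env => j; apply: measurable_funM. Qed.

Lemma wsgn_le1 b a : (wsgn b a <= 1)%R.
Proof. by rewrite /wsgn /sgn; have := th1 a; case: b => /andP[]; lra. Qed.

Let mw b i : measurable_fun setT (fun w => wsgn b (arow i w)).
Proof. exact: (measurableT_comp (measurable_wsgn th mth b) (measurable_arow i)). Qed.

(** Leave the other rows unconstrained: each contributes a factor 1, because its two label weights
    add up to 1. *)
Lemma signed_row_prob i (B : bool -> set (env 'I_n R)) :
  (forall b, measurable (B b)) ->
  P [set w | B (Y i w == 1%R) (arow i w)] =
  (\sum_(b : bool) fine (\int[P]_w (\1_(B b) (arow i w) * wsgn b (arow i w))%:E))%:E.
Proof.
move=> mB.
pose B' k := if k == i then B else fun=> setT.
have mB' k b : measurable (B' k b) by rewrite /B'; case: (k == i).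
have := signed_rows_prob mu A Y th mA mY iA Y1 mth th1 model B' mB'.
have -> : [set w | forall k, B' k (Y k w == 1%R) (fun j => A k j w)] =
    [set w | B (Y i w == 1%R) (arow i w)].
  apply/seteqP; split => w /= h; first by have := h i; rewrite /B' eqxx.
  by move=> k; rewrite /B'; case: eqP => // ->.
move=> ->; congr (_%:E); rewrite (bigD1 i)//= [X in (_ * X)%R]big1 ?mulr1 => [|k ki].
  by apply: eq_bigr => b _; rewrite /B' eqxx.
rewrite /B' (negbTE ki) big_bool /=.
have e b : \int[P]_w (\1_[set: env 'I_n R] (arow k w) * wsgn b (arow k w))%:E =
    \int[P]_w (wsgn b (arow k w))%:E.
  by apply: eq_integral => w _; rewrite indicT mul1r.
have fn b : \int[P]_w (wsgn b (arow k w))%:E \is a fin_num.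
  rewrite ge0_fin_numE; last by apply: int_ge0 => w; exact: (wsgn_ge0 th th1).
  apply: (@le_lt_trans _ _ 1); last exact: ltry.
  rewrite -[leRHS](int_cst P); apply: le_int => [||w|w].
  - exact: mw.
  - exact: measurable_cst.
  - exact: (wsgn_ge0 th th1).
  - exact: wsgn_le1.
rewrite !e -fineD// -intD; [|exact: mw|exact: mw|by move=> w; exact: (wsgn_ge0 th th1)|by move=> w; exact: (wsgn_ge0 th th1)].
rewrite (_ : \int[P]_w _ = 1)//.
rewrite -[RHS](int_cst P); apply: eq_integral => w _.
by congr (_%:E); rewrite /wsgn /sgn; field.
Qed.

(** Since y_i a_i is a function of the label and the row, an event on it becomes one event on the
    row per label, to which the product formula for labelled rows applies. *)
Lemma indep_urow : indep_law P urow (fun i => law_of P (urow i) (measurable_urow i)).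
Proof.
move=> B mB.
pose B' i b := [set a : env 'I_n R | B i (fun j => sgn b * a j)%R].
have mB' i b : measurable (B' i b).
  have ms : measurable_fun setT (fun a : env 'I_n R => (fun j => sgn b * a j)%R : env 'I_n R).
    by apply: measurable_env => j; apply: measurable_funM => //; exact: measurable_coord.
  by rewrite -[X in measurable X]setTI; exact: ms.
have UE i w : B i (urow i w) = B' i (Y i w == 1%R) (arow i w).
  rewrite /B' /=; congr (B i _); apply/funext => j; rewrite /urow /arow.
  have [->|->] := Y1 i w; first by rewrite eqxx.
  by rewrite eq_sym -subr_eq0 opprK (_ : 1 + 1 = 2)%R// pnatr_eq0.
have -> : [set w | forall i, B i (urow i w)] =
    [set w | forall i, B' i (Y i w == 1%R) (arow i w)].
  by apply/seteqP; split => w /= h i; [rewrite -UE|rewrite UE]; exact: h.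
have := signed_rows_prob mu A Y th mA mY iA Y1 mth th1 model B' mB'.
move=> ->; congr (_%:E); apply: eq_bigr => i _.
rewrite law_ofE.
have -> : urow i @^-1` B i = [set w | B' i (Y i w == 1%R) (arow i w)].
  by apply/seteqP; split => w /=; rewrite UE.
by rewrite signed_row_prob.
Qed.

(** On the event that the label is [b], the row has density [wsgn b] with respect to its own law.
    This is [signed_row_prob] on sets, and [integral_density] extends it to functions. *)
Lemma integral_sign_indic i (b : bool) (h : env 'I_n R -> R) :
  measurable_fun setT h -> (forall a, (0 <= h a)%R) ->
  \int[P]_w (if (Y i w == 1%R) == b then h (arow i w) else 0%R)%:E =
  \int[P]_w (h (arow i w) * wsgn b (arow i w))%:E.
Proof.
move=> mh h0.
pose D := [set w | (Y i w == 1%R) == b].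
have mD1 : measurable [set w | Y i w = 1%R].
  by rewrite -[X in measurable X]setTI; exact: (mY i measurableT [set 1%R] (measurable_set1 _)).
have mD : measurable D.
  rewrite /D; case: b {D}.
    rewrite (_ : [set w | _] = [set w | Y i w = 1%R])//.
    by apply/seteqP; split => w /=; rewrite eqb_id => /eqP.
  rewrite (_ : [set w | _] = ~` [set w | Y i w = 1%R]); first exact: measurableC.
  by apply/seteqP; split => w /=; rewrite eqbF_neg => /eqP.
pose mD' : {measure set T -> \bar R} := mrestr P mD.
pose nu := law_of P (arow i) (measurable_arow i).
pose XA : {mfun T >-> env 'I_n R} := mfun_Sub (mem_set (measurable_arow i)).
have mhE : measurable_fun setT (fun a => (h a)%:E) by exact/measurable_EFinP.
have h0E a : 0 <= (h a)%:E by rewrite lee_fin.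
transitivity (\int[pushforward mD' XA]_a (h a)%:E).
  rewrite (@ge0_integral_pushforward _ _ _ _ _ _ (measurable_arow i) mD' setT _ measurableT mhE)//.
  rewrite preimage_setT.
  have mha : measurable_fun setT (fun w => (h (arow i w))%:E).
    exact: (measurableT_comp mhE (measurable_arow i)).
  rewrite (integral_density mD' P (\1_D : T -> R) (fun w => (h (arow i w))%:E))//.
  - apply: eq_integral => w _; rewrite -EFinM indicE /=; congr (_%:E).
    case: ifP => wD; first by rewrite mem_set ?mulr1.
    by rewrite memNset ?mulr0//= /D /= wD.
  - by move=> B mB; rewrite integral_indic// setIC.
have mg : measurable_fun setT (wsgn b) by exact: (measurable_wsgn th mth).
rewrite (integral_density (pushforward mD' XA) nu (wsgn b) (fun a => (h a)%:E) mg)//.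
- rewrite integral_law_of//.
    by apply: emeasurable_funM => //; exact/measurable_EFinP.
  by move=> a; rewrite mule_ge0// lee_fin (wsgn_ge0 th th1).
- by move=> a; exact: (wsgn_ge0 th th1).
move=> C mC; rewrite integral_mkcond integral_law_of; first last.
- by move=> a; rewrite /patch; case: ifP => // _; rewrite lee_fin (wsgn_ge0 th th1).
- by apply/(measurable_restrictT _ _).1 => //; apply: measurable_funTS; exact/measurable_EFinP.
transitivity (P [set w | (fun b' => if b' == b then C else set0) (Y i w == 1%R) (arow i w)]).
  rewrite /= /pushforward /mD' /mrestr; congr (P _); apply/seteqP; split => w /=; rewrite /D /=.
    by move=> [Cw ->].
  by case: ifP.
rewrite (signed_row_prob i (fun b' => if b' == b then C else set0)); last first.
  by move=> b'; case: ifP.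
rewrite (bigD1 b)//= eqxx big1 ?addr0 => [|b' /negbTE ->]; last first.
  by under eq_integral do rewrite indic0 mul0r; rewrite int_cst.
rewrite fineK.
  apply: eq_integral => w _; rewrite /patch indicE; case: ifP => _; by rewrite ?mul1r ?mul0r.
rewrite ge0_fin_numE; last by apply: int_ge0 => w; rewrite mulr_ge0// (wsgn_ge0 th th1).
apply: (@le_lt_trans _ _ 1); last exact: ltry.
rewrite -[leRHS](int_cst P); apply: le_int => [||w|w] //.
- apply: measurable_funM; last exact: mw.
  by apply: (measurableT_comp _ (measurable_arow i)); exact: measurable_indic.
- by rewrite mulr_ge0// (wsgn_ge0 th th1).
- by rewrite indicE; case: (_ \in _); rewrite ?mul1r ?mul0r// wsgn_le1.
Qed.

Lemma integral_sign i (h : bool -> env 'I_n R -> R) :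
  (forall b, measurable_fun setT (h b)) -> (forall b a, (0 <= h b a)%R) ->
  \int[P]_w (h (Y i w == 1%R) (arow i w))%:E =
  \int[P]_w (h true (arow i w) * wsgn true (arow i w) +
             h false (arow i w) * wsgn false (arow i w))%:E.
Proof.
move=> mh h0.
have mha b : measurable_fun setT (fun w => h b (arow i w)).
  exact: (measurableT_comp (mh b) (measurable_arow i)).
have mD b : measurable [set w | (Y i w == 1%R) == b].
  have mD1 : measurable [set w | Y i w = 1%R].
    by rewrite -[X in measurable X]setTI; exact: (mY i measurableT [set 1%R] (measurable_set1 _)).
  case: b.
    rewrite (_ : [set w | _] = [set w | Y i w = 1%R])//.
    by apply/seteqP; split => w /=; rewrite eqb_id => /eqP.
  rewrite (_ : [set w | _] = ~` [set w | Y i w = 1%R]); first exact: measurableC.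
  by apply/seteqP; split => w /=; rewrite eqbF_neg => /eqP.
have mi b : measurable_fun setT (fun w => if (Y i w == 1%R) == b then h b (arow i w) else 0%R).
  apply: measurable_fun_ifT => //; apply: (measurable_fun_bool true) => /=.
  rewrite setTI; rewrite (_ : _ @^-1` _ = [set w | (Y i w == 1%R) == b])//.
rewrite intD; [|by apply: measurable_funM => //; exact: mw|by apply: measurable_funM => //; exact: mw|by move=> w; rewrite mulr_ge0// (wsgn_ge0 th th1)|by move=> w; rewrite mulr_ge0// (wsgn_ge0 th th1)].
rewrite -!integral_sign_indic// -intD//.
- by apply: eq_integral => w _; case: (Y i w == 1%R) => /=; rewrite ?addr0 ?add0r.
- by move=> w; case: ifP.
- by move=> w; case: ifP.
Qed.

End SignedRows.

(** * Taylor expansions and Lindeberg replacement *)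

Section Taylor.
Context {R : realType}.

Lemma ler_norm_derive0 (f df g dg : R -> R) (x : R) : 0 <= x ->
  (forall t : R, is_derive t 1 f (df t)) -> (forall t : R, is_derive t 1 g (dg t)) ->
  f 0 = 0 -> g 0 = 0 -> (forall t : R, 0 <= t -> `|df t| <= dg t) ->
  `|f x| <= g x.
Proof.
move=> x0 fd gd f0 g0 fg; rewrite ler_norml; apply/andP; split.
  have := @ler_derive0 R (fun t => g t + f t) (fun t => dg t + df t) x x0.
  rewrite f0 g0 addr0 => h; rewrite lerNl -subr_ge0 opprK; apply: h.
  by move=> t /fg; rewrite ler_norml => /andP[]; lra.
have := @ler_derive0 R (fun t => g t - f t) (fun t => dg t - df t) x x0.
rewrite f0 g0 subrr subr_ge0; apply.
by move=> t /fg; rewrite ler_norml subr_ge0 => /andP[].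
Qed.

(** Three successive comparisons of derivatives. The estimate for [p1] is kept because theta' has to
    be expanded as well as theta. *)
Lemma taylor_nneg (p0 p1 p2 p3 : R -> R) (B x : R) : 0 <= x ->
  (forall t : R, is_derive t 1 p0 (p1 t)) -> (forall t : R, is_derive t 1 p1 (p2 t)) ->
  (forall t : R, is_derive t 1 p2 (p3 t)) -> (forall t, `|p3 t| <= B) ->
  `|p1 x - p1 0 - p2 0 * x| <= B / 2 * x ^+ 2 /\
  `|p0 x - p0 0 - p1 0 * x - p2 0 / 2 * x ^+ 2| <= B / 6 * x ^+ 3.
Proof.
move=> x0 d0 d1 d2 b3.
have s2 t : 0 <= t -> `|p2 t - p2 0| <= B * t.
  move=> t0; apply: (ler_norm_derive0 (fun t => p2 t - p2 0) p3 (fun t => B * t) (fun=> B)) => //.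
  - by move=> s; have h := is_deriveB (d2 s) (is_derive_cst (p2 0) s (1 : R)); rewrite subr0 in h.
  - by move=> s; apply: is_derive_eq; rewrite /GRing.scale/= ; ring.
  - by rewrite subrr.
  - by rewrite mulr0.
have s1 t : 0 <= t -> `|p1 t - p1 0 - p2 0 * t| <= B / 2 * t ^+ 2.
  move=> t0; apply: (ler_norm_derive0 (fun t => p1 t - p1 0 - p2 0 * t) (fun t => p2 t - p2 0)
     (fun t => B / 2 * t ^+ 2) (fun t => B * t)) => //.
  - by move=> s; have := d1 s => ?; apply: is_derive_eq; rewrite /GRing.scale/= ; ring.
  - by move=> s; apply: is_derive_eq; rewrite /GRing.scale/= ; field.
  - by rewrite subrr mulr0 subr0.
  - by rewrite expr0n mulr0.
split; first exact: s1.
apply: (ler_norm_derive0 (fun t => p0 t - p0 0 - p1 0 * t - p2 0 / 2 * t ^+ 2)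
   (fun t => p1 t - p1 0 - p2 0 * t)
   (fun t => B / 6 * t ^+ 3) (fun t => B / 2 * t ^+ 2)) => //.
- by move=> s; have := d0 s => ?; apply: is_derive_eq; rewrite /GRing.scale/= ; field.
- by move=> s; apply: is_derive_eq; rewrite /GRing.scale/= ; field.
- by rewrite subrr !mulr0 expr0n mulr0 !subr0.
- by rewrite expr0n mulr0.
Qed.

Lemma taylor_C3 (f : R -> R) (B c u : R) : C3 f -> (forall t, `|derive1n 3 f t| <= B) ->
  `|derive1n 1 f (c + u) - derive1n 1 f c - derive1n 2 f c * u| <= B / 2 * u ^+ 2 /\
  `|f (c + u) - f c - derive1n 1 f c * u - derive1n 2 f c / 2 * u ^+ 2| <= B / 6 * `|u| ^+ 3.
Proof.
move=> [d0 [d1 [d2 _]]] b3.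
have dd (g : R -> R) : (forall t, derivable g t 1) ->
    forall e x : R, is_derive x 1 (fun t : R => g (c + e * t)) (e * derive1 g (c + e * x)).
  move=> dg e x.
  have h1 : is_derive x 1 (fun t : R => c + e * t) e.
    by apply: is_derive_eq; rewrite /GRing.scale/= ; ring.
  have h2 : is_derive (c + e * x) 1 g (derive1 g (c + e * x)).
    by rewrite derive1E; exact: derivableP.
  have := @is_derive1_comp _ g (fun t : R => c + e * t) x _ _ h2 h1.
  by rewrite mulrC.
(* The direction [e] is 1 or -1: the function f(c + e t) on t >= 0 reaches both sides of c. *)
have key (e x : R) : e ^+ 2 = 1 -> 0 <= x -> x = `|e * x| ->
  `|derive1n 1 f (c + e * x) - derive1n 1 f c - derive1n 2 f c * (e * x)| <= B / 2 * (e * x) ^+ 2 /\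
  `|f (c + e * x) - f c - derive1n 1 f c * (e * x) - derive1n 2 f c / 2 * (e * x) ^+ 2| <= B / 6 * `|e * x| ^+ 3.
  move=> e2 x0 xe; rewrite -xe.
  have [||||h1 h0] := @taylor_nneg (fun t => f (c + e * t)) (fun t => e * derive1n 1 f (c + e * t))
     (fun t => derive1n 2 f (c + e * t)) (fun t => e * derive1n 3 f (c + e * t)) B x x0.
  - by move=> t; exact: dd.
  - move=> t; have h := dd _ d1 e t.
    by apply: is_derive_eq; rewrite /GRing.scale/= mulrA -expr2 e2 mul1r.
  - by move=> t; have := dd _ d2 e t; rewrite -derive1nS.
  - move=> t; rewrite normrM; have -> : `|e| = 1.
      by apply/eqP; rewrite -sqrp_eq1// real_normK ?num_real// e2.
    by rewrite mul1r.
  have e1 : `|e| = 1.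
    by apply/eqP; rewrite -sqrp_eq1// real_normK ?num_real// e2.
  split.
    rewrite exprMn e2 mul1r; move: h1; rewrite mulr0 addr0.
    rewrite -[X in X <= _ -> _]mul1r -{1}e1 -normrM; congr (`|_| <= _).
    by rewrite !mulrBr !mulrA -!expr2 e2; ring.
  move: h0; rewrite mulr0 addr0 exprMn e2 mul1r; congr (`|_| <= _).
  by ring.
case: (lerP 0 u) => u0.
  have := key 1 u; rewrite !mul1r expr1n ger0_norm//; exact.
have := key (-1) (- u); rewrite mulrNN mul1r sqrrN expr1n ltr0_norm//; apply => //.
by rewrite oppr_ge0 ltW.
Qed.

End Taylor.

Ltac nonneg := repeat first
  [ done | exact: sqr_ge0 | exact: normr_ge0 | exact: expR_ge0
  | apply: addr_ge0 | apply: mulr_ge0 | apply: exprn_ge0 ].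

Section StandardLaws.
Context {R : realType} (nu : probability R R) (M : R).
Hypothesis nu_std : std_law nu M.
Local Open Scope ereal_scope.

Lemma std_poly (al be ga : R) : (0 <= al)%R -> (0 <= be)%R -> (0 <= ga)%R ->
  \int[nu]_t (al + be * t ^+ 2 + ga * t ^+ 4)%:E <= (al + be + ga * M)%:E.
Proof.
move=> al0 be0 ga0; have [_ m2 m4] := nu_std.
have p2 (t : R) : (0 <= t ^+ 2)%R by exact: sqr_ge0.
have p4 (t : R) : (0 <= t ^+ 4)%R by exact: exprn_even_ge0.
rewrite intD; [|by meas|by meas|by move=> t; nonneg|by move=> t; nonneg].
rewrite intD; [|by meas|by meas|by []|by move=> t; nonneg].
rewrite int_cst intZ; [|by meas|by []|by []].
rewrite intZ; [|by meas|by []|by []].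
rewrite m2 mule1 [leRHS]EFinD EFinM.
by rewrite leeD2l//; apply: lee_wpmul2l; rewrite ?lee_fin.
Qed.

Lemma std_symmetrize (f : R -> R) : measurable_fun setT f -> (forall t, (0 <= f t)%R) ->
  \int[nu]_t (f t + f (- t))%:E = 2%:E * \int[nu]_t (f t)%:E.
Proof.
move=> mf f0; have [snu _ _] := nu_std.
have mfN : measurable_fun setT (fun t : R => f (- t)%R).
  by apply: (measurableT_comp mf); exact: oppr_measurable.
rewrite intD; [|by []|by []|by []|by []].
rewrite (snu (fun t => (f t)%:E)); [|exact/measurable_EFinP|by move=> x; rewrite lee_fin].
have -> : (2%:E = 1 + 1 :> \bar R)%E by rewrite -EFinD.
by rewrite ge0_muleDl ?mul1e ?lee01.
Qed.

(** Symmetry reduces the integral to the even part of [f]. The coefficients [al] and [be] may be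
    negative, so their negative parts are moved to the left to keep every integrand nonnegative. *)
Lemma std_upper (f : R -> R) (al be ga : R) : measurable_fun setT f ->
  (forall t, (0 <= f t)%R) -> (0 <= ga)%R ->
  (forall t, f t + f (- t) <= 2 * (al + be * t ^+ 2 + ga * t ^+ 4))%R ->
  \int[nu]_t (f t)%:E <= (al + be + ga * M)%:E.
Proof.
move=> mf f0 ga0 fh.
pose pos (x : R) := ((`|x| + x) / 2)%R; pose neg (x : R) := ((`|x| - x) / 2)%R.
have pn x : (x = pos x - neg x)%R.
  by rewrite /pos /neg; field.
have pos0 x : (0 <= pos x)%R.
  by rewrite divr_ge0//; have := ler_norm (- x)%R; rewrite normrN; lra.
have neg0 x : (0 <= neg x)%R by rewrite divr_ge0// subr_ge0 ler_norm.
clearbody pos neg.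
have mfN : measurable_fun setT (fun t : R => f (- t)%R).
  by apply: (measurableT_comp mf); exact: oppr_measurable.
have p2 (t : R) : (0 <= t ^+ 2)%R by exact: sqr_ge0.
have p4 (t : R) : (0 <= t ^+ 4)%R by exact: exprn_even_ge0.
have [_ m2 m4] := nu_std.
have : \int[nu]_t ((f t + f (- t)) + (2 * neg al + 2 * neg be * t ^+ 2))%:E <=
    (2 * pos al + 2 * pos be + 2 * ga * M)%:E.
  apply: le_trans (std_poly (2 * pos al) (2 * pos be) (2 * ga) _ _ _); last 3 first.
  - by rewrite mulr_ge0.
  - by rewrite mulr_ge0.
  - by rewrite mulr_ge0.
  apply: le_int => [||t|t].
  - by meas.
  - by meas.
  - by nonneg.
  by have := fh t; rewrite {1}(pn al) {1}(pn be); lra.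
rewrite intD; [|by meas|by meas|by move=> t; nonneg|by move=> t; nonneg].
rewrite std_symmetrize// intD; [|by meas|by meas|by move=> t; nonneg|by move=> t; nonneg].
rewrite int_cst intZ; [|by meas|by nonneg|by []].
rewrite m2 mule1.
have i0 : 0 <= \int[nu]_t (f t)%:E by exact: int_ge0.
move: i0; case: (\int[nu]_t (f t)%:E) => [a| |] //.
  move=> _; rewrite -EFinM -!EFinD !lee_fin => h.
  by rewrite (pn al) (pn be); lra.
by move=> _; rewrite gt0_muley ?lte_fin.
Qed.

Lemma std_lower (f : R -> R) (al be ga : R) : measurable_fun setT f ->
  (forall t, (0 <= f t)%R) -> (0 <= ga)%R ->
  (forall t, 2 * (al + be * t ^+ 2 - ga * t ^+ 4) <= f t + f (- t))%R ->
  (al + be - ga * M)%:E <= \int[nu]_t (f t)%:E.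
Proof.
move=> mf f0 ga0 fh.
pose pos (x : R) := ((`|x| + x) / 2)%R; pose neg (x : R) := ((`|x| - x) / 2)%R.
have pn x : (x = pos x - neg x)%R.
  by rewrite /pos /neg; field.
have pos0 x : (0 <= pos x)%R.
  by rewrite divr_ge0//; have := ler_norm (- x)%R; rewrite normrN; lra.
have neg0 x : (0 <= neg x)%R by rewrite divr_ge0// subr_ge0 ler_norm.
clearbody pos neg.
have mfN : measurable_fun setT (fun t : R => f (- t)%R).
  by apply: (measurableT_comp mf); exact: oppr_measurable.
have p2 (t : R) : (0 <= t ^+ 2)%R by exact: sqr_ge0.
have p4 (t : R) : (0 <= t ^+ 4)%R by exact: exprn_even_ge0.
have [_ m2 m4] := nu_std.
have : (2 * pos al + 2 * pos be)%:E <=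
   \int[nu]_t ((f t + f (- t)) + (2 * neg al + 2 * neg be * t ^+ 2 + 2 * ga * t ^+ 4))%:E.
  have <- : \int[nu]_t (2 * pos al + 2 * pos be * t ^+ 2)%:E = (2 * pos al + 2 * pos be)%:E.
    rewrite intD; [|by meas|by meas|by move=> t; nonneg|by move=> t; nonneg].
    rewrite int_cst intZ; [|by meas|by nonneg|by []].
    by rewrite m2 mule1.
  apply: le_int => [||t|t].
  - by meas.
  - by meas.
  - by nonneg.
  by have := fh t; rewrite {1}(pn al) {1}(pn be); lra.
rewrite intD; [|by meas|by meas|by move=> t; nonneg|by move=> t; nonneg].
rewrite std_symmetrize//.
have hp : \int[nu]_t (2 * neg al + 2 * neg be * t ^+ 2 + 2 * ga * t ^+ 4)%:E <=
    (2 * neg al + 2 * neg be + 2 * ga * M)%:E.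
  by apply: std_poly; nonneg.
move=> h; have := le_trans h (leeD2l _ hp).
have i0 : 0 <= \int[nu]_t (f t)%:E by exact: int_ge0.
move: i0; case: (\int[nu]_t (f t)%:E) => [a| |] //; last by move=> *; exact: leey.
move=> _; rewrite -EFinM -!EFinD !lee_fin.
by rewrite [in X in _ -> X](pn al) [in X in _ -> X](pn be); lra.
Qed.

End StandardLaws.

(** * Weighted sums and Lindeberg replacement *)

Section WeightedSums.
Context {R : realType} {I : eqType}.
Local Open Scope ereal_scope.

Definition wsum (x : I -> R) (l : seq I) (u : env I R) : R := \sum_(j <- l) x j * u j.

Lemma measurable_wsum x l : measurable_fun setT (wsum x l).
Proof. by apply: measurable_sum => j; apply: measurable_funM => //; exact: measurable_coord. Qed.

Lemma wsum_cons_update x i l (c' c : env I R) t : i \notin l ->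
  (forall j, j \notin l -> c' j = update c i t j) ->
  wsum x (i :: l) c' = (x i * t + wsum x l c')%R.
Proof. by move=> il /(_ i il); rewrite /wsum big_cons /update eqxx => ->. Qed.

Lemma itintD (nu : I -> probability R R) l (f g : env I R -> \bar R) c :
  measurable_fun setT f -> measurable_fun setT g ->
  (forall c, 0 <= f c) -> (forall c, 0 <= g c) ->
  itint nu l (fun c => f c + g c) c = itint nu l f c + itint nu l g c.
Proof.
move=> mf mg f0 g0; elim: l c => [|i l IH] c //=.
under eq_integral do rewrite IH.
have mi (h : env I R -> \bar R) : measurable_fun setT h -> (forall c, 0 <= h c) ->
    measurable_fun setT (fun t => itint nu l h (update c i t)).
  by move=> mh h0; apply: measurable_comp_update; apply: measurable_itint.
have i0 (h : env I R -> \bar R) t : (forall c, 0 <= h c) ->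
    0 <= itint nu l h (update c i t).
  by move=> h0; apply: itint_ge0.
exact: (ge0_integralD (nu i) measurableT (fun t _ => i0 f t f0) (mi f mf f0) (fun t _ => i0 g t g0) (mi g mg g0)).
Qed.

Lemma std_quadratic (nu : probability R R) M (K c b : R) : std_law nu M -> (0 <= K)%R ->
  \int[nu]_t (K + (c + b * t) ^+ 2)%:E = (K + c ^+ 2 + b ^+ 2)%:E.
Proof.
move=> snu K0.
have mf : measurable_fun setT (fun t => K + (c + b * t) ^+ 2)%R by meas.
have f0 (t : R) : (0 <= K + (c + b * t) ^+ 2)%R by nonneg.
apply/eqP; rewrite eq_le; apply/andP; split.
  have := std_upper nu M snu _ (K + c ^+ 2) (b ^+ 2) 0 mf f0 (lexx _).
  by rewrite mul0r addr0; apply => t; rewrite le_eqVlt; apply/orP; left; apply/eqP; ring.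
have := std_lower nu M snu _ (K + c ^+ 2) (b ^+ 2) 0 mf f0 (lexx _).
by rewrite mul0r subr0; apply => t; rewrite le_eqVlt; apply/orP; left; apply/eqP; ring.
Qed.

Lemma itint_quadratic (nu : probability R R) M x l (K c : R) u : std_law nu M ->
  uniq l -> (0 <= K)%R ->
  itint (fun=> nu) l (fun u => (K + (c + wsum x l u) ^+ 2)%:E) u =
  (K + c ^+ 2 + \sum_(j <- l) x j ^+ 2)%:E.
Proof.
move=> snu; elim: l c K u => [|i l IH] c K u /=.
  by rewrite /wsum !big_nil !addr0.
move=> /andP[il ul] K0.
transitivity (\int[nu]_t (K + \sum_(j <- l) x j ^+ 2 + (c + x i * t) ^+ 2)%:E).
  apply: eq_integral => t _.
  rewrite (eq_itint_on _ _ _ (fun u' => (K + (c + x i * t + wsum x l u') ^+ 2)%:E)); last first.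
    by move=> u' hu; rewrite (wsum_cons_update _ _ _ _ u t il hu) addrA.
  by rewrite IH//; congr (_%:E); ring.
rewrite (std_quadratic _ M)//; last by rewrite addr_ge0// sumr_ge0// => j _; exact: sqr_ge0.
by rewrite big_cons; congr (_%:E); ring.
Qed.

End WeightedSums.

Section Lindeberg.
Context {R : realType} {I : eqType} (nu1 nu2 : probability R R) (M : R).
Hypothesis s1 : std_law nu1 M.
Hypothesis s2 : std_law nu2 M.
Variables (H : R -> R) (A : R -> R -> R) (D : R).
Hypothesis mH : measurable_fun setT H.
Hypothesis H0 : forall s, 0 <= H s.
Hypothesis D0 : 0 <= D.
Local Open Scope ereal_scope.
Hypothesis up1 : forall c b : R, (`|b| <= 1)%R ->
  \int[nu1]_t (H (c + b * t))%:E <= (A c b + D * `|b| ^+ 3 * (1 + c ^+ 2))%:E.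
Hypothesis low2 : forall c b : R, (`|b| <= 1)%R ->
  (A c b - D * `|b| ^+ 3 * (1 + c ^+ 2))%:E <= \int[nu2]_t (H (c + b * t))%:E.

(** The expansion [A] is shared by both laws, so exchanging coordinate i costs 2 D |x_i|^3 (1 +
    r^2), where r is [c] plus the sum over the other coordinates. As this cost depends on r, it is
    averaged exactly through second moments, which produces the last factor of the error. *)
Lemma lindeberg (x : I -> R) (l : seq I) (c : R) u : uniq l ->
  (forall j, `|x j| <= 1)%R ->
  itint (fun=> nu1) l (fun u => (H (c + wsum x l u))%:E) u <=
  itint (fun=> nu2) l (fun u => (H (c + wsum x l u))%:E) u +
  (2 * D * (\sum_(j <- l) `|x j| ^+ 3) * (1 + c ^+ 2 + \sum_(j <- l) x j ^+ 2))%:E.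
Proof.
move=> + x1; elim: l c u => [|i l IH] c u /=.
  by move=> _; rewrite /wsum !big_nil mulr0 mul0r adde0.
move=> /andP[il ul].
set W := (\sum_(j <- l) x j ^+ 2)%R; set S3 := (\sum_(j <- l) `|x j| ^+ 3)%R.
have W0 : (0 <= W)%R by apply: sumr_ge0 => j _; exact: sqr_ge0.
have S30 : (0 <= S3)%R by apply: sumr_ge0 => j _; exact: exprn_ge0.
have mHc l' (c' : R) : measurable_fun setT (fun u : env I R => H (c' + wsum x l' u)).
  by apply: (measurableT_comp mH); apply: measurable_funD => //; exact: measurable_wsum.
have mHcE l' (c' : R) : measurable_fun setT (fun u : env I R => (H (c' + wsum x l' u))%:E).
  exact/measurable_EFinP.
have mHb (c' b : R) : measurable_fun setT (fun t : R => H (c' + b * t)).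
  by apply: (measurableT_comp mH); meas.
pose f (t : R) (u : env I R) := (H (c + x i * t + wsum x l u))%:E.
have mf : measurable_fun setT (fun p : R * env I R => f p.1 p.2).
  apply/measurable_EFinP; apply: (measurableT_comp mH).
  apply: measurable_funD; first by meas.
  exact: (measurableT_comp (measurable_wsum x l) measurable_snd).
have f0 t u' : 0 <= f t u' by rewrite lee_fin.
have split_itint (nu : probability R R) :
    \int[nu]_t itint (fun=> nu) l (fun u => (H (c + wsum x (i :: l) u))%:E) (update u i t) =
    \int[nu]_t itint (fun=> nu) l (f t) (update u i t).
  apply: eq_integral => t _; apply: eq_itint_on => u' hu.
  by rewrite /f (wsum_cons_update _ _ _ _ u t il hu) addrA.
(* The integrand of the tail does not read coordinate [i], so the update can be forgotten; the order
   of integration is then free. *)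
have drop (nu' nu : probability R R) :
    \int[nu']_t itint (fun=> nu) l (f t) (update u i t) = \int[nu']_t itint (fun=> nu) l (f t) u.
  apply: eq_integral => t _.
  have inv : forall (g : env I R -> \bar R) (l0 : seq I) (v v' : env I R),
     (forall w w' : env I R, (forall j, j != i -> w j = w' j) -> g w = g w') ->
     (forall j, j != i -> v j = v' j) -> itint (fun=> nu) l0 g v = itint (fun=> nu) l0 g v'.
    move=> g; elim=> [|k l0 IH0] v v' hg hv /=; first exact: hg.
    apply: eq_integral => s _; apply: IH0 => // j ji; rewrite /update.
    by case: (j == k) => //; exact: hv.
  apply: inv; last by move=> j ji; rewrite /update (negbTE ji).
  move=> w w' ww; rewrite /f /wsum; congr ((H (_ + _))%:E).
  apply: eq_big_seq => j jl; rewrite ww//.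
  by apply: contraNneq il => <-.
rewrite !split_itint !drop.
have mit (nu : probability R R) : measurable_fun setT (fun t => itint (fun=> nu) l (f t) u).
  have := measurable_itint_param _ _ (fun=> nu) l f mf f0.
  by move=> h; apply: (measurableT_comp h (measurable_pair2 u)).
pose q (t : R) := (2 * D * S3 * (1 + W + (c + x i * t) ^+ 2))%R.
have q0 t : (0 <= q t)%R by rewrite /q; nonneg.
have mq : measurable_fun setT q by rewrite /q; meas.
pose e := (2 * (D * `|x i| ^+ 3))%R.
have e0 : (0 <= e)%R by rewrite /e; nonneg.
apply: (@le_trans _ _ (\int[nu1]_t (itint (fun=> nu2) l (f t) u + (q t)%:E))).
  apply: ge0_le_integral; first exact: measurableT.
  - by move=> t _; exact: itint_ge0.
  - exact: mit.
  - by apply: emeasurable_funD; [exact: mit|exact/measurable_EFinP].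
  move=> t _; apply: le_trans (IH (c + x i * t)%R u ul) _.
  rewrite leeD2l// lee_fin /q -/W -/S3.
  by rewrite le_eqVlt; apply/orP; left; apply/eqP; ring.
have mqE : measurable_fun setT (fun t => (q t)%:E) by exact/measurable_EFinP.
have i0 t : 0 <= itint (fun=> nu2) l (f t) u by exact: itint_ge0.
have q0E t : 0 <= (q t)%:E by rewrite lee_fin.
rewrite (ge0_integralD nu1 measurableT (fun t _ => i0 t) (mit nu2) (fun t _ => q0E t) mqE).
have -> : \int[nu1]_t (q t)%:E = (2 * D * S3 * (1 + W + c ^+ 2 + x i ^+ 2))%:E.
  rewrite /q intZ; [|by meas|by nonneg|by move=> t; nonneg].
  by rewrite (std_quadratic _ M)// ?addr_ge0.
rewrite !integral_itint//.
pose k (u' : env I R) := (e * (1 + (c + wsum x l u') ^+ 2))%R.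
have k0 u' : (0 <= k u')%R by rewrite /k; nonneg.
have mk : measurable_fun setT k.
  apply: measurable_funM => //; apply: measurable_funD => //; apply: measurable_funX.
  by apply: measurable_funD => //; exact: measurable_wsum.
have fE (nu : probability R R) u' : \int[nu]_t f t u' = \int[nu]_t (H ((c + wsum x l u') + x i * t))%:E.
  by apply: eq_integral => t _; rewrite /f; congr ((H _)%:E); ring.
have mg (nu : probability R R) : measurable_fun setT (fun u' => \int[nu]_t f t u').
  exact: (@measurable_fun_fubini_tonelli_G _ _ R (env I R) R nu (fun p => f p.1 p.2)).
have g0 (nu : probability R R) u' : 0 <= \int[nu]_t f t u'.
  by apply: integral_ge0 => t _; exact: f0.
have step u' : \int[nu1]_t f t u' <= \int[nu2]_t f t u' + (k u')%:E.
  rewrite !fE; set cc := (c + wsum x l u')%R.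
  have h1 := up1 cc (x i) (x1 i); have h2 := low2 cc (x i) (x1 i).
  apply: le_trans h1 _; apply: le_trans (leeD2r _ h2).
  by rewrite -EFinD lee_fin /k -/cc /e; lra.
have -> : (2 * D * (\sum_(j <- i :: l) `|x j| ^+ 3) * (1 + c ^+ 2 + \sum_(j <- i :: l) x j ^+ 2) =
   (e * (1 + c ^+ 2 + W)) + 2 * D * S3 * (1 + W + c ^+ 2 + x i ^+ 2) + e * x i ^+ 2)%R.
  by rewrite !big_cons -/W -/S3 /e; ring.
apply: (@le_trans _ _ ((itint (fun=> nu2) l (fun u' => \int[nu2]_t f t u') u +
   (e * (1 + c ^+ 2 + W))%:E) + (2 * D * S3 * (1 + W + c ^+ 2 + x i ^+ 2))%:E)); last first.
  rewrite -addeA -EFinD leeD2l// lee_fin lerDl.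
  by nonneg.
apply: leeD2r.
have mkE : measurable_fun setT (fun u' => (k u')%:E) by exact/measurable_EFinP.
have k0E u' : 0 <= (k u')%:E by rewrite lee_fin.
apply: (@le_trans _ _ (itint (fun=> nu2) l (fun u' => \int[nu2]_t f t u' + (k u')%:E) u)).
  by apply: le_itint => //; exact: emeasurable_funD.
rewrite itintD// leeD2l// /k itintZ//; last 2 first.
- apply: measurable_funD => //; apply: measurable_funX.
  by apply: measurable_funD => //; exact: measurable_wsum.
- by move=> u'; nonneg.
by rewrite (itint_quadratic _ M)// -EFinM.
Qed.

End Lindeberg.

Section GaussSums.
Context {R : realType}.
Local Notation gauss := (@gauss R).
Local Open Scope ereal_scope.

Lemma integral_gauss_add (h : R -> \bar R) (a b : R) :
  measurable_fun setT h -> (forall s, 0 <= h s) -> (0 <= a)%R ->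
  \int[gauss]_s \int[gauss]_t h (a * s + b * t)%R =
  \int[gauss]_s h (Num.sqrt (a ^+ 2 + b ^+ 2) * s)%R.
Proof.
move=> mh h0; rewrite le_eqVlt => /predU1P[<-|a0].
  (* For a = 0, outside the range of the rotation lemma, symmetry of the Gaussian law takes care of
     the sign of b. *)
  transitivity (\int[gauss]_s \int[gauss]_t h (b * t)%R).
    by apply: eq_integral => s _; apply: eq_integral => t _; rewrite mul0r add0r.
  rewrite (integral_probability_cst gauss) expr0n/= add0r sqrtr_sqr.
  case: (ger0P b) => // b0.
  rewrite -[RHS](gauss_sym (fun s => h (- b * s)%R)).
  - by apply: eq_integral => s _; rewrite mulrNN.
  - by apply: (measurableT_comp mh); meas.
  - by move=> s; exact: h0.
pose r := Num.sqrt (a ^+ 2 + b ^+ 2).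
have r0 : (0 < r)%R by rewrite sqrtr_gt0 ltr_wpDr ?sqr_ge0// exprn_gt0.
have rn0 : r != 0%R by rewrite gt_eqF.
have r2 : (r ^+ 2 = a ^+ 2 + b ^+ 2)%R by rewrite sqr_sqrtr// addr_ge0 ?sqr_ge0.
pose f (p : R * R) := h (r * p.1)%R.
have mf : measurable_fun setT f by apply: (measurableT_comp mh); meas.
have ar : (0 < a / r)%R by rewrite divr_gt0.
have abr : ((a / r) ^+ 2 + (b / r) ^+ 2 = 1)%R.
  by rewrite !expr_div_n -mulrDl -r2 divff// expf_neq0.
transitivity (\int[gauss]_s \int[gauss]_t f (s, t)).
  rewrite -(gauss_rotation f (a / r) (b / r) mf (fun=> h0 _) ar abr).
  apply: eq_integral => s _; apply: eq_integral => t _; rewrite /f /=; congr h.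
  by field.
apply: eq_integral => s _. rewrite /f /=; exact: (integral_probability_cst gauss).
Qed.

Lemma itint_gauss_wsum {I : eqType} (x : I -> R) (H : R -> R) (l : seq I) (c : R) u :
  measurable_fun setT H -> (forall s, (0 <= H s)%R) -> uniq l ->
  itint (fun=> gauss) l (fun u => (H (c + wsum x l u))%:E) u =
  \int[gauss]_s (H (c + Num.sqrt (\sum_(j <- l) x j ^+ 2) * s))%:E.
Proof.
move=> mH H0; elim: l c u => [|i l IH] c u /=.
  move=> _; rewrite /wsum !big_nil sqrtr0.
  by under eq_integral do rewrite mul0r; rewrite int_cst.
move=> /andP[il ul]; set W := (\sum_(j <- l) x j ^+ 2)%R.
have W0 : (0 <= W)%R by apply: sumr_ge0 => j _; exact: sqr_ge0.
transitivity (\int[gauss]_t \int[gauss]_s (H (c + x i * t + Num.sqrt W * s))%:E).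
  apply: eq_integral => t _.
  rewrite (eq_itint_on _ _ _ (fun u' => (H (c + x i * t + wsum x l u'))%:E)); last first.
    by move=> u' hu; rewrite (wsum_cons_update _ _ _ _ u t il hu) addrA.
  exact: IH.
pose k (p : R * R) := (H (c + x i * p.1 + Num.sqrt W * p.2))%:E.
have mk : measurable_fun setT k.
  by apply/measurable_EFinP; apply: (measurableT_comp mH); meas.
have k0 p : 0 <= k p by rewrite lee_fin.
rewrite (@fubini_tonelli _ _ R R R gauss gauss k mk k0) /k /=.
have mh : measurable_fun setT (fun s : R => (H (c + s))%:E).
  by apply/measurable_EFinP; apply: (measurableT_comp mH); meas.
have h0 (s : R) : 0 <= (H (c + s))%:E by rewrite lee_fin.
have := integral_gauss_add (fun s => (H (c + s))%:E) (Num.sqrt W) (x i) mh h0 (sqrtr_ge0 _).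
rewrite sqr_sqrtr// big_cons -/W [(x i ^+ 2 + W)%R]addrC => <-.
by apply: eq_integral => s _; apply: eq_integral => t _; congr ((H _)%:E); ring.
Qed.

End GaussSums.

(** * Second-order expansion of the link functional *)

Section Link.
Context {R : realType} (theta : R -> R) (tau3 : R).
Hypothesis th1 : forall t, -1 <= theta t <= 1.
Hypothesis thC3 : C3 theta.
Hypothesis tau3P : forall t, `|derive1n 3 theta t| <= tau3.

Lemma derivable_measurable (f : R -> R) : (forall t : R, derivable f t 1) -> measurable_fun setT f.
Proof.
move=> df; apply: continuous_measurable_fun => t.
by apply: differentiable_continuous; apply/derivable1_diffP.
Qed.

Lemma measurable_theta : measurable_fun setT theta.
Proof. by apply: derivable_measurable; case: thC3. Qed.

Lemma measurable_theta1 : measurable_fun setT (derive1n 1 theta).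
Proof. by apply: derivable_measurable; case: thC3 => _ []. Qed.

Lemma tau3_ge0 : 0 <= tau3.
Proof. exact: le_trans (normr_ge0 _) (tau3P 0). Qed.

Lemma theta_mul_ge (s : R) (c : R) : `|c| <= 1 -> 0 <= c * s + 1 + s ^+ 2.
Proof.
move=> c1; have h : 0 <= (s + c / 2) ^+ 2 by exact: sqr_ge0.
have c2 : c ^+ 2 <= 1 by rewrite -real_normK ?num_real// expr_le1.
by lra.
Qed.

Lemma theta_norm t : `|theta t| <= 1.
Proof. by rewrite ler_norml. Qed.

(* The summand 1 + s^2 makes the test function nonnegative and is expanded
   exactly, so it does not contribute to the error. *)
Definition linkH (s : R) : R := theta s * s + 1 + s ^+ 2.

Lemma linkH_ge0 s : 0 <= linkH s.
Proof. by apply: theta_mul_ge; exact: theta_norm. Qed.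

Lemma measurable_linkH : measurable_fun setT linkH.
Proof.
apply: measurable_funD; last by meas.
apply: measurable_funD => //; apply: measurable_funM => //; exact: measurable_theta.
Qed.

(** This is H(c) + b^2 H''(c) / 2 for H = [linkH]: the mean of the second-order Taylor polynomial
    under any symmetric law of unit variance. *)
Definition linkA (c b : R) : R :=
  linkH c + b ^+ 2 * (c * derive1n 2 theta c / 2 + derive1n 1 theta c + 1).

(** Taylor's formula is applied to theta alone, with remainders r1 and r2 at c + u and c - u. After
    symmetrization the error is exactly c (r1 + r2) + u (r1 - r2), at most (|c| + |u|) tau3 |u|^3 /
    3. *)
Lemma linkH_sym (c b t : R) : `|b| <= 1 ->
  `|linkH (c + b * t) + linkH (c - b * t) -
    2 * (linkH c + b ^+ 2 * t ^+ 2 * (c * derive1n 2 theta c / 2 + derive1n 1 theta c + 1))| <=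
  2 * (tau3 * `|b| ^+ 3 * ((1 + c ^+ 2) * (t ^+ 2 + t ^+ 4) / 24 + t ^+ 4 / 6)).
Proof.
move=> b1; set u := b * t.
have [_ h1] := taylor_C3 theta tau3 c u thC3 tau3P.
have [_ h2] := taylor_C3 theta tau3 c (- u) thC3 tau3P.
move: h1 h2; rewrite sqrrN normrN.
set t1 := derive1n 1 theta c; set t2 := derive1n 2 theta c.
set r1 := theta (c + u) - _ - _ - _; set r2 := theta (c - u) - _ - _ - _ => h1 h2.
have e1 : theta (c + u) = theta c + t1 * u + t2 / 2 * u ^+ 2 + r1 by rewrite /r1; ring.
have e2 : theta (c - u) = theta c + t1 * - u + t2 / 2 * u ^+ 2 + r2 by rewrite /r2; ring.
rewrite /linkH e1 e2.
rewrite [X in `|X|](_ : _ = c * (r1 + r2) + u * (r1 - r2)); last first.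
  by rewrite /u; field.
have U0 := normr_ge0 u; have B0 := normr_ge0 b; have T0 := normr_ge0 t.
have UE : `|u| = `|b| * `|t| by rewrite normrM.
set B := `|b| in b1 B0 UE *; set T := `|t| in T0 UE.
have T2 : t ^+ 2 = T ^+ 2 by rewrite real_normK// num_real.
have T4 : t ^+ 4 = T ^+ 4 by rewrite (exprM t 2 2) T2 -exprM.
have c2 : c ^+ 2 = `|c| ^+ 2 by rewrite real_normK// num_real.
apply: (@le_trans _ _ ((`|c| + `|u|) * (tau3 / 3 * `|u| ^+ 3))).
  apply: le_trans (ler_normD _ _) _; rewrite (normrM c) (normrM u) mulrDl.
  apply: lerD; apply: ler_wpM2l => //.
    by apply: le_trans (ler_normD _ _) _; lra.
  by apply: le_trans (ler_normB _ _) _; lra.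
rewrite T2 T4 c2 UE; set C := `|c|; have C0 : 0 <= C by exact: normr_ge0.
have t30 := tau3_ge0.
have B3 : 0 <= B ^+ 3 by exact: exprn_ge0.
have T4' : 0 <= T ^+ 4 by exact: exprn_ge0.
(* The odd power T^3 is traded for T^2 and T^4, whose moments are controlled. *)
have k1 : C * T ^+ 3 <= (1 + C ^+ 2) * (T ^+ 2 + T ^+ 4) / 4.
  have a1 : 2 * C <= 1 + C ^+ 2 by have := sqr_ge0 (C - 1); lra.
  have a2 : 2 * T ^+ 3 <= T ^+ 2 + T ^+ 4.
    have := mulr_ge0 (sqr_ge0 T) (sqr_ge0 (T - 1)); lra.
  have T30 : 0 <= T ^+ 3 by exact: exprn_ge0.
  have := ler_pM (mulr_ge0 (ler0n R 2) C0) (mulr_ge0 (ler0n R 2) T30) a1 a2.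
  by lra.
have k2 : B * T * T ^+ 3 <= T ^+ 4.
  rewrite -mulrA -exprS; exact: ler_piMl.
have -> : (C + B * T) * (tau3 / 3 * (B * T) ^+ 3) =
  tau3 * B ^+ 3 / 3 * (C * T ^+ 3 + B * T * T ^+ 3) by rewrite exprMn; field.
have -> : 2 * (tau3 * B ^+ 3 * ((1 + C ^+ 2) * (T ^+ 2 + T ^+ 4) / 24 + T ^+ 4 / 6)) =
  tau3 * B ^+ 3 / 3 * ((1 + C ^+ 2) * (T ^+ 2 + T ^+ 4) / 4 + T ^+ 4) by field.
by apply: ler_wpM2l; [nonneg|exact: lerD].
Qed.

Section Expand.
Variables (nu : probability R R) (M : R).
Hypothesis snu : std_law nu M.
Hypothesis M1 : 1 <= M.
Let D := tau3 * (1 + M) / 4.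

Let mf (c b : R) : measurable_fun setT (fun t : R => linkH (c + b * t)).
Proof. by apply: (measurableT_comp measurable_linkH); meas. Qed.

Let arith (c b : R) : tau3 * `|b| ^+ 3 * ((1 + c ^+ 2) / 24) +
    tau3 * `|b| ^+ 3 * ((1 + c ^+ 2) / 24 + 6^-1) * M <= D * `|b| ^+ 3 * (1 + c ^+ 2).
Proof.
rewrite /D.
have X0 : 0 <= tau3 * `|b| ^+ 3 by have t30 := tau3_ge0; nonneg.
set X := tau3 * _ in X0 *.
have -> : tau3 * (1 + M) / 4 * `|b| ^+ 3 * (1 + c ^+ 2) = X * ((1 + M) / 4 * (1 + c ^+ 2)).
  by rewrite /X; ring.
rewrite -mulrA -mulrDr; apply: ler_wpM2l => //.
have c0 : 0 <= c ^+ 2 by exact: sqr_ge0.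
have Mc0 : 0 <= M * c ^+ 2 by apply: mulr_ge0 => //; apply: le_trans M1.
have -> : (1 + c ^+ 2) / 24 + ((1 + c ^+ 2) / 24 + 6^-1) * M = (1 + M + c ^+ 2 + M * c ^+ 2) / 24 + M / 6 by field.
have -> : (1 + M) / 4 * (1 + c ^+ 2) = (1 + M + c ^+ 2 + M * c ^+ 2) / 4 by field.
by move: M1; lra.
Qed.

Let ga_ge0 (c b : R) : 0 <= tau3 * `|b| ^+ 3 * ((1 + c ^+ 2) / 24 + 6^-1).
Proof. by have t30 := tau3_ge0; nonneg; rewrite invr_ge0. Qed.

Lemma link_upper (c b : R) : `|b| <= 1 ->
  (\int[nu]_t (linkH (c + b * t))%:E <= (linkA c b + D * `|b| ^+ 3 * (1 + c ^+ 2))%:E)%E.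
Proof.
move=> b1; pose be := b ^+ 2 * (c * derive1n 2 theta c / 2 + derive1n 1 theta c + 1)
  + tau3 * `|b| ^+ 3 * ((1 + c ^+ 2) / 24).
pose ga := tau3 * `|b| ^+ 3 * ((1 + c ^+ 2) / 24 + 6^-1).
apply: le_trans (std_upper nu M snu _ (linkH c) be ga (mf c b) (fun=> linkH_ge0 _) (ga_ge0 c b) _) _.
  move=> t; have := linkH_sym c b t b1; rewrite mulrN => /(le_trans (ler_norm _)).
  by rewrite /be /ga; lra.
by rewrite lee_fin /linkA /be; have := arith c b; rewrite -/ga; lra.
Qed.

Lemma link_lower (c b : R) : `|b| <= 1 ->
  ((linkA c b - D * `|b| ^+ 3 * (1 + c ^+ 2))%:E <= \int[nu]_t (linkH (c + b * t))%:E)%E.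
Proof.
move=> b1; pose be := b ^+ 2 * (c * derive1n 2 theta c / 2 + derive1n 1 theta c + 1)
  - tau3 * `|b| ^+ 3 * ((1 + c ^+ 2) / 24).
pose ga := tau3 * `|b| ^+ 3 * ((1 + c ^+ 2) / 24 + 6^-1).
apply: le_trans (std_lower nu M snu _ (linkH c) be ga (mf c b) (fun=> linkH_ge0 _) (ga_ge0 c b) _).
  by rewrite lee_fin /linkA /be; have := arith c b; rewrite -/ga; lra.
move=> t; have := linkH_sym c b t b1; rewrite mulrN -normrN => /(le_trans (ler_norm _)).
by rewrite /be /ga; lra.
Qed.

End Expand.

(** The replacement inequality is one-sided, so it is run twice with the laws exchanged. As the
    weights have unit norm, the Gaussian sum is again standard, and the constant is 2 times tau3 (1
    + M) / 4 times 2. *)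
Lemma link_law_gap {I : eqType} (mu : probability R R) (M : R) (x : I -> R) (l : seq I) u :
  std_law mu M -> 100 <= M -> uniq l -> (forall j, `|x j| <= 1) ->
  \sum_(j <- l) x j ^+ 2 = 1 ->
  let err := tau3 * (1 + M) * \sum_(j <- l) `|x j| ^+ 3 in
  (itint (fun=> mu) l (fun u => (linkH (wsum x l u))%:E) u <=
    \int[@gauss R]_s (linkH s)%:E + err%:E)%E /\
  (\int[@gauss R]_s (linkH s)%:E <=
    itint (fun=> mu) l (fun u => (linkH (wsum x l u))%:E) u + err%:E)%E.
Proof.
move=> smu M100 ul x1 x2 err.
have sg : std_law (@gauss R) M := gauss_std_law M M100.
have M1 : 1 <= M by lra.
have D0 : 0 <= tau3 * (1 + M) / 4.
  have t30 := tau3_ge0; have M0 : 0 <= M by lra.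
  by nonneg; rewrite invr_ge0.
have gE : itint (fun=> @gauss R) l (fun u => (linkH (0 + wsum x l u))%:E) u =
    (\int[@gauss R]_s (linkH s)%:E)%E.
  rewrite (itint_gauss_wsum x linkH l 0 u measurable_linkH linkH_ge0 ul) x2 sqrtr1.
  by apply: eq_integral => s _; rewrite mul1r add0r.
have mE : itint (fun=> mu) l (fun u => (linkH (0 + wsum x l u))%:E) u =
    itint (fun=> mu) l (fun u => (linkH (wsum x l u))%:E) u.
  by apply: eq_itint => v; rewrite add0r.
have eE : 2 * (tau3 * (1 + M) / 4) * (\sum_(j <- l) `|x j| ^+ 3) *
    (1 + 0 ^+ 2 + \sum_(j <- l) x j ^+ 2) = err.
  by rewrite x2 /err expr0n/=; field.
rewrite -gE -mE -eE; split.
- by apply: (lindeberg mu (@gauss R) M smu sg linkH linkA _ measurable_linkH linkH_ge0 D0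
    (link_upper mu M smu M1) (link_lower _ M sg M1)).
- by apply: (lindeberg (@gauss R) mu M sg smu linkH linkA _ measurable_linkH linkH_ge0 D0
    (link_upper _ M sg M1) (link_lower mu M smu M1)).
Qed.

End Link.

(** * The mean of a signed row *)

Section Means.
Context {R : realType} {d : measure_display} {T : measurableType d} (P : probability T R).

Definition intg (f : T -> R) : Prop := P.-integrable setT (EFin \o f).
Definition mean (f : T -> R) : R := fine (\int[P]_w (f w)%:E)%E.

Lemma meanE (f : T -> R) : intg f -> (\int[P]_w (f w)%:E = (mean f)%:E)%E.
Proof. by move=> jf; rewrite fineK//; exact: integrable_fin_num jf. Qed.

Lemma intg_cst (r : R) : intg (fun=> r).
Proof.
by apply/integrableP; split; [exact: measurable_cst|rewrite /= int_cst ltry].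
Qed.

Lemma intg_nneg (f : T -> R) : measurable_fun setT f -> (forall w, 0 <= f w) ->
  (\int[P]_w (f w)%:E < +oo)%E -> intg f.
Proof.
move=> mf f0 fy; apply/integrableP; split; first exact/measurable_EFinP.
by under eq_integral do rewrite /= ger0_norm//.
Qed.

Lemma intg_dom (f g : T -> R) : measurable_fun setT f -> (forall w, `|f w| <= g w) -> intg g -> intg f.
Proof.
move=> mf fg jg; apply: le_integrable jg => //; first exact/measurable_EFinP.
by move=> w _ /=; rewrite lee_fin (le_trans (fg w))// ler_norm.
Qed.

Lemma intgD (f g : T -> R) : intg f -> intg g -> intg (fun w => f w + g w).
Proof. by move=> jf jg; exact: (integrableD measurableT jf jg). Qed.

Lemma intgZ (k : R) (f : T -> R) : intg f -> intg (fun w => k * f w).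
Proof. by move=> jf; exact: (integrableZl measurableT k jf). Qed.

Lemma intgB (f g : T -> R) : intg f -> intg g -> intg (fun w => f w - g w).
Proof. by move=> jf jg; exact: (integrableB measurableT jf jg). Qed.

Lemma intg_sum (I : Type) (s : seq I) (f : I -> T -> R) :
  (forall i, intg (f i)) -> intg (fun w => \sum_(i <- s) f i w).
Proof.
move=> jf; elim: s => [|i s IH]; first by under eq_fun do rewrite big_nil; exact: intg_cst.
by under eq_fun do rewrite big_cons; exact: intgD.
Qed.

Lemma mean_cst (r : R) : mean (fun=> r) = r.
Proof. by rewrite /mean int_cst. Qed.

Lemma meanD (f g : T -> R) : intg f -> intg g -> mean (fun w => f w + g w) = mean f + mean g.
Proof. by move=> jf jg; exact: (RintegralD measurableT jf jg). Qed.

Lemma meanB (f g : T -> R) : intg f -> intg g -> mean (fun w => f w - g w) = mean f - mean g.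
Proof. by move=> jf jg; exact: (RintegralB measurableT jf jg). Qed.

Lemma meanZ (k : R) (f : T -> R) : intg f -> mean (fun w => k * f w) = k * mean f.
Proof. by move=> jf; exact: (RintegralZl k measurableT jf). Qed.

Lemma mean_sum (I : Type) (s : seq I) (f : I -> T -> R) : (forall i, intg (f i)) ->
  mean (fun w => \sum_(i <- s) f i w) = \sum_(i <- s) mean (f i).
Proof.
move=> jf; elim: s => [|i s IH].
  by rewrite big_nil -[RHS]mean_cst; congr mean; apply/funext => w; rewrite big_nil.
rewrite big_cons -IH -meanD//; last exact: intg_sum.
by congr mean; apply/funext => w; rewrite big_cons.
Qed.

End Means.

Section RowBias.
Context {R : realType} {I : finType} (theta : R -> R) (tau1 tau3 : R).
Hypothesis th1 : forall t, -1 <= theta t <= 1.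
Hypothesis thC3 : C3 theta.
Hypothesis tau1P : forall t, `|derive1n 1 theta t| <= tau1.
Hypothesis tau3P : forall t, `|derive1n 3 theta t| <= tau3.
Variables (mu : probability R R) (M : R) (x : I -> R).
Hypothesis smu : std_law mu M.
Local Notation S := (wsum x (index_enum I)).
Local Notation theta1 := (derive1n 1 theta).

Definition row_test (j : I) (a : env I R) : R := theta (S a) * a j + 1 + a j ^+ 2.

(* The mean of theta(<a,x>) a_j, written with the nonnegative [row_test] so
   that it is an iterated integral. *)
Definition row_mean (j : I) : R :=
  fine (itint (fun=> mu) (index_enum I) (fun a => (row_test j a)%:E) (fun=> 0)) - 2.

Let thn (t : R) : `|theta t| <= 1. Proof. by rewrite ler_norml. Qed.

Lemma row_test_ge0 j a : 0 <= row_test j a.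
Proof. by apply: theta_mul_ge; exact: thn. Qed.

Lemma measurable_thetaS : measurable_fun setT (fun a => theta (S a)).
Proof. by apply: (measurableT_comp (measurable_theta theta thC3)); exact: measurable_wsum. Qed.

Lemma measurable_theta1S : measurable_fun setT (fun a => theta1 (S a)).
Proof. by apply: (measurableT_comp (measurable_theta1 theta thC3)); exact: measurable_wsum. Qed.

Lemma measurable_row_test j : measurable_fun setT (row_test j).
Proof.
by have mt := measurable_thetaS; rewrite /row_test; meas.
Qed.

Section Row.
Context {d : measure_display} {T : measurableType d} {P : probability T R} (A : I -> T -> R).
Hypothesis mA : forall j, measurable_fun setT (A j).
Hypothesis iA : indep_law P A (fun=> mu).
Let arow (w : T) : env I R := fun j => A j w.

Let marow : measurable_fun setT arow.
Proof. exact: measurable_env. Qed.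

Lemma row_sqr j : (\int[P]_w (A j w ^+ 2)%:E = 1)%E.
Proof.
have [_ m2 _] := smu.
rewrite (indep_integral_update mA iA j (fun a : env I R => (a j ^+ 2)%:E)).
- under eq_integral do (under eq_integral do rewrite /update eqxx; rewrite m2).
  exact: integral_probability_cst.
- by apply/measurable_EFinP; meas.
- by move=> a; rewrite lee_fin sqr_ge0.
Qed.

Lemma intg_row_sqr j : intg P (fun w => A j w ^+ 2).
Proof.
apply: intg_nneg; first by have := mA j; meas.
- by move=> w; exact: sqr_ge0.
- by rewrite row_sqr ltry.
Qed.

Lemma mean_row_sqr j : mean P (fun w => A j w ^+ 2) = 1.
Proof. by rewrite /mean row_sqr. Qed.

Lemma norm_le_sqr (t : R) : `|t| <= 1 + t ^+ 2.
Proof. by rewrite ler_norml; have := sqr_ge0 (t - 1); have := sqr_ge0 (t + 1); lra. Qed.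

Lemma intg_signed_entry (s : T -> R) j : measurable_fun setT s ->
  (forall w, `|s w| <= 1) -> intg P (fun w => s w * A j w).
Proof.
move=> ms s1; apply: (@intg_dom _ _ _ P _ (fun w => 1 + A j w ^+ 2)).
- by have := mA j; meas.
- by move=> w; rewrite normrM (le_trans _ (norm_le_sqr _))// ler_piMl.
- by apply: intgD; [exact: intg_cst|exact: intg_row_sqr].
Qed.

Let mth : measurable_fun setT (fun w => theta (S (arow w))).
Proof. exact: (measurableT_comp measurable_thetaS). Qed.

Let intg_thA j : intg P (fun w => theta (S (arow w)) * A j w).
Proof. exact: intg_signed_entry. Qed.

Lemma row_testE j : (\int[P]_w (row_test j (arow w))%:E = (row_mean j + 2)%:E)%E.
Proof.
rewrite /row_mean subrK.
rewrite -(indep_integral mA iA (index_enum I) (fun a => (row_test j a)%:E)).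
- rewrite -meanE//; apply: intgD; last exact: intg_row_sqr.
  by apply: intgD; [exact: intg_thA|exact: intg_cst].
- by move=> i; rewrite mem_index_enum.
- by apply/measurable_EFinP; exact: measurable_row_test.
- by move=> a; rewrite lee_fin row_test_ge0.
Qed.

Lemma row_meanE j : mean P (fun w => theta (S (arow w)) * A j w) = row_mean j.
Proof.
have := row_testE j; rewrite meanE; last first.
  apply: intgD; last exact: intg_row_sqr.
  by apply: intgD; [exact: intg_thA|exact: intg_cst].
rewrite /row_test meanD; last exact: intg_row_sqr.
  rewrite meanD; [|exact: intg_thA|exact: intg_cst].
  by rewrite mean_cst mean_row_sqr => -[]; lra.
by apply: intgD; [exact: intg_thA|exact: intg_cst].
Qed.

Let slope := mean P (fun w => theta1 (S (arow w))).

Let intg_th1 : intg P (fun w => theta1 (S (arow w))).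
Proof.
apply: (@intg_dom _ _ _ P _ (fun=> tau1)); [|by move=> w; exact: tau1P|exact: intg_cst].
exact: (measurableT_comp measurable_theta1S).
Qed.

(* f(t) = theta(c + b t) t - b theta'(c + b t) vanishes in the mean for a
   Gaussian t (Stein); the remaining terms make it nonnegative. *)
Definition stein_test (c b t : R) : R :=
  theta (c + b * t) * t - b * theta1 (c + b * t) + 1 + t ^+ 2 + tau1 * `|b|.

Lemma stein_test_ge0 c b t : 0 <= stein_test c b t.
Proof.
have h1 := theta_mul_ge t _ (thn (c + b * t)).
have h2 : b * theta1 (c + b * t) <= tau1 * `|b|.
  apply: le_trans (ler_norm _) _; rewrite normrM mulrC.
  by apply: ler_wpM2r => //; exact: tau1P.
by rewrite /stein_test; lra.
Qed.

(** Beside the added terms, symmetrization leaves 2 b theta'(c) (t^2 - 1), which integrates to 0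
    under unit variance, and the Taylor remainders of theta and theta'. Stein's identity thus holds
    up to |b|^3 for every symmetric law of unit variance with a fourth moment. *)
Lemma stein_test_sym c b t :
  `|stein_test c b t + stein_test c b (- t) -
    2 * (1 + tau1 * `|b| - b * theta1 c + (1 + b * theta1 c) * t ^+ 2)| <=
  2 * (tau3 * `|b| ^+ 3 * (t ^+ 2 / 2 + t ^+ 4 / 6)).
Proof.
have [g1 h1] := taylor_C3 theta tau3 c (b * t) thC3 tau3P.
have [g2 h2] := taylor_C3 theta tau3 c (- (b * t)) thC3 tau3P.
move: g1 h1 g2 h2; rewrite sqrrN normrN /stein_test (mulrN b t).
set t1 := derive1n 1 theta c; set t2 := derive1n 2 theta c; set u := b * t.
set q1 := theta1 (c + u) - _ - _; set q2 := theta1 (c - u) - _ - _.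
set r1 := theta (c + u) - _ - _ - _; set r2 := theta (c - u) - _ - _ - _ => g1 h1 g2 h2.
have e1 : theta (c + u) = theta c + t1 * u + t2 / 2 * u ^+ 2 + r1 by rewrite /r1; ring.
have e2 : theta (c - u) = theta c + t1 * - u + t2 / 2 * u ^+ 2 + r2 by rewrite /r2; ring.
have e3 : theta1 (c + u) = t1 + t2 * u + q1 by rewrite /q1; ring.
have e4 : theta1 (c - u) = t1 + t2 * - u + q2 by rewrite /q2; ring.
rewrite e1 e2 e3 e4.
rewrite [X in `|X|](_ : _ = t * (r1 - r2) - b * (q1 + q2)); last by rewrite /u; ring.
clearbody q1 q2 r1 r2 t1 t2 => {e1 e2 e3 e4}.
apply: le_trans (ler_normB _ _) _; rewrite (normrM t) (normrM b).
have T2 : t ^+ 2 = `|t| ^+ 2 by rewrite real_normK// num_real.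
have T4 : t ^+ 4 = `|t| ^+ 4 by rewrite (exprM t 2 2) T2 -exprM.
have u2 : u ^+ 2 = `|u| ^+ 2 by rewrite real_normK// num_real.
have k1 : `|t| * `|r1 - r2| <= `|t| * (tau3 / 3 * `|u| ^+ 3).
  by apply: ler_wpM2l => //; apply: le_trans (ler_normB _ _) _; lra.
have k2 : `|b| * `|q1 + q2| <= `|b| * (tau3 * `|u| ^+ 2).
  by apply: ler_wpM2l => //; apply: le_trans (ler_normD _ _) _; rewrite -u2; lra.
apply: le_trans (lerD k1 k2) _.
by rewrite T2 T4 /u normrM le_eqVlt; apply/orP; left; apply/eqP; field.
Qed.

Lemma stein_test_integral c b :
  let B := tau3 * `|b| ^+ 3 * (2^-1 + M / 6) in
  ((2 + tau1 * `|b| - B)%:E <= \int[mu]_t (stein_test c b t)%:E)%E /\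
  (\int[mu]_t (stein_test c b t)%:E <= (2 + tau1 * `|b| + B)%:E)%E.
Proof.
move=> B.
have m : measurable_fun setT (stein_test c b).
  have mt : measurable_fun setT (fun t : R => theta (c + b * t)).
    by apply: (measurableT_comp (measurable_theta theta thC3)); meas.
  have mt1 : measurable_fun setT (fun t : R => theta1 (c + b * t)).
    by apply: (measurableT_comp (measurable_theta1 theta thC3)); meas.
  by rewrite /stein_test; meas.
pose X := tau3 * `|b| ^+ 3.
have X0 : 0 <= X by have t30 := tau3_ge0 theta tau3 tau3P; rewrite /X; nonneg.
have ga0 : 0 <= X / 6 by rewrite divr_ge0.
split.
- apply: le_trans (std_lower mu M smu (stein_test c b) (1 + tau1 * `|b| - b * theta1 c)
    (1 + b * theta1 c - X / 2) (X / 6) m (stein_test_ge0 c b) ga0 _).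
    by rewrite lee_fin /B -/X; lra.
  move=> t; have := stein_test_sym c b t; rewrite ler_norml -/X => /andP[+ _].
  by lra.
- apply: le_trans (std_upper mu M smu (stein_test c b) (1 + tau1 * `|b| - b * theta1 c)
    (1 + b * theta1 c + X / 2) (X / 6) m (stein_test_ge0 c b) ga0 _) _.
    move=> t; have := stein_test_sym c b t; rewrite ler_norml -/X => /andP[_ +].
    by lra.
  by rewrite lee_fin /B -/X; lra.
Qed.

(** Freeze the other coordinates: <a,x> = cc + x_j a_j, and the approximate Stein identity in a_j
    has an error bound that does not depend on cc. *)
Lemma coordinate_bias j :
  `|row_mean j - x j * slope| <= tau3 * `|x j| ^+ 3 * (2^-1 + M / 6).
Proof.
pose q (a : env I R) := theta (S a) * a j - x j * theta1 (S a) + 1 + a j ^+ 2 + tau1 * `|x j|.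
pose cc (a : env I R) := \sum_(i | i != j) x i * a i.
have SE a t : S (update a j t) = cc a + x j * t.
  rewrite /wsum (bigD1 j)//= /update eqxx addrC; congr (_ + _).
  by apply: eq_bigr => i /negbTE ->.
have qE a t : q (update a j t) = stein_test (cc a) (x j) t.
  by rewrite /q SE /update eqxx.
have updE (a : env I R) : update a j (a j) = a.
  by apply/funext => i; rewrite /update; case: eqP => // ->.
have q0 a : 0 <= q a by rewrite -(updE a) qE; exact: stein_test_ge0.
have mq : measurable_fun setT q.
  have m1 := measurable_thetaS; have m2 := measurable_theta1S.
  by rewrite /q; meas.
have i1 : intg P (fun w => theta (S (arow w)) * A j w - x j * theta1 (S (arow w))).
  by apply: intgB; [exact: intg_thA|exact: intgZ].
have i2 := intgD P _ _ i1 (intg_cst P 1).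
have i3 := intgD P _ _ i2 (intg_row_sqr j).
have i4 := intgD P _ _ i3 (intg_cst P (tau1 * `|x j|)).
have intq : (\int[P]_w (q (arow w))%:E = (row_mean j - x j * slope + 2 + tau1 * `|x j|)%:E)%E.
  rewrite /q /arow meanE//; congr (_%:E).
  rewrite (meanD P _ _ i3 (intg_cst P _)) (meanD P _ _ i2 (intg_row_sqr j)).
  rewrite (meanD P _ _ i1 (intg_cst P _)) (meanB P _ _ (intg_thA j) (intgZ P _ _ intg_th1)).
  by rewrite !mean_cst mean_row_sqr row_meanE (meanZ P _ _ intg_th1) /slope; ring.
have intqE : (\int[P]_w (q (arow w))%:E =
    \int[P]_w \int[mu]_t (stein_test (cc (arow w)) (x j) t)%:E)%E.
  rewrite (indep_integral_update mA iA j (fun a => (q a)%:E)).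
  - by apply: eq_integral => w _; apply: eq_integral => t _; rewrite -qE.
  - exact/measurable_EFinP.
  - by move=> a; rewrite lee_fin.
pose g w := (\int[mu]_t (stein_test (cc (arow w)) (x j) t)%:E)%E.
have mg : measurable_fun setT g.
  have mq' : measurable_fun setT (fun a => (q a)%:E) by exact/measurable_EFinP.
  have h := measurable_integral_update mu j _ mq' (fun a => q0 a).
  have -> : g = (fun a => \int[mu]_t (q (update a j t))%:E)%E \o arow.
    by apply/funext => w; apply: eq_integral => t _; rewrite -qE.
  exact: (measurableT_comp h marow).
have g0 w : (0 <= g w)%E by apply: int_ge0 => t; exact: stein_test_ge0.
pose B := tau3 * `|x j| ^+ 3 * (2^-1 + M / 6); rewrite -/B.
have hi : (\int[P]_w g w <= (2 + tau1 * `|x j| + B)%:E)%E.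
  rewrite -(integral_probability_cst P (2 + tau1 * `|x j| + B)%:E).
  apply: ge0_le_integral; first exact: measurableT.
  - by move=> w _; exact: g0.
  - exact: mg.
  - exact: measurable_cst.
  - by move=> w _; have [_] := stein_test_integral (cc (arow w)) (x j).
have lo : ((2 + tau1 * `|x j| - B)%:E <= \int[P]_w g w)%E.
  (* A negative lower bound is immediate for a nonnegative integrand; otherwise the constant itself
     is integrated. *)
  have [l0|/ltW l0] := leP 0 (2 + tau1 * `|x j| - B); last first.
    by apply: le_trans (integral_ge0 _ _) => [|w _]; rewrite ?lee_fin.
  rewrite -(integral_probability_cst P (2 + tau1 * `|x j| - B)%:E).
  apply: ge0_le_integral; first exact: measurableT.
  - by move=> w _; rewrite lee_fin.
  - exact: measurable_cst.
  - exact: mg.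
  - by move=> w _; have [] := stein_test_integral (cc (arow w)) (x j).
have gE : (\int[P]_w g w)%E = (row_mean j - x j * slope + 2 + tau1 * `|x j|)%:E.
  by rewrite -intq intqE.
move: lo hi; rewrite gE !lee_fin ler_norml => lo hi.
by apply/andP; split; lra.
Qed.

Lemma mean_linkH : \sum_j x j ^+ 2 = 1 ->
  (itint (fun=> mu) (index_enum I) (fun a => (linkH theta (S a))%:E) (fun=> 0%R) =
   (\sum_j x j * row_mean j + 2)%:E)%E.
Proof.
move=> x2.
have idx (i : I) : i \in index_enum I by rewrite mem_index_enum.
have mS2 : measurable_fun setT (fun a : env I R => (0 + (0 + S a) ^+ 2)%:E).
  by have mS := measurable_wsum x (index_enum I); apply/measurable_EFinP; meas.
have S20 (a : env I R) : (0 <= (0 + (0 + S a) ^+ 2)%:E)%E by rewrite lee_fin add0r sqr_ge0.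
have S2 : (\int[P]_w (S (arow w) ^+ 2)%:E = 1)%E.
  under eq_integral do rewrite -[X in X%:E]add0r -[X in X ^+ 2]add0r.
  rewrite (indep_integral mA iA (index_enum I) (fun a => (0 + (0 + S a) ^+ 2)%:E) (fun=> 0) idx mS2 S20).
  by rewrite (itint_quadratic mu M x _ 0 0 _ smu (index_enum_uniq _))// expr0n/= !add0r x2.
have jS2 : intg P (fun w => S (arow w) ^+ 2).
  apply: intg_nneg; [|by move=> w; exact: sqr_ge0|by rewrite S2 ltry].
  by have mS := measurableT_comp (measurable_wsum x (index_enum I)) marow; exact: measurable_funX.
have sE (w : T) : theta (S (arow w)) * S (arow w) =
    \sum_(j <- index_enum I) x j * (theta (S (arow w)) * A j w).
  by rewrite {2}/wsum mulr_sumr; apply: eq_bigr => j _; rewrite mulrCA.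
have jx j := intgZ P (x j) _ (intg_thA j).
have jt : intg P (fun w => theta (S (arow w)) * S (arow w)).
  by under eq_fun do rewrite sE; exact: intg_sum.
have mt : mean P (fun w => theta (S (arow w)) * S (arow w)) = \sum_j x j * row_mean j.
  under eq_fun do rewrite sE; rewrite (mean_sum P _ _ _ jx).
  by apply: eq_bigr => j _; rewrite (meanZ P _ _ (intg_thA j)) row_meanE.
rewrite -(indep_integral mA iA (index_enum I) (fun a => (linkH theta (S a))%:E) (fun=> 0) idx).
- have j1 := intgD P _ _ jt (intg_cst P 1).
  rewrite /linkH (meanE P _ (intgD P _ _ j1 jS2)) (meanD P _ _ j1 jS2).
  rewrite (meanD P _ _ jt (intg_cst P 1)) mt mean_cst /mean S2.
  by rewrite /= -addrA.
- apply/measurable_EFinP; apply: (measurableT_comp (measurable_linkH theta thC3)).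
  exact: measurable_wsum.
- by move=> a; rewrite lee_fin linkH_ge0.
Qed.

(** The vector v is close to slope times x. Tested on x this puts <v,x> close to the slope, while
    [link_law_gap] puts <v,x> close to lambda; hence the slope is close to lambda, and v can be
    tested on z. *)
Lemma link_bias (lambda : R) (z : I -> R) : 100 <= M -> \sum_j x j ^+ 2 = 1 ->
  (\int[@gauss R]_s (linkH theta s)%:E = (lambda + 2)%:E)%E ->
  (forall j, `|z j| <= 2) -> `|\sum_j x j * z j| <= 2 ->
  `|\sum_j row_mean j * z j - lambda * \sum_j x j * z j| <=
  4 * (tau3 * (1 + M) * \sum_j `|x j| ^+ 3).
Proof.
move=> M100 x2 lamE z2 xz2.
have x1 j : `|x j| <= 1.
  rewrite -(@expr_le1 _ 2)// real_normK ?num_real// -x2 (bigD1 j)//= lerDl.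
  by apply: sumr_ge0 => i _; exact: sqr_ge0.
have := link_law_gap theta tau3 th1 thC3 tau3P mu M x (index_enum I) (fun=> 0) smu
  M100 (index_enum_uniq _) x1 x2.
rewrite (mean_linkH x2) lamE; set S3 := \sum_j `|x j| ^+ 3.
set v := \sum_j x j * row_mean j; move=> /= []; rewrite -!EFinD !lee_fin => g1 g2.
have t30 := tau3_ge0 theta tau3 tau3P.
have S30 : 0 <= S3 by apply: sumr_ge0 => j _; exact: exprn_ge0.
pose B := tau3 * (2^-1 + M / 6) * S3.
have M60 : 0 <= 2^-1 + M / 6 by lra.
have dom (y : I -> R) (c : R) : (forall j, `|y j| <= c) ->
    `|\sum_j (row_mean j - x j * slope) * y j| <= c * B.
  move=> yc; apply: le_trans (ler_norm_sum _ _ _) _.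
  apply: (@le_trans _ _ (\sum_j tau3 * `|x j| ^+ 3 * (2^-1 + M / 6) * c)).
    apply: ler_sum => j _; rewrite normrM.
    by apply: ler_pM => //; exact: coordinate_bias.
  by rewrite -!mulr_suml -mulr_sumr -/S3 /B le_eqVlt; apply/orP; left; apply/eqP; ring.
have b1 : `|v - slope| <= B.
  have := dom x 1 x1; rewrite mul1r; congr (`|_| <= _).
  under eq_bigr do rewrite mulrBl mulrAC -expr2.
  by rewrite sumrB -mulr_suml x2 mul1r; congr (_ - _); apply: eq_bigr => j _; rewrite mulrC.
have b2 := dom z 2 z2.
have -> : \sum_j row_mean j * z j - lambda * \sum_j x j * z j =
    \sum_j (row_mean j - x j * slope) * z j + (slope - lambda) * \sum_j x j * z j.
  under [X in _ = X + _]eq_bigr do rewrite mulrBl mulrAC.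
  by rewrite sumrB -mulr_suml; ring.
apply: le_trans (ler_normD _ _) _; rewrite normrM.
have b3 : `|slope - lambda| <= B + tau3 * (1 + M) * S3.
  by move: b1; rewrite !ler_norml => /andP[? ?]; apply/andP; split; lra.
have b4 : `|slope - lambda| * `|\sum_j x j * z j| <= (B + tau3 * (1 + M) * S3) * 2.
  by apply: ler_pM.
(* Write gap for tau3 (1 + M) S3. The two errors are 2 B and 2 (B + gap), so B <= gap / 2 brings the
   total to at most 4 gap. *)
have b5 : B <= tau3 * (1 + M) * S3 / 2.
  have X0 : 0 <= tau3 * S3 by nonneg.
  have MM : 2^-1 + M / 6 <= (1 + M) / 2 by lra.
  have -> : B = tau3 * S3 * (2^-1 + M / 6) by rewrite /B; ring.
  have -> : tau3 * (1 + M) * S3 / 2 = tau3 * S3 * ((1 + M) / 2) by ring.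
  exact: ler_wpM2l.
by lra.
Qed.

End Row.
End RowBias.

(** The integrand defining lambda is signed, so its positive and negative parts are transferred to
    [gauss] separately. The 2 is 1 plus the Gaussian second moment. *)
Lemma normal_linkH {R : realType} (theta : R -> R) (lambda : R) :
  (forall t, -1 <= theta t <= 1) -> C3 theta ->
  (\int[normal_prob 0 1]_t (theta t * t)%:E = lambda%:E)%E ->
  (\int[@gauss R]_s (linkH theta s)%:E = (lambda + 2)%:E)%E.
Proof.
move=> th1 thC3; rewrite integralE.
have mth := measurable_theta theta thC3; have mtt : measurable_fun setT (fun t : R => theta t * t).
  by meas.
rewrite (integral_normal_gauss _ (measurable_funepos (iffRL (measurable_EFinP _ _) mtt)) (fun=> funepos_ge0 _ _)).
rewrite (integral_normal_gauss _ (measurable_funeneg (iffRL (measurable_EFinP _ _) mtt)) (fun=> funeneg_ge0 _ _)).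
rewrite -integralE => lamE.
have j2 : intg (@gauss R) (fun t : R => t ^+ 2).
  by apply: intg_nneg; [meas|move=> t; exact: sqr_ge0|rewrite gauss_second_moment ltry].
have jt : intg (@gauss R) (fun t : R => theta t * t).
  apply: (@intg_dom _ _ _ _ _ (fun t : R => 1 + t ^+ 2)).
  - by meas.
  - move=> t; rewrite normrM (le_trans _ (norm_le_sqr t))// ler_piMl// ler_norml.
    exact: th1.
  - by apply: intgD => //; exact: intg_cst.
have j1 := intgD _ _ _ jt (intg_cst _ 1).
rewrite /linkH (meanE _ _ (intgD _ _ _ j1 j2)) (meanD _ _ _ j1 j2).
rewrite (meanD _ _ _ jt (intg_cst _ 1)) mean_cst /mean gauss_second_moment lamE.
by rewrite /= -addrA.
Qed.

(** * Uniform deviation *)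

Section Deviation.
Context {R : realType} {d : measure_display} {T : measurableType d}
  {P : probability T R} {m n : nat}.
Variables (mu : probability R R) (M Lam : R) (A : 'I_m -> 'I_n -> T -> R)
  (Y : 'I_m -> T -> R) (theta : R -> R) (x : 'I_n -> R).
Hypothesis smu : std_law mu M.
Hypothesis m0 : (0 < m)%N.
Hypothesis Lam0 : 0 < Lam.
Hypothesis mu_dom : forall f : R -> R, measurable_fun setT f ->
  (forall x, 0 <= f x) -> cvx1 f ->
  (\int[mu]_x (f x)%:E <= \int[@gauss R]_x (f (Lam * x))%:E)%E.
Hypothesis mA : forall i j, measurable_fun setT (A i j).
Hypothesis mY : forall i, measurable_fun setT (Y i).
Hypothesis iA : indep_law P (fun k : 'I_m * 'I_n => A k.1 k.2) (fun=> mu).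
Hypothesis Y1 : forall i w, Y i w = 1 \/ Y i w = -1.
Hypothesis th1 : forall t, -1 <= theta t <= 1.
Hypothesis thC3 : C3 theta.
Let th (a : env 'I_n R) : R := theta (wsum x (index_enum 'I_n) a).
Hypothesis model : cond_pm1_model P (gen_sigma (fun k : 'I_m * 'I_n => A k.1 k.2))
  Y (fun i w => th (fun j => A i j w)).
Local Notation v := (row_mean theta mu x).

Lemma intg_signed_row i j : intg P (fun w => Y i w * A i j w).
Proof.
apply: (intg_signed_entry mu M smu (A i) (mA i) (indep_row mu A iA i) (Y i) j (mY i)).
by move=> w; case: (Y1 i w) => ->; rewrite ?normrN normr1.
Qed.

(** Integrating out the label with weights (1 + theta) / 2 and (1 - theta) / 2 turns y_i a_j into
    theta a_j. The summand 1 + a_j^2 keeps the integrand nonnegative and cancels at the end. *)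
Lemma signed_row_mean i j : (\int[P]_w (Y i w * A i j w)%:E = (v j)%:E)%E.
Proof.
have jU := intg_signed_row i j.
have j2 := intg_row_sqr mu M smu (A i) (mA i) (indep_row mu A iA i) j.
have j1 := intgD P _ _ jU (intg_cst P 1).
pose h (b : bool) (a : env 'I_n R) := sgn b * a j + 1 + a j ^+ 2.
have mh b : measurable_fun setT (h b) by rewrite /h; meas.
have h0 b a : 0 <= h b a.
  by apply: theta_mul_ge; case: b; rewrite /sgn ?normrN normr1.
have mth : measurable_fun setT th by exact: measurable_thetaS.
have := integral_sign mu A Y th mA mY iA Y1 mth (fun a => th1 _) model i h mh h0.
have hE w : h (Y i w == 1) (arow A i w) = Y i w * A i j w + 1 + A i j w ^+ 2.
  rewrite /h /arow /sgn; case: (Y1 i w) => ->; first by rewrite eqxx.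
  by rewrite -subr_eq0 -opprD oppr_eq0 (_ : 1 + 1 == 0 = false)// (pnatr_eq0 R 2).
under eq_integral do rewrite hE.
rewrite (meanE P _ (intgD P _ _ j1 j2)) (meanD P _ _ j1 j2) (meanD P _ _ jU (intg_cst P 1)).
rewrite mean_cst (mean_row_sqr mu M smu (A i) (mA i) (indep_row mu A iA i)) (meanE P _ jU).
have rE w : h true (arow A i w) * wsgn th true (arow A i w) +
    h false (arow A i w) * wsgn th false (arow A i w) = row_test theta x j (arow A i w).
  by rewrite /h /wsgn /row_test /sgn /th; field.
under eq_integral do rewrite rE.
rewrite (row_testE theta th1 thC3 mu M x smu (A i) (mA i) (indep_row mu A iA i)).
by move=> [] e; congr (_%:E); lra.
Qed.

Definition deviation (w : T) : env 'I_n R := fun j => \sum_i (Y i w * A i j w - v j).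

Lemma measurable_deviation : measurable_fun setT deviation.
Proof.
apply: measurable_env => j; apply: measurable_sum => i.
by have mYi := mY i; have mAij := mA i j; meas.
Qed.

Context {dQ : measure_display}
  {Q : measurableType dQ} {PQ : probability Q R} {G : 'I_n -> Q -> R}.
Hypothesis mG : forall i, measurable_fun setT (G i).
Hypothesis iG : indep_law PQ G (fun=> @gauss R).
Local Notation vec := (@vec R 'I_n dQ Q G).

Section FiniteSet.
Variable Z : seq 'rV[R]_n.
Hypothesis Z4 : forall z, z \in Z -> dotv z z <= 4.

(** On the Gaussian side the factor 2 comes from removing the mean and the sign, [Lam] from convex
    domination, and the square root of m from adding the rows. *)
Lemma deviation_exp (r : R) : 0 < r ->
  (\int[P]_w (expR (r * maxF Z (deviation w)))%:E <=
   \int[PQ]_w (expR (2 * r * Lam * Num.sqrt m%:R * maxF Z (vec w)))%:E)%E.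
Proof.
move=> r0.
have rL0 : 0 < 2 * r * Lam by rewrite !mulr_gt0.
have F_supp u : exists z : 'I_n -> R, maxF Z u = \sum_i z i * u i /\
    forall v', \sum_i z i * v' i <= maxF Z v'.
  by have [z [_ ? ?]] := maxF_supp Z u Z4; exists z.
pose nu i := law_of P (urow A Y i) (measurable_urow A Y mA mY i).
have mH : measurable_fun setT (fun u : env 'I_m (env 'I_n R) =>
    (expR (maxF Z (fun j => 0 + \sum_(i <- index_enum 'I_m) r * (u i j - v j))))%:E).
  apply/measurable_EFinP; apply: (measurableT_comp (@measurable_expR R)).
  apply: (measurableT_comp (measurable_maxF Z)); apply: measurable_env => j.
  apply: measurable_funD; first exact: measurable_cst.
  apply: measurable_sum => i; apply: measurable_funM; first exact: measurable_cst.
  apply: measurable_funB; last exact: measurable_cst.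
  exact: (measurableT_comp (measurable_coord j) (measurable_coord i)).
have nu_dom (i : 'I_m) (c : env 'I_n R) :
    (\int[nu i]_u (expR (maxF Z (aff c r (fun j => u j - v j))))%:E <=
     \int[PQ]_w (expR (maxF Z (aff c (2 * r * Lam) (vec w))))%:E)%E.
  rewrite integral_law_of.
  - exact: (signed_row_dominated mG iG (maxF Z) (measurable_maxF Z) F_supp mu Lam mu_dom
      (A i) (Y i) v (mA i) (mY i) (indep_row mu A iA i) (Y1 i) (intg_signed_row i)
      (signed_row_mean i)).
  - apply/measurable_EFinP; apply: (measurableT_comp (@measurable_expR R)).
    apply: (measurableT_comp (measurable_maxF Z)); apply: measurable_env => j.
    by rewrite /aff; meas.
  - by move=> u; rewrite lee_fin expR_ge0.
have mth : measurable_fun setT th by exact: measurable_thetaS.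
have key := rows_dominated mG iG (maxF Z) (measurable_maxF Z) nu v Lam r rL0 nu_dom
  (index_enum 'I_m) (fun=> 0) (fun _ _ => 0) (index_enum_uniq _).
have E0 (u : env 'I_m (env 'I_n R)) :
    (0 <= (expR (maxF Z (fun j => 0 + \sum_(i <- index_enum 'I_m) r * (u i j - v j))))%:E)%E.
  by rewrite lee_fin expR_ge0.
rewrite -(indep_integral (measurable_urow A Y mA mY)
  (indep_urow mu A Y th mA mY iA Y1 mth (fun a => th1 _) model)
  (index_enum 'I_m) _ (fun _ _ => 0) (fun i => mem_index_enum i) mH E0) in key.
have sE : size (index_enum 'I_m) = m by rewrite -[RHS]card_ord cardT enumT.
move: key; rewrite sE.
under eq_integral => w _.
  rewrite (_ : maxF Z _ = r * maxF Z (deviation w)); last first.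
    rewrite -maxF_scale ?ltW//; congr maxF; apply/funext => j.
    by rewrite add0r -mulr_sumr.
  over.
move=> /le_trans; apply; rewrite le_eqVlt; apply/orP; left; apply/eqP.
apply: eq_integral => w _; rewrite -maxF_scale; last by rewrite !mulr_ge0// ltW.
by congr ((expR (maxF Z _))%:E); apply/funext => j; rewrite /aff add0r.
Qed.

Lemma deviation_prob (W beta : R) : 0 < beta ->
  (\int[PQ]_w (maxF Z (vec w))%:E <= W%:E)%E ->
  (P [set w | (Lam * Num.sqrt m%:R * (5 * W + 22 * beta) < maxF Z (deviation w))%R] <=
   (expR (- beta ^+ 2))%:E)%E.
Proof.
move=> b0 FW; set a := Lam * _ * _; set S := [set w | _].
have sm : 0 < Num.sqrt m%:R :> R by rewrite sqrtr_gt0 ltr0n.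
(* The Chernoff parameter gives the Gaussian side parameter beta. The exponent is then at most 5/2
   (beta W + 4 beta^2) - beta (5 W + 22 beta) / 2 = - beta^2, which explains 5 and 22. *)
pose r := beta / (2 * Lam * Num.sqrt m%:R).
have r0 : 0 < r by rewrite divr_gt0// !mulr_gt0.
have mF : measurable_fun setT (fun w => maxF Z (deviation w)).
  exact: (measurableT_comp (measurable_maxF Z) measurable_deviation).
have mS : measurable S.
  have -> : S = (fun w => maxF Z (deviation w)) @^-1` `]a, +oo[%classic.
    by apply/seteqP; split => w; rewrite /S /= in_itv/= andbT.
  by rewrite -[X in measurable X]setTI; apply: mF => //; exact: measurable_itv.
pose W0 := mean PQ (fun w => maxF Z (vec w)).
have W0E : (\int[PQ]_w (maxF Z (vec w))%:E = W0%:E)%E.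
  apply: meanE; apply: intg_nneg; first exact: measurable_maxF_vec.
    by move=> w; exact: maxF_ge0.
  by apply: le_lt_trans FW _; rewrite ltry.
have W0W : W0 <= W by move: FW; rewrite W0E lee_fin.
have F_supp u := maxF_supp Z u Z4.
have conc := gauss_concentration mG iG (maxF Z) (measurable_maxF Z) (maxF_ge0 Z) F_supp
  (maxF_exp_moment mG iG Z) W0 W0E beta (ltW b0).
have dE := deviation_exp r r0.
have rE : 2 * r * Lam * Num.sqrt m%:R = beta.
  by rewrite /r; field; rewrite !gt_eqF.
rewrite rE in dE.
have me : measurable_fun setT (fun w => expR (r * maxF Z (deviation w))).
  by apply: (measurableT_comp (@measurable_expR R)); apply: measurable_funM.
apply: (@le_trans _ _ (\int[P]_w (expR (- (r * a)) * expR (r * maxF Z (deviation w)))%:E)%E).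
  rewrite -(setIT S) -integral_indic//.
  apply: le_int.
  - exact: measurable_indic.
  - by apply: measurable_funM.
  - by move=> w.
  - move=> w; rewrite indicE; case: (boolP (w \in S)) => [|_]; last by rewrite mulr_ge0 ?expR_ge0.
    rewrite inE /S /= => aw; rewrite -expRD -[leLHS]expR0 ler_expR.
    by rewrite addrC subr_ge0 ler_wpM2l// ltW.
rewrite intZ; [|exact: me|exact: expR_ge0|by move=> w; exact: expR_ge0].
apply: (@le_trans _ _ ((expR (- (r * a)))%:E * (expR (5 / 2 * (beta * W0 + 4 * beta ^+ 2)))%:E)%E).
  by apply: lee_wpmul2l; [rewrite lee_fin expR_ge0|exact: le_trans dE conc].
rewrite -EFinM lee_fin -expRD ler_expR.
have -> : r * a = beta * (5 * W + 22 * beta) / 2.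
  by rewrite /r /a; field; rewrite !gt_eqF.
have := ler_wpM2l (ltW b0) W0W.
by lra.
Qed.

End FiniteSet.
End Deviation.

Lemma mutually_independent_law {R : realType} {d} {T : measurableType d}
    (P : probability T R) {I : finType} (X : I -> T -> R) (nu : I -> probability R R) :
  (forall i, same_law P (X i) (nu i)) -> mutually_independent P X -> indep_law P X nu.
Proof.
move=> Xnu iX B mB; have := iX B mB.
have -> : \bigcap_(i in [set: I]) (X i @^-1` B i) = [set w | forall i, B i (X i w)].
  by apply/seteqP; split => [w h i|w h i _]; [exact: (h i)|exact: h].
by move=> ->; congr (_%:E); apply: eq_bigr => i _; rewrite Xnu.
Qed.

(** For every box with rational centre and radius 1 / (N + 1) that meets K, one point of K in it is
    selected. Boxes that miss K, and integers that encode no box, fall back on [x]. *)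
Lemma countable_dense {R : realType} {n} (K : set 'rV[R]_n) (x : 'rV[R]_n) : K x ->
  exists D : nat -> 'rV[R]_n, (forall k, K (D k)) /\
    forall u, K u -> forall e : R, 0 < e ->
      exists k, forall j, `|u 0 j - D k 0 j| < e.
Proof.
move=> Kx; pose near (c : {ffun 'I_n -> rat} * nat) : set 'rV[R]_n :=
  [set u | K u /\ forall j, `|u 0 j - ratr (c.1 j)| < c.2.+1%:R^-1].
pose pt c := if pselect (exists u, near c u) is left h then projT1 (cid h) else x.
have Kpt c : K (pt c).
  by rewrite /pt; case: pselect => [h|//]; case: cid => u [].
pose D k := if unpickle k is Some c then pt c else x.
exists D; split=> [k|u Ku e e0]; first by rewrite /D; case: unpickle.
(* This makes 2 / (N + 1) < e: [u] and the selected point are both within 1 / (N + 1) of the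
   rational centre. *)
pose N := Num.truncn (2 / e); pose de : R := N.+1%:R^-1.
have de0 : 0 < de by rewrite invr_gt0 ltr0n.
have de2 : de + de < e.
  have : 2 / e < N.+1%:R by exact: truncnS_gt.
  rewrite ltr_pdivrMr// => h; rewrite (_ : de + de = 2 / N.+1%:R); last by rewrite /de; ring.
  by rewrite ltr_pdivrMr ?ltr0n// mulrC.
have q_ex j : {q : rat | `|u 0 j - ratr q| < de}.
  apply: cid; have /rat_in_itvoo[q] : u 0 j - de < u 0 j + de by lra.
  by rewrite in_itv/= => /andP[q1 q2]; exists q; rewrite ltr_norml; apply/andP; split; lra.
pose c : {ffun 'I_n -> rat} * nat := ([ffun j => projT1 (q_ex j)], N).
have uc : near c u by split => // j; rewrite /c /= ffunE; exact: (projT2 (q_ex j)).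
exists (pickle c) => j; rewrite /D pickleK /pt; case: pselect => [h|]; last first.
  by case; exists u.
case: cid => v /= [_ vc]; have [_ /(_ j) u1] := uc; have := vc j => v1.
apply: le_lt_trans de2; rewrite (_ : u 0 j - v 0 j = (u 0 j - ratr (c.1 j)) - (v 0 j - ratr (c.1 j))); last by ring.
by apply: le_trans (ler_normB _ _) _; apply: lerD; apply: ltW.
Qed.

(* The majorant need not be measurable. *)
Lemma ge0_le_integral_majorant {R : realType} {d} {T : measurableType d}
    (P : {measure set T -> \bar R}) (f g : T -> \bar R) :
  (forall w, 0 <= f w)%E -> (forall w, f w <= g w)%E ->
  (\int[P]_w f w <= \int[P]_w g w)%E.
Proof.
move=> f0 fg; have g0 w : (0 <= g w)%E by exact: le_trans (f0 w) (fg w).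
rewrite !ge0_integralTE//; apply: le_ereal_sup => _ /= [h hf <-]; exists h => // w.
exact: le_trans (hf w) (fg w).
Qed.

Section MeanWidth.
Context {R : realType} {n : nat} {dQ : measure_display} {Q : measurableType dQ}
  (PQ : probability Q R) (G : 'I_n -> Q -> R) (K : set 'rV[R]_n).

Lemma pairing_dotv (z : 'rV[R]_n) (u : env 'I_n R) : dotv (\row_j u j) z = pairing z u.
Proof. by apply: eq_bigr => j _; rewrite mxE mulrC. Qed.

Lemma maxF_le_mean_width (x : 'rV[R]_n) (Z : seq 'rV[R]_n) : K x ->
  (forall z, z \in Z -> minkowski_diff K z) ->
  (\int[PQ]_w (maxF Z (vec (G := G) w))%:E <= mean_width PQ G K)%E.
Proof.
move=> Kx ZK; apply: ge0_le_integral_majorant => w; first by rewrite lee_fin maxF_ge0.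
(* The difference x - x accounts for the default value of [maxF]. *)
have K0 : minkowski_diff K 0 by exists x, x; rewrite subrr.
have ub z : minkowski_diff K z -> ((pairing z (vec (G := G) w))%:E <=
    ereal_sup [set (dotv (\row_j G j w) u)%:E | u in minkowski_diff K])%E.
  by move=> Kz; apply: ereal_sup_ubound; exists z => //; rewrite pairing_dotv.
have [->|[z /ZK Kz ->]] := maxF_attained Z (vec (G := G) w); last exact: ub.
apply: le_trans (ub _ K0); rewrite lee_fin /pairing big1// => j _.
by rewrite mxE mul0r.
Qed.

End MeanWidth.

Section CountableEvent.
Context {R : realType} {d : measure_display} {T : measurableType d}
  (P : probability T R) {n : nat} (K : set 'rV[R]_n) (x : 'rV[R]_n).
Variables (dev : T -> env 'I_n R) (a p : R).
Hypothesis Kx : K x.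
Hypothesis mdev : measurable_fun setT dev.
Hypothesis finite_dev : forall Z : seq 'rV[R]_n,
  (forall z, z \in Z -> exists2 u, K u & z = u - x) ->
  (P [set w | (a < maxF Z (dev w))%R] <= p%:E)%E.

(** The bad events of the first k points of a dense sequence increase with k, so their union is
    measurable and keeps the bound [p] by continuity from below. Outside it, a continuous linear
    form is bounded on a dense part of K, hence on K. *)
Lemma uniform_deviation : exists E : set T, [/\ measurable E,
  ((1 - p)%:E <= P E)%E &
  forall w, E w -> forall u, K u -> pairing (u - x) (dev w) <= a].
Proof.
have [D [KD denseD]] := countable_dense K x Kx.
pose Z k := [seq D i - x | i <- iota 0 k].
pose S k := [set w | (a < maxF (Z k) (dev w))%R].
have mS k : measurable (S k).
  have -> : S k = (fun w => maxF (Z k) (dev w)) @^-1` `]a, +oo[%classic.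
    by apply/seteqP; split => w; rewrite /S /= in_itv/= andbT.
  rewrite -[X in measurable X]setTI.
  by apply: (measurableT_comp (measurable_maxF (Z k)) mdev) => //; exact: measurable_itv.
have mU : measurable (\bigcup_k S k) by exact: bigcup_measurable.
have nd : nondecreasing_seq S.
  move=> k l kl; apply/subsetPset => w; rewrite /S /= => /lt_le_trans; apply.
  apply: maxF_le; first exact: maxF_ge0.
  move=> z /mapP[i]; rewrite mem_iota add0n => /andP[_ ik] ->; apply: maxF_ge.
  by apply: map_f; rewrite mem_iota add0n (leq_trans ik kl).
have PU : (P (\bigcup_k S k) <= p%:E)%E.
  have cv := nondecreasing_cvg_mu (mu := P) mS mU nd.
  rewrite -(cvg_lim (@ereal_hausdorff R) cv); apply: lime_le.
    by apply/cvg_ex; exists (P (\bigcup_k S k)).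
  near=> k; apply: finite_dev => z /mapP[i _ ->].
  by exists (D i).
exists (~` \bigcup_k S k); split; first exact: measurableC.
  rewrite (probability_setC P mU) EFinB; exact: leeB.
move=> w Ew u Ku.
have Dk k : pairing (D k - x) (dev w) <= a.
  rewrite leNgt; apply/negP => h; apply: Ew; exists k.+1 => //.
  apply: lt_le_trans h _; apply: maxF_ge; apply/mapP; exists k => //.
  by rewrite mem_iota add0n ltnS leqnn.
apply/ler_addgt0Pr => e e0.
(* The summand 1 keeps the divisor positive when the deviation vanishes. *)
pose B := 1 + \sum_j `|dev w j|.
have B0 : 0 < B by rewrite ltr_pwDl// sumr_ge0.
have [k hk] := denseD u Ku (e / B) (divr_gt0 e0 B0).
have -> : pairing (u - x) (dev w) = pairing (D k - x) (dev w) + pairing (u - D k) (dev w).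
  by rewrite /pairing -big_split/=; apply: eq_bigr => j _; rewrite !mxE; ring.
apply: lerD => //; apply: le_trans (ler_norm _) _.
apply: le_trans (ler_norm_sum _ _ _) _.
apply: (@le_trans _ _ (\sum_j e / B * `|dev w j|)).
  apply: ler_sum => j _; rewrite normrM !mxE; apply: ler_wpM2r => //.
  exact: ltW (hk j).
rewrite -mulr_sumr mulrAC ler_pdivrMr//; apply: ler_wpM2l; first exact: ltW.
by rewrite /B lerDr.
Unshelve. all: by end_near.
Qed.

End CountableEvent.

(** * Euclidean geometry and the final estimate *)

Section Geometry.
Context {R : realType} {n : nat}.
Implicit Types u v x : 'rV[R]_n.

Lemma dotv_ge0 u : 0 <= dotv u u.
Proof. by apply: sumr_ge0 => j _; rewrite -expr2 sqr_ge0. Qed.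

Lemma dotv_sub u v : dotv (u - v) (u - v) = dotv u u + dotv v v - 2 * dotv u v.
Proof.
rewrite /dotv mulr_sumr -big_split/= -sumrB.
by apply: eq_bigr => j _; rewrite !mxE; ring.
Qed.

Lemma dotv_add u v : dotv (u + v) (u + v) = dotv u u + dotv v v + 2 * dotv u v.
Proof.
rewrite /dotv mulr_sumr -!big_split/=.
by apply: eq_bigr => j _; rewrite !mxE; ring.
Qed.

Lemma norm2_sqr u : norm2 u ^+ 2 = dotv u u.
Proof. by rewrite sqr_sqrtr// dotv_ge0. Qed.

Lemma unit_ball_dotv u : unit_ball u -> dotv u u <= 1.
Proof.
by rewrite /unit_ball /= -norm2_sqr => h; apply: exprn_ile1 => //; exact: sqrtr_ge0.
Qed.

Lemma unit_ball_dotv_norm u v : unit_ball u -> unit_ball v -> `|dotv u v| <= 1.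
Proof.
move=> /unit_ball_dotv hu /unit_ball_dotv hv.
have := dotv_ge0 (u - v); have := dotv_ge0 (u + v); rewrite dotv_sub dotv_add ler_norml.
by move=> h1 h2; apply/andP; split; lra.
Qed.

Lemma unit_ball_sub u v : unit_ball u -> unit_ball v -> dotv (u - v) (u - v) <= 4.
Proof.
move=> hu hv; rewrite dotv_sub.
have := unit_ball_dotv u hu; have := unit_ball_dotv v hv.
by have := unit_ball_dotv_norm u v hu hv; rewrite ler_norml => /andP[]; lra.
Qed.

Lemma sqr_entry_le u j : (u 0 j) ^+ 2 <= dotv u u.
Proof.
rewrite /dotv (bigD1 j)//= -expr2 lerDl.
by apply: sumr_ge0 => i _; rewrite -expr2 sqr_ge0.
Qed.

Lemma sum_cubes_le x : dotv x x = 1 -> \sum_j `|x 0 j| ^+ 3 <= norminf x.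
Proof.
move=> x1; rewrite -[leRHS]mulr1 -x1 /dotv mulr_sumr; apply: ler_sum => j _.
rewrite exprS -expr2 real_normK ?num_real//; apply: ler_wpM2r; first exact: sqr_ge0.
exact: (le_bigmax_cond 0 (fun j => `|x 0 j|)).
Qed.

Lemma norminf_ge0 x : 0 <= norminf x.
Proof. exact: bigmax_ge_id. Qed.

End Geometry.

Lemma objectiveB {R : realType} {m n : nat} (A : 'I_m -> 'I_n -> R) (y : 'I_m -> R)
    (u v : 'rV[R]_n) :
  objective A y (u - v) = objective A y u - objective A y v.
Proof.
rewrite /objective -sumrB; apply: eq_bigr => i _; rewrite -mulrBr; congr (_ * _).
by rewrite /dotv -sumrB; apply: eq_bigr => j _; rewrite !mxE mulrBr.
Qed.

Lemma pairing_deviation {R : realType} {d} {T : measurableType d} {m n : nat}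
    (mu : probability R R) (A : 'I_m -> 'I_n -> T -> R) (Y : 'I_m -> T -> R)
    (theta : R -> R) (x : 'I_n -> R) (w : T) (u : 'rV[R]_n) :
  pairing u (deviation mu A Y theta x w) =
  objective (fun i j => A i j w) (fun i => Y i w) u -
  m%:R * \sum_j row_mean theta mu x j * u 0 j.
Proof.
rewrite /objective /dotv mulr_sumr.
under [in RHS]eq_bigr do rewrite mulr_sumr.
rewrite exchange_big -sumrB; apply: eq_bigr => j _.
rewrite /deviation sumrB mulrBr sumr_const card_ord mulr_sumr.
congr (_ - _); last by rewrite -mulr_natl; ring.
by apply: eq_bigr => i _; rewrite mxE; ring.
Qed.

Theorem theorem1p3 (R : realType) :
  exists C : R, 0 < C /\
  forall (d : measure_display) (T : measurableType d) (P : probability T R)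
    (m n : nat) (mu : probability R R) (kappa : R)
    (A : 'I_m -> 'I_n -> {RV P >-> R}) (Y : 'I_m -> {RV P >-> R})
    (K : set 'rV[R]_n) (x : 'rV[R]_n) (theta : R -> R)
    (tau1 tau2 tau3 lambda : R)
    (dQ : measure_display) (Q : measurableType dQ) (PQ : probability Q R)
    (G : 'I_n -> {RV PQ >-> R}) (beta : R),
  (* the law of a: symmetric, E a^2 = 1, sub-gaussian with norm kappa *)
  symmetric_law mu ->
  (\int[mu]_t (t ^+ 2)%:E = 1)%E ->
  subgaussian_norm mu = kappa%:E ->
  (* a_1, ..., a_m with i.i.d. coordinates distributed as a *)
  (0 < m)%N ->
  (forall i j, same_law P (A i j) mu) ->
  mutually_independent P (fun k : 'I_m * 'I_n => (A k.1 k.2 : T -> R)) ->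
  (* K and x *)
  K `<=` @unit_ball R n -> K x -> norm2 x = 1 ->
  (* the link function theta *)
  (forall t, -1 <= theta t <= 1) ->
  C3 theta ->
  (forall t, `|derive1n 1 theta t| <= tau1) ->
  (forall t, `|derive1n 2 theta t| <= tau2) ->
  (forall t, `|derive1n 3 theta t| <= tau3) ->
  (\int[normal_prob 0 1]_t (theta t * t)%:E = lambda%:E)%E ->
  0 < lambda ->
  (* the responses y_i *)
  (forall i w, Y i w = 1 \/ Y i w = -1) ->
  cond_pm1_model P
    (gen_sigma (fun k : 'I_m * 'I_n => (A k.1 k.2 : T -> R)))
    (fun i => (Y i : T -> R))
    (fun i w => theta (dotv (\row_j A i j w) x)) ->
  (* g = (G_j)_j a standard Gaussian vector, used to compute w(K) *)
  (forall j, same_law PQ (G j) (normal_prob 0 1)) ->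
  mutually_independent PQ (fun j => (G j : Q -> R)) ->
  0 < beta ->
  exists E : set T, measurable E /\
    ((1 - 4 * expR (- beta ^+ 2))%:E <= P E)%E /\
    forall w, E w ->
    forall xh, K xh ->
      (forall x', K x' ->
         objective (fun i j => A i j w) (fun i => Y i w) x'
         <= objective (fun i j => A i j w) (fun i => Y i w) xh) ->
      (((norm2 (x - xh)) ^+ 2)%:E <=
      C%:E * ((kappa ^+ 4 / lambda * (tau2 + tau3) * norminf x)%:E
              + (kappa / (lambda * Num.sqrt m%:R))%:E
                * (mean_width PQ (fun j => (G j : Q -> R)) K + beta%:E)))%E.
Proof.
(* With X and V the two terms of the bound, the end of the proof gives q <= 128 * 22 V + 4 * 404 X,
   so 2 q <= 5632 V + 3232 X. *)
have [C C0 C6] : exists2 C : R, 0 < C & 60 * 100 <= C.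
  by exists (60 * 100); [rewrite mulr_gt0|exact: lexx].
exists C; split; first exact: C0.
move=> d T P m n mu kappa A Y K x theta tau1 tau2 tau3 lambda dQ Q PQ G beta
  smu var sg m0 Alaw Aind KB Kx x1 th1 thC3 t1 t2 t3 lamE lam0 Y1 model Glaw Gind b0.
have k0 : 0 < kappa := subgaussian_norm_gt0 mu kappa sg var.
have k4 : 4^-1 <= kappa ^+ 4.
  have k2 := subgaussian_norm_sqr_ge mu kappa sg var.
  have -> : 4^-1 = 2^-1 ^+ 2 :> R by rewrite exprVn -natrX.
  by rewrite (exprM kappa 2 2); apply: lerXn2r; rewrite ?nnegrE ?sqr_ge0 ?invr_ge0.
have sm : 0 < Num.sqrt m%:R :> R by rewrite sqrtr_gt0 ltr0n.
have xx : dotv x x = 1 by rewrite -norm2_sqr x1 expr1n.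
have inf0 : 0 <= norminf x := norminf_ge0 x.
have t20 : 0 <= tau2 := le_trans (normr_ge0 _) (t2 0).
have t30 : 0 <= tau3 := le_trans (normr_ge0 _) (t3 0).
pose g := fun j => (G j : Q -> R); rewrite -/g.
have mw0 : (0 <= mean_width PQ g K)%E.
  apply: le_trans (maxF_le_mean_width PQ g K x [::] Kx _) => //.
  by apply: int_ge0 => w; exact: maxF_ge0.
(* For an infinite width the right side is infinite, and the whole space is a valid event. *)
case mwE : (mean_width PQ g K) mw0 => [W| |]//; last first.
  exists setT; split; first exact: measurableT; split.
    have -> : P setT = 1%E by exact: probability_setT.
    by rewrite lee_fin gerBl mulr_ge0// expR_ge0.
  move=> w _ xh _ _; rewrite addye ?ltNyr// gt0_muley ?lte_fin ?divr_gt0 ?mulr_gt0//.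
  by rewrite addey ?ltNyr// gt0_muley ?lte_fin// leey.
rewrite lee_fin => W0.
pose M := 400 * kappa ^+ 4.
have M100 : 100 <= M by rewrite /M; lra.
have std : std_law mu M := subgaussian_std_law mu kappa smu sg var.
pose Lam := 128 * kappa.
have Lam0 : 0 < Lam by rewrite mulr_gt0.
have mu_dom (f : R -> R) : measurable_fun setT f -> (forall x, 0 <= f x) -> cvx1 f ->
    (\int[mu]_x (f x)%:E <= \int[@gauss R]_x (f (Lam * x))%:E)%E.
  exact: gauss_dominates.
have iA : indep_law P (fun k : 'I_m * 'I_n => (A k.1 k.2 : T -> R)) (fun=> mu).
  by apply: mutually_independent_law => // k; exact: Alaw.
have iG : indep_law PQ g (fun=> @gauss R).
  by apply: mutually_independent_law => // j; exact: Glaw.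
pose a := fun i j => (A i j : T -> R); pose y := fun i => (Y i : T -> R).
have ma i j : measurable_fun setT (a i j) by exact: measurable_funPT.
have my i : measurable_fun setT (y i) by exact: measurable_funPT.
have mg j : measurable_fun setT (g j) by exact: measurable_funPT.
pose xf j := x 0 j.
have model' : cond_pm1_model P (gen_sigma (fun k : 'I_m * 'I_n => a k.1 k.2)) y
    (fun i w => theta (wsum xf (index_enum 'I_n) (fun j => a i j w))).
  have -> // : (fun i w => theta (wsum xf (index_enum 'I_n) (fun j => a i j w))) =
    (fun i w => theta (dotv (\row_j A i j w) x)).
  apply/funext => i; apply/funext => w; congr theta.
  by apply: eq_bigr => j _; rewrite mxE mulrC.
pose dev := deviation mu a y theta xf.
have mdev : measurable_fun setT dev by exact: measurable_deviation.
pose B := Lam * Num.sqrt m%:R * (5 * W + 22 * beta).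
have finite_dev (Z : seq 'rV[R]_n) : (forall z, z \in Z -> exists2 u, K u & z = u - x) ->
    (P [set w | (B < maxF Z (dev w))%R] <= (expR (- beta ^+ 2))%:E)%E.
  move=> ZK; apply: (deviation_prob mu M Lam a y theta xf std m0 Lam0 mu_dom ma my iA Y1 th1
    thC3 model' mg iG Z _ W beta b0).
    by move=> z /ZK[u Ku ->]; apply: unit_ball_sub; exact: KB.
  rewrite -mwE; apply: (maxF_le_mean_width PQ g K x Z Kx) => z /ZK[u Ku ->].
  by exists u, x.
(* The bias is deterministic, so this is the only exceptional event, of probability at most exp(-
   beta^2). *)
have [E [mE PE devE]] := uniform_deviation P K x dev B _ Kx mdev finite_dev.
exists E; split => //; split.
  by apply: le_trans PE; rewrite lee_fin; have := expR_ge0 (- beta ^+ 2); lra.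
move=> w Ew xh Kxh /(_ x Kx) opt.
have := devE w Ew xh Kxh.
pose z := x - xh; pose zf j := z 0 j.
pose S := \sum_j row_mean theta mu xf j * zf j.
have zN : \sum_j row_mean theta mu xf j * (xh - x) 0 j = - S.
  by rewrite /S -sumrN; apply: eq_bigr => j _; rewrite /zf /z !mxE; ring.
rewrite (pairing_deviation mu a y theta xf w (xh - x)) zN objectiveB => devB.
have S_le : m%:R * S <= B by move: opt devB; clear; lra.
have xzE : \sum_j xf j * zf j = 1 - dotv x xh.
  by rewrite -xx /dotv -sumrB; apply: eq_bigr => j _; rewrite /xf /zf /z !mxE; ring.
have xz1 : `|\sum_j xf j * zf j| <= 2.
  have := unit_ball_dotv_norm x xh (KB _ Kx) (KB _ Kxh).
  by rewrite xzE !ler_norml => /andP[h1 h2]; apply/andP; split; move: h1 h2; clear; lra.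
have z2 j : `|zf j| <= 2.
  rewrite -(@ler_pXn2r _ 2)// ?nnegrE// real_normK ?num_real//.
  apply: le_trans (sqr_entry_le z j) _; apply: le_trans (unit_ball_sub x xh (KB _ Kx) (KB _ Kxh)) _.
  by rewrite -natrX.
have x2 : \sum_j xf j ^+ 2 = 1 by rewrite -xx; apply: eq_bigr => j _; rewrite expr2.
have := link_bias theta tau1 tau3 th1 thC3 t1 t3 mu M xf std (a (Ordinal m0)) (ma _)
  (indep_row mu a iA _) lambda zf M100 x2 (normal_linkH theta lambda th1 thC3 lamE) z2 xz1.
rewrite -/S xzE ler_norml => /andP[+ _].
set q := 1 - dotv x xh; set S3 := \sum_j _; pose N := Num.sqrt m%:R : R; rewrite -/N => bias.
have S3_le : S3 <= norminf x by exact: sum_cubes_le.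
have mN : m%:R = N ^+ 2 :> R by rewrite sqr_sqrtr// ler0n.
have SN : S <= Lam * (5 * W + 22 * beta) / N.
  rewrite ler_pdivlMr// -(ler_pM2l sm) -/N.
  by move: S_le; rewrite mN /B -/N expr2; clear; lra.
have zz : norm2 (x - xh) ^+ 2 <= 2 * q.
  rewrite norm2_sqr dotv_sub xx /q.
  by have := unit_ball_dotv xh (KB _ Kxh); clear; lra.
rewrite -!(EFinM, EFinD) lee_fin; apply: le_trans zz _.
(* Here 1 + M <= 404 kappa^4, because 1 <= 4 kappa^4. *)
have e1 : tau3 * (1 + M) * S3 <= 404 * kappa ^+ 4 * (tau3 * norminf x).
  have -> : 404 * kappa ^+ 4 * (tau3 * norminf x) = tau3 * (404 * kappa ^+ 4) * norminf x by ring.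
  apply: ler_pM => //; first by apply: mulr_ge0 => //; move: M100; clear; lra.
    by apply: sumr_ge0 => j _; exact: exprn_ge0.
  by apply: ler_wpM2l => //; move: k4; rewrite /M; clear; lra.
have lq : lambda * q <= 128 * kappa * (5 * W + 22 * beta) / N +
    4 * (404 * kappa ^+ 4 * (tau3 * norminf x)).
  by move: bias e1 SN; rewrite /Lam; clear; lra.
pose X := kappa ^+ 4 / lambda * (tau2 + tau3) * norminf x.
pose V := kappa / (lambda * N) * (W + beta).
have l1 : 0 <= lambda^-1 by rewrite invr_ge0 ltW.
have V0 : 0 <= kappa / (lambda * N) by rewrite divr_ge0 ?mulr_ge0// ltW.
have k40 : 0 <= kappa ^+ 4 by rewrite exprn_ge0 ?ltW.
have X3 : kappa ^+ 4 / lambda * tau3 * norminf x <= X.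
  by apply: ler_wpM2r => //; apply: ler_wpM2l; [exact: mulr_ge0|rewrite lerDr].
have X30 : 0 <= kappa ^+ 4 / lambda * tau3 * norminf x.
  by apply: mulr_ge0 => //; apply: mulr_ge0 => //; exact: mulr_ge0.
have V1 : kappa / (lambda * N) * (5 * W + 22 * beta) <= 22 * V.
  by rewrite /V mulrCA; apply: ler_wpM2l => //; move: W0; clear; lra.
have V2 : 0 <= V by apply: mulr_ge0 => //; rewrite addr_ge0// ltW.
have q_le : q <= 128 * (kappa / (lambda * N) * (5 * W + 22 * beta)) +
    4 * 404 * (kappa ^+ 4 / lambda * tau3 * norminf x).
  rewrite -(ler_pM2l lam0); apply: le_trans lq _; rewrite le_eqVlt; apply/orP; left.
  by apply/eqP; field; rewrite !gt_eqF.
apply: (@le_trans _ _ (60 * 100 * (X + V))).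
  by move: q_le X3 X30 V1 V2; clear; lra.
by apply: ler_wpM2r => //; rewrite addr_ge0// (le_trans X30).
Qed.
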